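(* Let $1<Q<+\infty$ and $1\le p<+\infty$. Suppose that $(X,d,\mu)$ is a complete, unbounded metric measure space with metric $d$ and Ahlfors $Q$-regular measure $\mu$ supporting a $p$-Poincaré inequality. If $Q<p<+\infty$, then for every $u\in N^{1,p}(X)$, $$\lim_{x\to+\infty}u(x)=0.$$ If $1\le p\le Q$, then for every $u\in N^{1,p}(X)$ there exists a $p$-thin set $E$ such that $$\lim_{E\not\ni x\to+\infty}u(x)=0.$$ Furthermore (in the case $1\le p\le Q$), if there exist $c'\in\mathbb R$ and a $p$-thin set $E'\subset X$ such that $\lim_{E'\not\ni x\to+\infty}u(x)=c'$, then $c'=0$.
   Context: A metric measure space $(X,d,\mu)$ is a separable metric space $(X,d)$ with a nontrivial locally finite Borel-regular measure $\mu$. $B(x,r)$ is the ball of center $x$ and radius $r$. $\mu$ is Ahlfors $Q$-regular if there is a constant $C_Q\ge1$ with $r^Q/C_Q\le\mu(B(x,r))\le C_Qr^Q$ for all $x\in X$, $r>0$. Upper gradient: a Borel function $\rho:X\to[0,+\infty]$ is an upper gradient of a locally integrable function $u$ if $|u(x)-u(y)|\le\int_\gamma\rho\,ds$ for every rectifiable curve $\gamma$ connecting $x$ and $y$ (for all $x,y\in X$). $\dot N^{1,p}(X)$ is the collection of all locally integrable functions on $X$ (defined pointwise everywhere) that have a $p$-integrable upper gradient on $X$, and $N^{1,p}(X):=\dot N^{1,p}(X)\cap L^p_\mu(X)$, where $L^p_\mu(X)$ consists of all $p$-integrable functions. $p$-Poincaré inequality: every ball has finite positive measure and there are finite constants $C>0$,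 $\lambda\ge1$ such that $\frac1{\mu(B(x,r))}\int_{B(x,r)}|u-u_{B(x,r)}|\,d\mu\le Cr\left(\frac1{\mu(B(x,\lambda r))}\int_{B(x,\lambda r)}\rho^p\,d\mu\right)^{1/p}$ for all balls $B(x,r)$ and all pairs $(u,\rho)$ with $u$ integrable on balls and $\rho$ an upper gradient of $u$, where $u_A=\frac1{\mu(A)}\int_Au\,d\mu$. A base point $O\in X$ is fixed, $|x|:=d(O,x)$, and $x\to+\infty$ means $|x|\to+\infty$; $\lim_{E\not\ni x\to+\infty}$ is the limit along $x\in X\setminus E$. Hausdorff content: for $\beta\ge0$, $\mathcal H^\beta_{+\infty}(E)=\inf\{\sum_kr_k^\beta: E\subset\bigcup_kB_k,\ B_k \text{ a ball of radius } r_k\in(0,+\infty)\}$ (countable covers). $p$-thin set (for $1\le p\le Q$): $E\subset X$ is $p$-thin if there is a finite constant $C\ge1$ such that $\lim_{k\to+\infty}\sum_{j=k}^{+\infty}\frac{\mathcal H^{Q-(p-\alpha)}_{+\infty}(E\cap A_{C2^{j+1}})}{(C2^{j+1})^\alpha}=0$ for all $0<\alpha<p$, where $A_{C2^{j+1}}:=B(O,C2^{j+2})\setminus B(O,C2^{j+1})$. *)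

(* Defs.v *)
From HB Require Import structures.
From mathcomp Require Import all_boot all_order all_algebra.
From mathcomp Require Import all_classical all_reals all_analysis.
From mathcomp Require Import measurable_realfun.

Set Implicit Arguments.
Unset Strict Implicit.
Unset Printing Implicit Defensive.

Import Order.TTheory GRing.Theory Num.Theory.
Import numFieldNormedType.Exports.

Local Open Scope classical_set_scope.
Local Open Scope ring_scope.

(* The measure theory of the library requires pointed types, so metric spaces
   are taken nonempty; the point is used only as a witness of nonemptiness. *)
#[short(type="pmetricType")]
HB.structure Definition PointedMetric (K : numDomainType) :=
  {M of Metric K M & isPointed M}.

#[short(type="completeMetricType")]
HB.structure Definition CompleteMetric (K : numDomainType) :=
  {M of PointedMetric K M & Uniform_isComplete M}.

Section MetricMeasureSpace.
Context {R : realType} {X : pmetricType R}.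

Definition borel : set (set X) := <<s @open X >>.

Definition separable_space : Prop :=
  exists2 D : set X, countable D & dense D.

(* diam X = +oo *)
Definition unbounded_space : Prop :=
  forall M : R, exists x y : X, M < mdist x y.

(* As usual in analysis on metric spaces, a measure on X is an outer measure,
   defined on all subsets of X. Integrals are taken with respect to its
   restriction to the sigma-algebra of Caratheodory measurable sets. *)
Definition cara (mu : {outer_measure set X -> \bar R}) :
    {measure set (caratheodory_type mu) -> \bar R} :=
  (mu : set (caratheodory_type mu) -> \bar R).

Variable mu : {outer_measure set X -> \bar R}.

Definition borel_regular : Prop :=
  borel `<=` mu.-caratheodory /\
  forall A : set X, exists B : set X, [/\ borel B, A `<=` B & mu B = mu A].

Definition locally_finite : Prop :=
  forall x : X, exists2 U : set X, nbhs x U & (mu U < +oo)%E.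

Definition metric_measure_space : Prop :=
  [/\ separable_space, borel_regular, locally_finite & mu [set: X] <> 0%E].

Definition ahlfors_regular (Q : R) : Prop :=
  exists2 C : R, 1 <= C &
    forall (x : X) (r : R), 0 < r ->
      ((r `^ Q / C)%:E <= mu (ball x r) <= (C * r `^ Q)%:E)%E.

(* Curves are maps R -> X, considered on a compact interval [a, b]. *)
Definition curve_length (a b : R) (g : R -> X) : \bar R :=
  ereal_sup [set (\sum_(0 <= i < size s)
      mdist (g (nth b (a :: s) i)) (g (nth b (a :: s) i.+1)))%:E
    | s in itv_partition a b].

Definition rectifiable (a b : R) (g : R -> X) : Prop :=
  {within `[a, b], continuous g} /\ (curve_length a b g < +oo)%E.

(* Arc-length parametrization g o l^-1 on [0, length g], where l t is the
   length of g on [a, t] and l^-1 s is the largest t such that l t = s. *)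
Definition arc_param (a b : R) (g : R -> X) (s : R) : X :=
  g (sup [set t | t \in `[a, b] /\ curve_length a t g = s%:E]).

Definition line_integral (a b : R) (g : R -> X) (rho : X -> \bar R) : \bar R :=
  (\int[lebesgue_measure]_(s in `[0%R, fine (curve_length a b g)])
     rho (arc_param a b g s))%E.

Definition upper_gradient (u : X -> R) (rho : X -> \bar R) : Prop :=
  [/\ measurable_fun [set: g_sigma_algebraType (@open X)] rho,
      (forall x, (0 <= rho x)%E) &
      forall (a b : R) (g : R -> X), a <= b -> rectifiable a b g ->
        (`|u (g a) - u (g b)|%:E <= line_integral a b g rho)%E].

Definition loc_integrable (u : X -> R) : Prop :=
  forall x : X, exists2 U : set X, nbhs x U &
    (cara mu).-integrable U (EFin \o u).

Definition integrable_on_balls (u : X -> R) : Prop :=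
  forall (x : X) (r : R), 0 < r ->
    (cara mu).-integrable (ball x r) (EFin \o u).

Definition dotN1p (p : R) (u : X -> R) : Prop :=
  loc_integrable u /\
  exists2 rho : X -> \bar R, upper_gradient u rho &
    (\int[cara mu]_x (rho x `^ p) < +oo)%E.

Definition N1p (p : R) (u : X -> R) : Prop :=
  dotN1p p u /\ u \in Lfun (cara mu) p%:E.

Definition mean (A : set X) (u : X -> R) : R :=
  (fine (mu A))^-1 * Rintegral (cara mu) A u.

Definition poincare (p : R) : Prop :=
  (forall (x : X) (r : R), 0 < r -> (0 < mu (ball x r) < +oo)%E) /\
  exists C lambda : R, [/\ 0 < C, 1 <= lambda &
    forall (u : X -> R) (rho : X -> \bar R),
      integrable_on_balls u -> upper_gradient u rho ->
      forall (x : X) (r : R), 0 < r ->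
        (((fine (mu (ball x r)))^-1)%:E *
           \int[cara mu]_(y in ball x r) `|u y - mean (ball x r) u|%:E
         <= (C * r)%:E *
            (((fine (mu (ball x (lambda * r))))^-1)%:E *
               \int[cara mu]_(y in ball x (lambda * r)) (rho y `^ p))
            `^ p^-1)%E].

End MetricMeasureSpace.

Arguments unbounded_space {R} X.

Section ThinSets.
Context {R : realType} {X : pmetricType R}.

(* Countable covers, possibly finite, are indexed by a set D of naturals. *)
Definition hausdorff_content (beta : R) (E : set X) : \bar R :=
  ereal_inf [set t | exists (D : set nat) (c : nat -> X) (r : nat -> R),
    [/\ (forall k, D k -> 0 < r k),
        E `<=` \bigcup_(k in D) ball (c k) (r k) &
        t = (\esum_(k in D) (r k `^ beta)%:E)%E]].

Definition annulus (O : X) (r : R) : set X := ball O (2 * r) `\` ball O r.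

Definition thin (O : X) (Q p : R) (E : set X) : Prop :=
  exists2 C : R, 1 <= C &
    forall alpha : R, 0 < alpha < p ->
      (fun k : nat => (\sum_(k <= j <oo)
         hausdorff_content (Q - (p - alpha))%R
           (E `&` annulus O (C * 2 ^+ j.+1)%R)
         * (((C * 2 ^+ j.+1) `^ alpha)^-1)%:E)%E) @ \oo --> 0%E.

Definition at_infinity (O : X) : set_system X :=
  filter_from [set: R] (fun M => [set x | M < mdist O x]).

End ThinSets.

(* Main.v *)
(* Let rho be a lower semicontinuous majorant of an upper gradient of u with
   rho in L^p (Vitali-Caratheodory), and call x good if the rho^p-energy of the
   balls B(x, lambda r), r = 2^(1-i), is at most S r^(Q - p + al) for all i.
   The core is a pointwise estimate at every good point, not only at Lebesgue
   points: |u x - u y| <= K (b(x) + b(y)) for good x, y with d(x, y) < 1.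
   If it failed, replace u by the discrete path distance w_n from x, the least
   cost sum f_n(z_i) d(z_i, z_(i+1)) of a chain with small steps, where f_n are
   Lipschitz functions increasing to rho. The w_n are continuous, so that
   telescoping the Poincare inequality over dyadic balls bounds w_n(y) by
   K (b(x) + b(y)) for every n. Cheap chains from x to y converge, along an
   ultrafilter and by properness of X, to a curve along which the integral of
   rho is small, and rho dominates an upper gradient of u.
   Near a far point x there is a good y with u y small, since u and rho are in
   L^p; this gives decay at good points. Points that are not good are covered at
   each dyadic scale by a separated net, which bounds their content and shows
   that they form a p-thin set, empty far away if p > Q. A limit c <> 0 along
   the complement of a thin set is impossible: |u| >= |c|/2 has finite measure,
   while the annuli, nonempty by connectedness, have measure ~ r^Q and hence
   content >= c r^(Q - p + al) inside the thin set. *)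
Require Import Defs.
From mathcomp Require Import all_boot all_order all_algebra.
From mathcomp Require Import all_classical all_reals all_analysis.
From mathcomp Require Import measurable_realfun.
From mathcomp Require Import ring lra.

Import Order.TTheory GRing.Theory Num.Theory.
Import numFieldNormedType.Exports.
Local Open Scope classical_set_scope.
Local Open Scope ring_scope.

Set Implicit Arguments.
Unset Strict Implicit.
Unset Printing Implicit Defensive.

(** * Curves and arc length *)

(** The obstacle is that [u] is defined everywhere and only has an upper gradient: telescoping means
    around [x] recovers [u x] at Lebesgue points only, while a null set may be far too large for a
    content estimate. The functions [w_n] avoid this because they are continuous, and the constant
    stays independent of [n] because every [w_n] has the upper gradient [4 * f_n <= 4 * rho]. [rho]
    is first raised to a floor [eta > 0], so that a chain of cost [T] has length at most [T / eta],
    which gives equicontinuity; [eta] is small enough to at most double the energy bounds at [x] and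
    [y]. The exponent in the definition of good points is dictated by scaling: energy
    [S * r^(Q - p + al)] becomes oscillation of order [S^(1/p) * r^(al/p)], summable over dyadic
    [r]. For [p > Q], [al = p - Q] removes the radius, so that far points are good by finiteness of
    the energy. For [p <= Q], the level [S] in the [j]-th annulus is of order [1 / (j + 1)]: it
    tends to zero, yet the content of the bad points grows only linearly in [j], which the weights
    [2^(- al * j)] absorb. *)

Section CurveLength.
Context {R : realType} {X : pmetricType R}.
Implicit Types (a b c : R) (g : R -> X) (s : seq R).

Fixpoint poly_length g a s : R :=
  if s is x :: s' then mdist (g a) (g x) + poly_length g x s' else 0.

Lemma poly_length_cat g a s t :
  poly_length g a (s ++ t) = poly_length g a s + poly_length g (last a s) t.
Proof. by elim: s a => [|x s ih] a /=; rewrite ?add0r// ih addrA. Qed.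

Lemma poly_lengthE g a b s :
  \sum_(0 <= i < size s)
    mdist (g (nth b (a :: s) i)) (g (nth b (a :: s) i.+1)) = poly_length g a s.
Proof.
elim: s a => [|x s ih] a; first by rewrite big_nil.
by rewrite /= big_nat_recl//= -ih.
Qed.

Lemma curve_lengthE a b g : curve_length a b g =
  ereal_sup [set (poly_length g a s)%:E | s in itv_partition a b].
Proof.
by rewrite /curve_length; congr ereal_sup; apply: eq_imagel => s _ /=;
  rewrite poly_lengthE.
Qed.

Lemma poly_length_le_curve a b g s : itv_partition a b s ->
  ((poly_length g a s)%:E <= curve_length a b g)%E.
Proof. by move=> abs; rewrite curve_lengthE; apply: ereal_sup_ubound; exists s. Qed.

Lemma itv_partition_refl a : itv_partition a a [::].
Proof. by rewrite /itv_partition/= eqxx. Qed.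

Lemma itv_partition_exists a b : a <= b -> exists2 s, itv_partition a b s &
  forall g, poly_length g a s = mdist (g a) (g b).
Proof.
rewrite le_eqVlt => /predU1P[->|ab].
  by exists [::] => [|g]; [exact: itv_partition_refl|rewrite mdistxx].
by exists [:: b] => [|g]; [exact: itv_partition1|rewrite /= addr0].
Qed.

Lemma curve_length_ge_mdist a b g : a <= b ->
  ((mdist (g a) (g b))%:E <= curve_length a b g)%E.
Proof.
move=> /itv_partition_exists[s abs <-]; exact: poly_length_le_curve.
Qed.

Lemma curve_length_ge0 a b g : a <= b -> (0 <= curve_length a b g)%E.
Proof.
move=> ab; apply: le_trans (curve_length_ge_mdist g ab).
by rewrite lee_fin mdist_ge0.
Qed.

Lemma curve_lengthxx a g : curve_length a a g = 0%E.
Proof.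
apply/eqP; rewrite eq_le curve_length_ge0// andbT curve_lengthE.
by apply: ge_ereal_sup => _ [s /itv_partitionxx -> <-].
Qed.

(** The edge that jumps over [c] is split at [c]; by the triangle inequality the polygon can only
    get longer. *)
Lemma poly_length_insert a b c g s : a <= c -> c <= b -> itv_partition a b s ->
  exists s1 s2, [/\ itv_partition a c s1, itv_partition c b s2 &
    poly_length g a s <= poly_length g a s1 + poly_length g c s2].
Proof.
elim: s a => [|x s ih] a ac cb abs.
  have ab := itv_partition_nil abs; move: ac cb; rewrite -ab => ac ca.
  have -> : c = a by apply/le_anti; rewrite ac ca.
  exists [::], [::]; split; [exact: itv_partition_refl..|].
  by rewrite /= addr0.
have xs := itv_partition_cons abs.
have [xc|cx] := leP x c.
  have [s1 [s2 [s1P s2P le12]]] := ih _ xc cb xs.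
  exists (x :: s1), s2; split => //=; last by rewrite -addrA lerD2l.
  case: abs s1P => /= /andP[ax _] _ [ps1 ls1].
  by split => //=; rewrite ax.
have [s1 s1P s1E] := itv_partition_exists ac.
exists s1, (x :: s); split => //.
  by case: xs => xs1 xs2; split => //=; rewrite cx.
by rewrite s1E /= addrA lerD2r metric_triangle.
Qed.

Lemma curve_length_cat a b c g : a <= c -> c <= b ->
  curve_length a b g = (curve_length a c g + curve_length c b g)%E.
Proof.
move=> ac cb; apply/eqP; rewrite eq_le; apply/andP; split.
  rewrite [in leLHS]curve_lengthE; apply: ge_ereal_sup => _ [s abs <-].
  have [s1 [s2 [s1P s2P le12]]] := poly_length_insert g ac cb abs.
  apply: (@le_trans _ _ ((poly_length g a s1)%:E + (poly_length g c s2)%:E)%E).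
    by rewrite -EFinD lee_fin.
  by apply: leeD; exact: poly_length_le_curve.
have key s1 s2 : itv_partition a c s1 -> itv_partition c b s2 ->
    ((poly_length g a s1)%:E + (poly_length g c s2)%:E <= curve_length a b g)%E.
  move=> s1P s2P; rewrite -EFinD.
  have -> : poly_length g c s2 = poly_length g (last a s1) s2.
    by case: s1P => _ /eqP ->.
  rewrite -poly_length_cat; apply: poly_length_le_curve.
  exact: itv_partition_cat s1P s2P.
(* The suprema over [s1] and [s2] are taken one after the other, moving the other length across the
   inequality, which requires a finite total. *)
have [->|] := eqVneq (curve_length a b g) +oo%E; first exact: leey.
move=> abfin.
have {}abfin : curve_length a b g \is a fin_num.
  by rewrite fin_numE abfin andbT gt_eqF// (lt_le_trans _ (curve_length_ge0 _ (le_trans ac cb))).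
have key1 s2 : itv_partition c b s2 ->
    (curve_length a c g <= curve_length a b g - (poly_length g c s2)%:E)%E.
  move=> s2P; rewrite curve_lengthE; apply: ge_ereal_sup => _ [s1 s1P <-].
  by rewrite leeBrDr//; exact: key.
have acfin : curve_length a c g \is a fin_num.
  have [s2 s2P _] := itv_partition_exists cb.
  rewrite ge0_fin_numE ?curve_length_ge0//.
  apply: le_lt_trans (key1 _ s2P) _.
  by rewrite -(fineK abfin) -EFinB ltry.
rewrite addeC -leeBrDr//.
rewrite [leLHS]curve_lengthE; apply: ge_ereal_sup => _ [s2 s2P <-].
by rewrite leeBrDr// addeC -leeBrDr//; exact: key1.
Qed.

End CurveLength.

Section RectifiableCurve.
Context {R : realType} {X : pmetricType R}.
Variables (a b : R) (g : R -> X).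
Hypothesis rg : rectifiable a b g.

Definition len_upto t : R := fine (curve_length a t g).

Lemma curve_length_fin s t : a <= s -> s <= t -> t <= b ->
  curve_length s t g \is a fin_num.
Proof.
move=> as_ st tb; rewrite ge0_fin_numE ?curve_length_ge0//.
case: rg => _; apply: le_lt_trans.
rewrite (curve_length_cat g as_ (le_trans st tb)).
rewrite (curve_length_cat g st tb).
rewrite addeCA leeDl// adde_ge0// ?curve_length_ge0//.
Qed.

Lemma len_uptoB s t : a <= s -> s <= t -> t <= b ->
  len_upto t - len_upto s = fine (curve_length s t g).
Proof.
move=> as_ st tb; rewrite /len_upto (curve_length_cat g as_ st) fineD.
- by rewrite addrC addKr.
- by apply: curve_length_fin => //; exact: le_trans tb.
- exact: curve_length_fin.
Qed.

Lemma len_uptoa : len_upto a = 0.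
Proof. by rewrite /len_upto curve_lengthxx. Qed.

Lemma len_upto_homo s t : a <= s -> s <= t -> t <= b -> len_upto s <= len_upto t.
Proof.
move=> as_ st tb; rewrite -subr_ge0 len_uptoB// fine_ge0//.
exact: curve_length_ge0.
Qed.

Lemma mdist_le_len s t : a <= s -> s <= t -> t <= b ->
  mdist (g s) (g t) <= len_upto t - len_upto s.
Proof.
move=> as_ st tb; rewrite len_uptoB// -lee_fin fineK ?curve_length_fin//.
exact: curve_length_ge_mdist.
Qed.

End RectifiableCurve.

Section within_segment.
Context {R : realType}.

Lemma within_itv_mdistP {T : metricType R} (a b : R) (f : R -> T) :
  {within `[a, b], continuous f} <->
  forall t, t \in `[a, b] -> forall e, 0 < e -> exists2 d, 0 < d &
    forall s, s \in `[a, b] -> `|t - s| < d -> mdist (f t) (f s) < e.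
Proof.
split.
  move/subspace_continuousP => cf t tab e e0.
  have /metricType_numDomainType.cvgrPdist_lt/(_ _ e0) := cf t tab.
  rewrite near_withinE => -[d /= d0 dP]; exists d => // s sab std.
  exact: dP.
move=> cf; apply/subspace_continuousP => t /= tab.
apply/metricType_numDomainType.cvgrPdist_lt => e e0.
have [d d0 dP] := cf t tab _ e0.
by rewrite near_withinE; exists d => // s std sab; exact: dP.
Qed.

Lemma within_itv_normP (a b : R) (f : R -> R) :
  {within `[a, b], continuous f} <->
  forall t, t \in `[a, b] -> forall e, 0 < e -> exists2 d, 0 < d &
    forall s, s \in `[a, b] -> `|t - s| < d -> `|f t - f s| < e.
Proof.
split.
  move/subspace_continuousP => cf t tab e e0.
  have /cvgrPdist_lt/(_ _ e0) := cf t tab.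
  rewrite near_withinE => -[d /= d0 dP]; exists d => // s sab std.
  exact: dP.
move=> cf; apply/subspace_continuousP => t /= tab.
apply/cvgrPdist_lt => e e0.
have [d d0 dP] := cf t tab _ e0.
by rewrite near_withinE; exists d => // s std sab; exact: dP.
Qed.

End within_segment.

Section ArcLength.
Context {R : realType} {X : pmetricType R}.
Variables (a b : R) (g : R -> X).
Hypotheses (ab : a <= b) (rg : rectifiable a b g).

Local Notation len := (len_upto a g).

Lemma curve_length_approx s t e : a <= s -> s <= t -> t <= b -> 0 < e ->
  exists2 p, itv_partition s t p & len t - len s < poly_length g s p + e.
Proof.
move=> as_ st tb e0; rewrite (len_uptoB rg)//.
have fin : curve_length s t g \is a fin_num by exact: (curve_length_fin rg).
have /(ub_ereal_sup_adherent e0) : ereal_sup [set (poly_length g s p)%:E | p in itv_partition s t] \is a fin_num.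
  by rewrite -curve_lengthE.
move=> [_ [p pst <-]]; rewrite -curve_lengthE => H; exists p => //.
by rewrite -lte_fin EFinD fineK// -lteBlDr.
Qed.

Lemma curve_continuous_at t : t \in `[a, b] -> forall e, 0 < e ->
  exists2 d, 0 < d &
    forall s, s \in `[a, b] -> `|t - s| < d -> mdist (g t) (g s) < e.
Proof. by case: rg => + _; move/within_itv_mdistP; exact. Qed.

(** A partition of [[t, b]] of almost maximal length is refined by [s] just after [t]. Beyond [s]
    the polygon has length at most [len b - len s], so all that remains for [[t, s]] is the edge
    from [g t] to [g s], small by continuity, and the defect of the partition. *)
Lemma len_upto_right t e : a <= t -> t < b -> 0 < e ->
  exists2 s, t < s <= b & len s - len t < e.
Proof.
move=> at_ tb e0; have e20 : 0 < e / 2 by rewrite divr_gt0.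
have [[|x p] pP lp] := curve_length_approx at_ (ltW tb) (lexx b) e20.
  by have := itv_partition_nil pP => tb'; move: tb; rewrite tb' ltxx.
have [d d0 dP] := @curve_continuous_at t ltac:(by rewrite in_itv/= at_ ltW) _ e20.
have tx : t < x by case: pP => /= /andP[].
have xb : x <= b by exact: (itv_partition_le (itv_partition_cons pP)).
pose s := Num.min x (t + d / 2).
have ts : t < s by rewrite lt_min tx ltrDl divr_gt0.
have sx : s <= x by rewrite ge_min lexx.
have sb : s <= b by exact: le_trans xb.
exists s; first by rewrite ts.
have dts : mdist (g t) (g s) < e / 2.
  apply: dP; first by rewrite in_itv/= sb andbT (le_trans at_)// ltW.
  rewrite ltr0_norm ?subr_lt0// opprB ltrBlDl.
  by rewrite (@le_lt_trans _ _ (t + d / 2))// ?ge_min ?lexx ?orbT//; lra.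
have sbl : mdist (g s) (g x) + poly_length g x p <= len b - len s.
  rewrite (len_uptoB rg) ?(le_trans at_ (ltW ts))//.
  rewrite -lee_fin fineK; last first.
    by apply: (curve_length_fin rg) => //; exact: le_trans (ltW ts).
  have [q qP qE] := @itv_partition_exists _ X _ _ sx.
  rewrite -qE.
  have -> : poly_length g x p = poly_length g (last s q) p.
    by case: qP => _ /eqP ->.
  rewrite -poly_length_cat.
  exact: poly_length_le_curve (itv_partition_cat qP (itv_partition_cons pP)).
move: lp => /=.
have := metric_triangle (g t) (g s) (g x).
lra.
Qed.

Lemma len_upto_left t e : a < t -> t <= b -> 0 < e ->
  exists2 s, a <= s < t & len t - len s < e.
Proof.
move=> at_ tb e0; have e20 : 0 < e / 2 by rewrite divr_gt0.
have [p pP lp] := curve_length_approx (lexx a) (ltW at_) tb e20.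
case/lastP : p pP lp => [pP|p x pP lp].
  by have := itv_partition_nil pP => ta; move: at_; rewrite ta ltxx.
have xt : x = t by case: pP => _; rewrite last_rcons => /eqP.
rewrite {}xt in pP lp.
have pP' : itv_partition a (last a p) p.
  by case: pP; rewrite rcons_path => /andP[pp _ _]; split.
have yt : last a p < t by case: pP; rewrite rcons_path => /andP[].
have ay := itv_partition_le pP'.
have [d d0 dP] := @curve_continuous_at t ltac:(by rewrite in_itv/= tb ltW) _ e20.
pose s := Num.max (last a p) (t - d / 2).
have st : s < t by rewrite gt_max yt/= gtrBl divr_gt0.
have ys : last a p <= s by rewrite le_max lexx.
have as_ : a <= s by exact: le_trans ys.
exists s; first by rewrite as_.
have dts : mdist (g t) (g s) < e / 2.
  apply: dP; first by rewrite in_itv/= as_ (le_trans (ltW st)).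
  rewrite gtr0_norm ?subr_gt0// ltrBlDl -ltrBlDr.
  by rewrite (@lt_le_trans _ _ (t - d / 2))// ?le_max ?lexx ?orbT//; lra.
have sbl : poly_length g a p + mdist (g (last a p)) (g s) <= len s - len a.
  rewrite (len_uptoB rg) ?(le_trans (ltW st))//.
  rewrite -lee_fin fineK; last first.
    by apply: (curve_length_fin rg) => //; exact: le_trans (ltW st) _.
  have [q qP qE] := @itv_partition_exists _ X _ _ ys.
  rewrite -qE -poly_length_cat.
  exact: poly_length_le_curve (itv_partition_cat pP' qP).
move: lp => /=; rewrite -cats1 poly_length_cat/= addr0.
have := metric_triangle (g (last a p)) (g s) (g t).
rewrite (metric_sym (g s)).
lra.
Qed.

Lemma len_upto_continuous : {within `[a, b], continuous len}.
Proof.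
apply/within_itv_normP => t tab e e0.
have [at_ tb] : a <= t /\ t <= b by move: tab; rewrite in_itv/= => /andP[].
have [d1 d10 d1P] : exists2 d, 0 < d & forall s, t <= s -> s <= b -> s - t < d ->
    len s - len t < e.
  have [tltb|] := ltP t b; last first.
    move=> bt; exists 1 => // s ts sb _.
    suff -> : s = t by rewrite subrr.
    by apply/le_anti; rewrite ts (le_trans sb bt).
  have [u /andP[tu ub] lu] := len_upto_right at_ tltb e0.
  exists (u - t); first by rewrite subr_gt0.
  move=> s ts sb; rewrite ltrD2r => su.
  apply: le_lt_trans lu; rewrite lerD2r.
  by apply: (len_upto_homo rg) => //; [exact: le_trans ts|exact: ltW].
have [d2 d20 d2P] : exists2 d, 0 < d & forall s, a <= s -> s <= t -> t - s < d ->
    len t - len s < e.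
  have [altt|] := ltP a t; last first.
    move=> ta; exists 1 => // s as_ st _.
    suff -> : s = t by rewrite subrr.
    by apply/le_anti; rewrite st (le_trans ta as_).
  have [u /andP[au ut] lu] := len_upto_left altt tb e0.
  exists (t - u); first by rewrite subr_gt0.
  move=> s as_ st; rewrite ltrD2l ltrN2 => us.
  apply: le_lt_trans lu; rewrite lerD2l lerN2.
  by apply: (len_upto_homo rg) => //; [exact: ltW|exact: le_trans tb].
exists (Num.min d1 d2); first by rewrite lt_min d10.
move=> s; rewrite in_itv/= => /andP[as_ sb]; rewrite lt_min => /andP[H1 H2].
have [ts|st] := leP t s.
  rewrite ler0_norm ?subr_le0 ?(len_upto_homo rg)// opprB d1P//.
  by move: H1; rewrite distrC ger0_norm// subr_ge0.
rewrite ger0_norm ?subr_ge0 ?(len_upto_homo rg)// ?ltW//.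
rewrite d2P// ?ltW//.
by move: H2; rewrite ger0_norm// subr_ge0 ltW.
Qed.

(** The set in [arc_param] is nonempty by the intermediate value theorem, and its supremum is
    attained by continuity of [len]. The maximality clause settles the case of equal parameters in
    [arc_param_lip]. *)
Lemma arc_paramP s : 0 <= s <= len b -> exists t, [/\ t \in `[a, b],
  arc_param a b g s = g t, len t = s &
  forall t', t' \in `[a, b] -> len t' = s -> t' <= t].
Proof.
move=> sL.
pose A := [set t | t \in `[a, b] /\ curve_length a t g = s%:E].
have AE t : A t <-> t \in `[a, b] /\ len t = s.
  rewrite /A/=; split => -[tab tE]; split => //; first by rewrite /len_upto tE.
  move: tab; rewrite in_itv/= => /andP[at_ tb].
  by rewrite -tE /len_upto fineK//; exact: (curve_length_fin rg).
have A0 : A !=set0.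
  have [|c cab cs] := @IVT _ len a b s ab len_upto_continuous.
    by move: sL => /andP[s0 sL]; rewrite (len_uptoa a) ge_min le_max s0 sL orbT.
  by exists c; apply/AE.
have ubA : has_ubound A.
  by exists b => t -[]; rewrite in_itv/= => /andP[].
have supA : has_sup A by [].
have tab : sup A \in `[a, b].
  rewrite in_itv/=; apply/andP; split.
    have [t0 At0] := A0; apply: (@le_trans _ _ t0).
      by case: At0; rewrite in_itv/= => /andP[].
    exact: ub_le_sup.
  by apply: ge_sup => // t -[]; rewrite in_itv/= => /andP[].
exists (sup A); split => //; last first.
  by move=> t' t'ab t's; apply: ub_le_sup => //; apply/AE.
have [t0 At0] := A0.
move/AE : (At0) => [t0ab t0s].
have slen : s <= len (sup A).
  rewrite -t0s; move: t0ab tab; rewrite !in_itv/= => /andP[? ?] /andP[? ?].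
  by apply: (len_upto_homo rg) => //; exact: ub_le_sup.
apply/eqP; rewrite eq_le slen andbT leNgt; apply/negP => slt.
have /within_itv_normP/(_ _ tab (len (sup A) - s)) := len_upto_continuous.
rewrite subr_gt0 => /(_ slt)[d d0 dP].
have [t At dt] := sup_adherent d0 supA.
have /AE[tab' ts] := At.
have := dP _ tab'.
have tsup : t <= sup A by exact: ub_le_sup.
rewrite ger0_norm ?subr_ge0// ltrBlDl -ltrBlDr => /(_ dt).
by rewrite ts ger0_norm ?ltxx// subr_ge0.
Qed.

Lemma arc_param_lip s t : 0 <= s -> s <= t -> t <= len b ->
  mdist (arc_param a b g s) (arc_param a b g t) <= t - s.
Proof.
move=> s0 st tL.
have [|x [xab -> xs xmax]] := @arc_paramP s; first by rewrite s0 (le_trans st).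
have [|y [yab -> yt ymax]] := @arc_paramP t; first by rewrite tL (le_trans s0).
rewrite -xs -yt.
move: (xab) (yab); rewrite !in_itv/= => /andP[? ?] /andP[? ?].
have [xy|yx] := leP x y; first by rewrite (mdist_le_len rg).
(* Monotonicity of [len] leaves only [s = t], where [x] would be a later preimage than the last
   one. *)
have := len_upto_homo rg _ (ltW yx) _; rewrite xs yt => ts.
have E : s = t by apply/le_anti; rewrite st ts.
by have := ymax x xab; rewrite xs E => /(_ erefl); rewrite leNgt yx.
Qed.

(** The parametrization picks the last time of length zero, which may exceed [a]; the curve has not
    moved by then. *)
Lemma arc_param0 : arc_param a b g 0 = g a.
Proof.
have := len_upto_homo rg (lexx a) ab (lexx b); rewrite (len_uptoa a) => L0.
have [|t [+ -> t0 _]] := @arc_paramP 0; first by rewrite lexx.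
rewrite in_itv/= => /andP[at_ tb].
apply/esym/mdist_positivity/le_anti; rewrite mdist_ge0 andbT.
by have := mdist_le_len rg (lexx a) at_ tb; rewrite t0 (len_uptoa a) subrr.
Qed.

Lemma arc_param_len : arc_param a b g (len b) = g b.
Proof.
have := len_upto_homo rg (lexx a) ab (lexx b); rewrite (len_uptoa a) => L0.
have [|t [+ -> tL _]] := @arc_paramP (len b); first by rewrite lexx andbT.
rewrite in_itv/= => /andP[at_ tb].
apply/mdist_positivity/le_anti; rewrite mdist_ge0 andbT.
by have := mdist_le_len rg at_ tb (lexx b); rewrite tL subrr.
Qed.

End ArcLength.

(** The integral of a nonnegative function is a supremum over simple functions below it, hence
    monotone without measurability. This serves for instance for an upper gradient composed with
    [arc_param]. *)
Lemma ge0_le_integral_nomeas d (T : measurableType d) (R : realType)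
    (mu : {measure set T -> \bar R}) (D : set T) (f1 f2 : T -> \bar R) :
  (forall x, D x -> (0 <= f1 x)%E) -> (forall x, D x -> (f1 x <= f2 x)%E) ->
  (\int[mu]_(x in D) f1 x <= \int[mu]_(x in D) f2 x)%E.
Proof.
move=> f10 f12.
have f20 x : D x -> (0 <= f2 x)%E by move=> Dx; exact: le_trans (f10 _ Dx) (f12 _ Dx).
rewrite !ge0_integralE//; apply: le_ereal_sup => _ [h hf1 <-].
exists h => // x; apply: le_trans (hf1 x) _.
by apply: lee_restrict.
Qed.

Section lsc_borel.
Context {R : realType} {X : pmetricType R}.

Lemma lsc_borel_measurable (f : X -> \bar R) : lower_semicontinuous f ->
  measurable_fun [set: g_sigma_algebraType (@open X)] f.
Proof.
move=> scif; apply: (measurability _ (ErealGenOInfty.measurableE R)).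
move=> /= _ [_ [a ->]] <-; apply: measurableI => //.
apply: sub_sigma_algebra.
by rewrite preimage_itvoy; move/lower_semicontinuousP : scif; exact.
Qed.

Lemma continuous_EFin_lsc (f : X -> R) : continuous f ->
  lower_semicontinuous (EFin \o f).
Proof.
move=> cf; apply/lower_semicontinuousP => a.
rewrite (_ : [set x | _] = f @^-1` [set r | a < r]); last first.
  by apply/seteqP; split => x /=; rewrite lte_fin.
by apply: open_comp => [x _|]; [exact: cf|exact: open_gt].
Qed.

End lsc_borel.

(** Telescoping over [N + 1] equal steps, each shorter than [e], globalizes a comparison of
    increments. *)
Lemma interval_chain {R : realType} (F G : R -> R) (L e : R) : 0 < e -> 0 <= L ->
  (forall s t, 0 <= s -> s <= t -> t <= L -> t - s < e ->
     F t - F s <= G t - G s) ->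
  F L - F 0 <= G L - G 0.
Proof.
move=> e0 L0 H.
have [N NP] : exists N : nat, L / e < N.+1%:R.
  by exists (Num.truncn (L / e)); rewrite truncnS_gt.
pose x k := L * k%:R / N.+1%:R.
have x0 k : 0 <= x k by rewrite /x divr_ge0// mulr_ge0.
have xL k : (k <= N.+1)%N -> x k <= L.
  by move=> kN; rewrite /x ler_pdivrMr// ler_wpM2l// ler_nat.
have xS k : x k.+1 - x k = L / N.+1%:R.
  by rewrite /x -mulrBl -mulrBr -natrB// subSnn mulr1.
have key k : (k <= N.+1)%N -> F (x k) - F 0 <= G (x k) - G 0.
  elim: k => [_|k ih kN].
    by rewrite /x mulr0 mul0r !subrr.
  have xkS : x k <= x k.+1 by rewrite -subr_ge0 xS divr_ge0.
  have xe : x k.+1 - x k < e by rewrite xS ltr_pdivrMr// mulrC -ltr_pdivrMr.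
  have := H (x k) (x k.+1) (x0 _) xkS (xL _ kN) xe.
  have := ih (ltnW kN); lra.
have := key N.+1 (leqnn _).
by rewrite /x -mulrA divff// ?mulr1.
Qed.

Section integral_segment.
Context {R : realType}.
Notation leb := (@lebesgue_measure R).
Variables (h : R -> R) (L : R).
Hypothesis ch : {within `[0, L], continuous h}.

Let I t := (\int[leb]_(r in `[0%R, t]) h r)%R.

Lemma within_segment_integrable t : t <= L ->
  leb.-integrable `[0, t] (EFin \o h).
Proof.
move=> tL; apply: continuous_compact_integrable; first exact: segment_compact.
apply: continuous_subspaceW ch => x /=; rewrite !in_itv/= => /andP[-> xt].
exact: le_trans xt tL.
Qed.

Lemma integral_segmentB_bounds (s t m M : R) : 0 <= s -> s <= t -> t <= L ->
  (forall r, s <= r -> r <= t -> m <= h r <= M) ->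
  m * (t - s) <= I t - I s <= M * (t - s).
Proof.
move=> s0 st tL hmM.
have it := within_segment_integrable tL.
have sub : [set` `]s, t]] `<=` [set` `[0, t]].
  by move=> x /=; rewrite !in_itv/= => /andP[/ltW /(le_trans s0) -> ->].
have ist : leb.-integrable `]s, t] (EFin \o h) by apply: integrableS it.
rewrite /I Rintegral_itvB ?bnd_simp//.
have cstE c : (\int[leb]_(r in `]s, t]) c)%R = c * (t - s).
  have E : leb `]s, t] = (t - s)%:E.
    have := @lebesgue_measure_itv R `]s, t]%R; rewrite /= lte_fin => ->.
    case: ifPn => [_|]; first by rewrite -EFinB.
    by rewrite -leNgt => ts; rewrite (_ : t = s) ?subrr//; apply/le_anti; rewrite ts.
  by rewrite Rintegral_cst//= E.
have icst c : leb.-integrable `]s, t] (EFin \o cst c).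
  apply: (@integrableS _ _ _ leb `[s, t]%classic) => //.
    by move=> x /=; rewrite !in_itv/= => /andP[/ltW -> ->].
  apply: continuous_compact_integrable; first exact: segment_compact.
  apply: continuous_subspaceT => x; exact: cst_continuous.
apply/andP; split.
  rewrite -cstE; apply: le_Rintegral => //; [exact: icst|move=> r /=].
  by rewrite in_itv/= => /andP[/ltW sr rt]; have /andP[] := hmM _ sr rt.
rewrite -cstE; apply: le_Rintegral => //; [exact: icst|move=> r /=].
by rewrite in_itv/= => /andP[/ltW sr rt]; have /andP[] := hmM _ sr rt.
Qed.

End integral_segment.

(** * A local Lipschitz criterion for upper gradients *)

Section upper_gradient_criterion.
Context {R : realType} {X : pmetricType R}.
Notation leb := (@lebesgue_measure R).

Lemma arc_param_continuous (a b : R) (g : R -> X) (f : X -> R) :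
  a <= b -> rectifiable a b g -> continuous f ->
  {within `[0, len_upto a g b], continuous (f \o arc_param a b g)}.
Proof.
move=> ab rg cf; apply/subspace_continuousP => t /= tL.
apply: (@cvg_comp _ _ _ _ f _ (nbhs (arc_param a b g t))); last exact: cf.
move: t tL; apply/subspace_continuousP/within_itv_mdistP => t tL e e0; exists e => //.
move=> s sL ts; apply: le_lt_trans ts.
move: tL sL; rewrite !in_itv/= => /andP[t0 tL] /andP[s0 sL].
have [ts|st] := leP t s.
  by rewrite ler0_norm ?subr_le0// opprB; exact: arc_param_lip.
rewrite metric_sym ger0_norm ?subr_ge0; last exact: ltW.
exact: arc_param_lip (ltW st) _.
Qed.

Lemma line_integral_EFin (a b : R) (g : R -> X) (f : X -> R) :
  a <= b -> rectifiable a b g -> continuous f ->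
  line_integral a b g (EFin \o f) =
  (\int[leb]_(r in `[0%R, len_upto a g b]) f (arc_param a b g r))%:E.
Proof.
move=> ab rg cf; rewrite /line_integral /Rintegral fineK//.
apply: integrable_fin_num => //.
apply: (within_segment_integrable _ (lexx _)).
exact: arc_param_continuous.
Qed.

(** On a piece of arc shorter than [e], [2 * f] stays above the value of [f] at its start, so the
    integral of [2 * f] dominates the local Lipschitz bound; [interval_chain] adds up the pieces. *)
Lemma upper_gradient_local_lip (w f : X -> R) (e : R) : 0 < e -> continuous f ->
  (forall z, 0 <= f z) ->
  (forall z z', mdist z z' < e -> `|w z - w z'| <= f z * mdist z z') ->
  (forall z z', mdist z z' < e -> f z <= 2 * f z') ->
  upper_gradient w (fun z => (2 * f z)%:E).
Proof.
move=> e0 cf f0 wf ff.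
have cf2 : continuous (fun z => 2 * f z).
  by move=> x; apply: cvgM; [exact: cvg_cst|exact: cf].
split.
- exact: (lsc_borel_measurable (continuous_EFin_lsc cf2)).
- by move=> x; rewrite lee_fin mulr_ge0.
move=> a b g ab rg.
rewrite (line_integral_EFin ab rg cf2) lee_fin.
set L := len_upto a g b; set ga := arc_param a b g.
have L0 : 0 <= L.
  by rewrite -(len_uptoa a g); apply: (len_upto_homo rg).
pose I t := (\int[leb]_(r in `[0%R, t]) (2 * f (ga r)))%R.
have cfg := arc_param_continuous ab rg cf2.
have I0 : I 0 = 0 by rewrite /I set_itv1 Rintegral_set1.
have loc s t : 0 <= s -> s <= t -> t <= L -> t - s < e ->
    `|w (ga s) - w (ga t)| <= I t - I s.
  move=> s0 st tL tse.
  have dst r : s <= r -> r <= t -> mdist (ga s) (ga r) <= r - s.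
    by move=> sr rt; apply: arc_param_lip => //; exact: le_trans tL.
  have dstt := dst _ st (lexx _).
  apply: (@le_trans _ _ (f (ga s) * (t - s))).
    apply: le_trans (wf _ _ (le_lt_trans dstt tse)) _.
    by rewrite ler_wpM2l.
  have [|//] := andP (@integral_segmentB_bounds _ _ _ cfg s t (f (ga s)) (4 * f (ga s)) s0 st tL _).
  move=> r sr rt /=.
  have sre : mdist (ga s) (ga r) < e.
    by apply: le_lt_trans (dst _ sr rt) _; apply: le_lt_trans tse; rewrite lerD2r.
  rewrite ff//=.
  have := ff (ga r) (ga s); rewrite metric_sym => /(_ sre).
  by rewrite -(@ler_pM2l _ 2)// mulrA -natrM.
rewrite -{1}(arc_param0 ab rg) -(arc_param_len ab rg) -/ga -/L.
have -> : (\int[leb]_(r in `[0%R, L]) (2 * f (ga r)))%R = I L - I 0.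
  by rewrite I0 subr0.
rewrite ler_norml; apply/andP; split.
  rewrite lerNl opprB.
  apply: (interval_chain (F := w \o ga) e0 L0) => s t s0 st tL tse /=.
  by apply: le_trans (loc _ _ s0 st tL tse); rewrite distrC ler_norm.
have := @interval_chain _ (fun t => - w (ga t)) I _ _ e0 L0.
rewrite opprK addrC; apply => s t s0 st tL tse /=.
by apply: le_trans (loc _ _ s0 st tL tse); rewrite opprK addrC ler_norm.
Qed.

End upper_gradient_criterion.

(** * Lower semicontinuous majorants *)

Section Regularity.
Context {R : realType} {X : pmetricType R}.
Variable mu : {outer_measure set X -> \bar R}.
Hypothesis borel_cara : @borel R X `<=` mu.-caratheodory.

Lemma borel_measurable (A : set X) : borel A ->
  measurable (A : set (caratheodory_type mu)).
Proof. by move=> /borel_cara. Qed.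

Lemma open_borel (A : set X) : open A -> borel A.
Proof. by move=> oA; exact: sub_sigma_algebra. Qed.

Lemma closed_borel (A : set X) : closed A -> borel A.
Proof.
move=> cA; rewrite -(setCK A) -[~` ~` A]setTD.
by apply: sigma_algebraCD; apply: open_borel; exact: closed_openC.
Qed.

Lemma open_cara (A : set X) : open A -> measurable (A : set (caratheodory_type mu)).
Proof. by move=> /open_borel/borel_measurable. Qed.

Lemma closed_cara (A : set X) : closed A -> measurable (A : set (caratheodory_type mu)).
Proof. by move=> /closed_borel/borel_measurable. Qed.

Lemma ball_openX (x : X) (r : R) : open (ball x r).
Proof.
rewrite openE ballEmdist => y /= xy.
rewrite /interior -metricType_numDomainType.filter_from_mdist_nbhs.
exists (r - mdist x y); first by rewrite /= subr_gt0.
move=> z /= yz.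
by apply: le_lt_trans (metric_triangle _ y _) _; rewrite -ltrBrDl.
Qed.

Lemma ball_cara (x : X) (r : R) : measurable (ball x r : set (caratheodory_type mu)).
Proof. exact/open_cara/ball_openX. Qed.

Lemma borel_fun_cara (f : X -> \bar R) :
  measurable_fun [set: g_sigma_algebraType (@open X)] f ->
  measurable_fun [set: caratheodory_type mu] f.
Proof.
move=> mf _ Y mY; rewrite setTI; apply: borel_measurable.
by have := mf measurableT Y mY; rewrite setTI.
Qed.

(** The error is measured in a window [B] of finite measure. Keeping a closed and an open set at
    once makes the property stable under complements, which exchange them. *)
Definition inner_outer (B A : set X) := forall e : R, 0 < e ->
  exists F U : set X, [/\ closed F, open U, F `<=` A, A `<=` U &
    (mu ((U `\` F) `&` B) < e%:E)%E].

(** The closed sets [F k] of points whose ball of radius [1 / (k + 1)] stays in [A] exhaust [A];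
    what they miss inside [B] decreases to the empty set. *)
Lemma inner_outer_open (B A : set X) : borel B -> (mu B < +oo)%E -> open A ->
  inner_outer B A.
Proof.
move=> bB muB oA e e0.
pose F k := [set x | ball x k.+1%:R^-1 `<=` A] : set X.
have cF k : closed (F k).
  rewrite -openC openE => x /= /existsNP[y /not_implyP[xy nAy]].
  rewrite /interior -metricType_numDomainType.filter_from_mdist_nbhs.
  exists (k.+1%:R^-1 - mdist x y).
    by move: xy; rewrite ballEmdist/= subr_gt0.
  move=> z /= xz Fz; apply: nAy; apply: Fz.
  rewrite ballEmdist/= (le_lt_trans (metric_triangle _ x _))//.
  by rewrite metric_sym -ltrBrDr.
have FA k : F k `<=` A by move=> x; apply; apply: ballxx.
pose D k := (A `\` F k) `&` B.
have mD k : measurable (D k : set (caratheodory_type mu)).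
  apply: measurableI; last exact: borel_measurable.
  by apply: measurableD; [exact: open_cara|exact: closed_cara].
have D0 : \bigcap_k D k = set0.
  apply/seteqP; split => // x Dx.
  have [[Ax _] _] := Dx 0%N I.
  have : nbhs x A by exact: open_nbhs_nbhs.
  rewrite -metricType_numDomainType.filter_from_mdist_nbhs => -[r /= r0 rA].
  have [[_ +] _] := Dx (Num.truncn r^-1) I; apply => y.
  rewrite ballEmdist/= => xy; apply: rA; apply: (lt_trans xy).
  by rewrite invf_plt ?posrE ?ltr0n//; exact: truncnS_gt.
have ndF : {homo F : n m / (n <= m)%N >-> n `<=` m}.
  move=> n m nm x Fx; apply: subset_trans Fx.
  by apply: le_ball; rewrite lef_pV2 ?posrE ?ltr0n// ler_nat ltnS.
have niD : nonincreasing_seq D.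
  move=> n m nm; apply/subsetPset => x [[Ax nF] Bx]; split => //; split => //.
  by move=> Fn; apply: nF; exact: ndF Fn.
have muD0 : (cara mu (D 0%N) < +oo)%E.
  by apply: le_lt_trans muB; apply: le_outer_measure => x [].
have := @nonincreasing_cvg_mu _ _ _ (cara mu) D muD0 mD.
rewrite D0 measure0 => /(_ measurable0 niD) /fine_cvgP[finD].
move=> /cvgrPdist_lt /(_ _ e0) H.
near \oo => k.
exists (F k), A; split => //.
have fk : cara mu (D k) \is a fin_num by near: k.
rewrite -(fineK fk) lte_fin; apply: le_lt_trans (ler_norm _) _.
by rewrite -normrN -[X in `|X|]sub0r; near: k.
Unshelve. all: by end_near. Qed.

Lemma inner_outer_sigma (B : set X) : borel B -> (mu B < +oo)%E ->
  sigma_algebra [set: X] (inner_outer B).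
Proof.
move=> bB muB; split.
- move=> e e0; exists set0, set0; split => //; first exact: closed0.
    exact: open0.
  by rewrite set0D set0I outer_measure0 lte_fin.
- move=> A ioA e e0; have [F [U [cF oU FA AU UF]]] := ioA _ e0.
  exists (~` U), (~` F); split.
  + exact: open_closedC.
  + exact: closed_openC.
  + by rewrite setTD; exact: subsetC.
  + by rewrite setTD; exact: subsetC.
  + suff -> : ~` F `\` ~` U = U `\` F by [].
    by rewrite !setDE setCK setIC.
- move=> A ioA e e0.
  have e20 : 0 < e / 2 by rewrite divr_gt0.
  have /choice[FU FUP] : forall k, exists FU : set X * set X, [/\ closed FU.1,
      open FU.2, FU.1 `<=` A k, A k `<=` FU.2 &
      (mu ((FU.2 `\` FU.1) `&` B) < (e / 2 / (2 ^ k.+1)%:R)%:E)%E].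
    move=> k; have ek : 0 < e / 2 / (2 ^ k.+1)%:R by rewrite divr_gt0// ltr0n expn_gt0.
    by have [F [U H]] := ioA k _ ek; exists (F, U).
  pose F k := (FU k).1; pose U k := (FU k).2.
  pose UU := \bigcup_k U k.
  (* A countable union of closed sets need not be closed, hence the finite unions; the loss vanishes
     by continuity from above in the window. *)
  pose FF n := \bigcup_(k < n) F k.
  have oU : open UU by apply: bigcup_open => k _; have [] := FUP k.
  have cF n : closed (FF n).
    by rewrite /FF bigcup_mkord; apply: closed_bigsetU => k _; have [] := FUP k.
  pose D n := (UU `\` FF n) `&` B.
  have mD n : measurable (D n : set (caratheodory_type mu)).
    apply: measurableI; last exact: borel_measurable.
    by apply: measurableD; [exact: open_cara|exact: closed_cara].
  have mDc : measurable (\bigcap_n D n : set (caratheodory_type mu)).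
    by apply: bigcap_measurable => // n _.
  have niD : nonincreasing_seq D.
    move=> n m nm; apply/subsetPset => x [[Ux nF] Bx]; split => //; split => //.
    by move=> [k /= kn Fk]; apply: nF; exists k => //=; exact: leq_trans nm.
  have muD0 : (cara mu (D 0%N) < +oo)%E.
    by apply: le_lt_trans muB; apply: le_outer_measure => x [].
  have cvD := @nonincreasing_cvg_mu _ _ _ (cara mu) D muD0 mD mDc niD.
  have muDc : (mu (\bigcap_n D n) < e%:E)%E.
    apply: (@le_lt_trans _ _ (e / 2)%:E); last by rewrite lte_fin; lra.
    apply: (@le_trans _ _ (mu (\bigcup_k ((U k `\` F k) `&` B)))).
      apply: le_outer_measure => x Dx.
      have [[[k _ Ux] _] Bx] := Dx 0%N I.
      exists k => //; split => //; split => // Fx.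
      by have [[_ +] _] := Dx k.+1 I; apply; exists k => /=.
    apply: le_trans (outer_measure_sigma_subadditive _ _) _.
    apply: le_trans (epsilon_trick0 xpredT (ltW e20)).
    apply: lee_nneseries => // k _.
    by have [_ _ _ _ /ltW H] := FUP k; exact: H.
  have [n muDn] : exists n, (mu (D n) < e%:E)%E.
    have Dcfin : cara mu (\bigcap_n D n) \is a fin_num.
      by rewrite ge0_fin_numE//; apply: lt_trans muDc (ltry _).
    move: cvD; rewrite -(fineK Dcfin) => /fine_cvgP[finD /cvgrPdist_lt].
    have d0 : 0 < e - fine (cara mu (\bigcap_n D n)).
      by rewrite subr_gt0 -lte_fin fineK.
    move=> /(_ _ d0) [n1 _ n1P]; have [n2 _ n2P] := finD.
    pose n := maxn n1 n2; exists n.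
    have fk : cara mu (D n) \is a fin_num by apply: n2P; rewrite /= leq_maxr.
    rewrite -[mu (D n)]/(cara mu (D n)) -(fineK fk) lte_fin.
    have := n1P n (leq_maxl _ _); rewrite /= distrC => /(le_lt_trans (ler_norm _)).
    by rewrite ltrD2r.
  exists (FF n), UU; split => //.
  + by move=> x [k _ Fx]; exists k => //; have [_ _ + _ _] := FUP k; exact.
  + by move=> x [k _ Ax]; exists k => //; have [_ _ _ + _] := FUP k; exact.
Qed.

Lemma borel_inner_outer (B A : set X) : borel B -> (mu B < +oo)%E -> borel A ->
  inner_outer B A.
Proof.
move=> bB muB; apply: smallest_sub; first exact: inner_outer_sigma.
by move=> U oU; exact: inner_outer_open.
Qed.

(** Each window gets its own open set with error [e / 2^(n + 1)], cut down to that window, which is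
    open itself; the errors sum to [e]. *)
Lemma borel_outer_regular (B : nat -> set X) (A : set X) (e : R) :
  (forall n, open (B n)) -> (forall n, (mu (B n) < +oo)%E) ->
  \bigcup_n B n = setT -> borel A -> 0 < e ->
  exists U, [/\ open U, A `<=` U & (mu (U `\` A) <= e%:E)%E].
Proof.
move=> oB muB BT bA e0.
have /choice[U UP] : forall n, exists U, [/\ open U, A `<=` U &
    (mu ((U `\` A) `&` B n) <= (e / (2 ^ n.+1)%:R)%:E)%E].
  move=> n; have en : 0 < e / (2 ^ n.+1)%:R by rewrite divr_gt0// ltr0n expn_gt0.
  have [F [U [_ oU FA AU UF]]] := borel_inner_outer (open_borel (oB n)) (muB n) bA en.
  exists U; split => //; apply: le_trans (ltW UF).
  by apply: le_outer_measure => x [[Ux nA] Bx]; split => //; split => // /FA.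
exists (\bigcup_n (U n `&` B n)); split.
- by apply: bigcup_open => n _; apply: openI => //; have [] := UP n.
- move=> x Ax; have [n _ Bx] : (\bigcup_n B n) x by rewrite BT.
  by exists n => //; split => //; have [_ + _] := UP n; exact.
- apply: (@le_trans _ _ (mu (\bigcup_n ((U n `\` A) `&` B n)))).
    by apply: le_outer_measure => x [[n _ [Ux Bx] nA]]; exists n.
  apply: le_trans (outer_measure_sigma_subadditive _ _) _.
  apply: le_trans (epsilon_trick0 xpredT (ltW e0)).
  apply: lee_nneseries => // k _.
  by have [_ _ H] := UP k; exact: H.
Qed.

End Regularity.

Lemma half_powR_lt1 {R : realType} (d : R) : 0 < d -> 2^-1 `^ d < 1 :> R.
Proof.
move=> d0; have h : 2^-1 < 1 :> R by rewrite invf_lt1// ltr1n.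
by have := @gt0_ltr_powR R d d0 2^-1 1; rewrite powR1; apply; rewrite ?nnegrE.
Qed.

Lemma ltr_exp2 {R : realType} (x : R) : exists n : nat, x < 2 ^+ n.
Proof.
exists (Num.truncn x).+1; apply: (lt_le_trans (truncnS_gt _)).
by rewrite -(natrX R 2) ler_nat ltnW// ltn_expl.
Qed.

Lemma dyadic_level {R : realType} (r : R) : 0 < r -> exists z : int, 2 ^ z < r <= 2 ^ (z + 1).
Proof.
move=> r0.
have [m mP] := ltr_exp2 r^-1.
have ex : exists n : nat, r * 2 ^+ m <= 2 ^+ n.
  by have [n nP] := ltr_exp2 (r * 2 ^+ m); exists n; exact: ltW.
have r1 : 1 < r * 2 ^+ m by rewrite mulrC -ltr_pdivrMr// div1r.
case: (ex_minnP ex) => -[|n] nP nmin.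
  by move: nP; rewrite expr0 leNgt r1.
have nlt : 2 ^+ n < r * 2 ^+ m.
  by rewrite ltNge; apply/negP => /nmin; rewrite ltnn.
have m0 : 0 < 2 ^+ m :> R by rewrite exprn_gt0.
exists (n%:Z - m%:Z); rewrite addrAC (addrC n%:Z) -intS.
rewrite !expfzDr// -exprnN -!exprnP.
by rewrite ltr_pdivrMr// ler_pdivlMr// nlt.
Qed.

Section VitaliCaratheodory.
Context {R : realType} {X : pmetricType R}.
Variable mu : {outer_measure set X -> \bar R}.
Hypothesis borel_cara : @borel R X `<=` mu.-caratheodory.
Variable B : nat -> set X.
Hypotheses (oB : forall n, open (B n)) (muB : forall n, (mu (B n) < +oo)%E)
  (BT : \bigcup_n B n = setT).

Lemma open_enlargement (A : nat -> set X) (a : nat -> R) :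
  (forall k, borel (A k)) -> (forall k, 0 <= a k) ->
  (\sum_(k <oo) (a k)%:E * mu (A k) < +oo)%E ->
  exists U : nat -> set X, [/\ forall k, open (U k), forall k, A k `<=` U k &
    (\sum_(k <oo) (a k)%:E * mu (U k) < +oo)%E].
Proof.
move=> bA a0 sfin.
(* Dividing by [a k + 1] makes the weighted excess at most [1 / 2^(k + 1)], also when [a k = 0]. *)
have /choice[U UP] : forall k, exists U, [/\ open U, A k `<=` U &
    (mu (U `\` A k) <= ((2 ^ k.+1)%:R^-1 / (a k + 1))%:E)%E].
  move=> k; apply: (borel_outer_regular borel_cara oB muB BT (bA k)).
  by rewrite divr_gt0 ?invr_gt0 ?ltr0n ?expn_gt0// ltr_wpDl.
exists U; split => [k|k|]; [by have [] := UP k|by have [_] := UP k|].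
apply: (@le_lt_trans _ _ (\sum_(k <oo) (a k)%:E * mu (A k) + 1%:E)%E); last first.
  by rewrite lte_add_pinfty// ltry.
apply: le_trans (@epsilon_trick R (fun k => (a k)%:E * mu (A k))%E 1 xpredT _ ler01); last first.
  by move=> n; rewrite mule_ge0 ?outer_measure_ge0 ?lee_fin.
apply: lee_nneseries => [k _ _|k _].
  by rewrite mule_ge0 ?outer_measure_ge0 ?lee_fin.
have [oU AU muU] := UP k.
apply: (@le_trans _ _ ((a k)%:E * (mu (A k) + mu (U k `\` A k)))%E).
  rewrite lee_wpmul2l ?lee_fin//.
  rewrite -[X in mu X](setDKU AU).
  by rewrite addeC; exact: outer_measureU2.
rewrite ge0_muleDr ?outer_measure_ge0// leeD2l//.
apply: (@le_trans _ _ ((a k)%:E * ((2 ^ k.+1)%:R^-1 / (a k + 1))%:E)%E).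
  by rewrite lee_wpmul2l ?lee_fin.
rewrite -EFinM lee_fin mul1r mulrCA ler_piMr ?invr_ge0//.
have ak1 : 0 < a k + 1 by rewrite ltr_wpDl.
by rewrite ler_pdivrMr// mul1r lerDl.
Qed.

(** On open enlargements each [a k * \1_(U k)] is lower semicontinuous, and so is the supremum [h]
    of all of them; its integral is controlled by bounding the supremum by the sum. *)
Lemma lsc_levels (A : nat -> set X) (a : nat -> R) :
  (forall k, borel (A k)) -> (forall k, 0 <= a k) ->
  (\sum_(k <oo) (a k)%:E * mu (A k) < +oo)%E ->
  exists h : X -> \bar R, [/\ lower_semicontinuous h, forall x, (0 <= h x)%E,
    forall k x, A k x -> ((a k)%:E <= h x)%E & (\int[cara mu]_x h x < +oo)%E].
Proof.
move=> bA a0 sfin.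
have [U [oU AU sU]] := open_enlargement bA a0 sfin.
pose h x := ereal_sup [set (a k * \1_(U k) x)%:E | k in setT].
have hU k x : U k x -> ((a k)%:E <= h x)%E.
  move=> Ux; apply: ereal_sup_ubound; exists k => //.
  by rewrite indicE mem_set// mulr1.
have h0 x : (0 <= h x)%E.
  apply: (@le_trans _ _ (a 0%N * \1_(U 0%N) x)%:E).
    by rewrite lee_fin mulr_ge0.
  by apply: ereal_sup_ubound; exists 0%N.
exists h; split => //.
- apply/lower_semicontinuousP => c.
  have [c0|c0] := ltP c 0.
    rewrite (_ : [set x | _] = setT); first exact: openT.
    apply/seteqP; split => // x _ /=.
    by apply: lt_le_trans (h0 x); rewrite lte_fin.
  rewrite (_ : [set x | _] = \bigcup_(k in [set k | c < a k]) U k).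
    by apply: bigcup_open.
  apply/seteqP; split => x /=.
    move=> /ereal_sup_gt[_ [k _ <-]]; rewrite lte_fin indicE.
    have [Ux|Ux] := boolP (x \in U k).
      by rewrite mulr1 => ck; exists k => //; exact: set_mem.
    by rewrite mulr0 ltNge c0.
  by move=> [k /= ck Ux]; apply: lt_le_trans (hU _ _ Ux); rewrite lte_fin.
- by move=> k x /AU; exact: hU.
pose f k x := (a k * \1_(U k) x)%:E : \bar R.
apply: le_lt_trans sU.
apply: (@le_trans _ _ (\int[cara mu]_x (\sum_(k <oo) f k x)))%E.
  apply: ge0_le_integral_nomeas => // x _.
  apply: ge_ereal_sup => _ [k _ <-].
  rewrite -/(f k x) [leRHS](@nneseriesD1 _ _ k)// => [|i _]; last by rewrite lee_fin mulr_ge0.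
  by rewrite leeDl// nneseries_ge0// => i _ _; rewrite lee_fin mulr_ge0.
rewrite integral_nneseries//=; last 2 first.
- move=> k; apply/measurable_EFinP; apply: measurable_funM => //.
  by apply: measurable_indic; exact: (open_cara borel_cara).
- by move=> k x _; rewrite lee_fin mulr_ge0.
apply: lee_nneseries => [k _ _|k _].
  by apply: integral_ge0 => x _; rewrite lee_fin mulr_ge0.
under eq_integral do rewrite /f EFinM.
rewrite ge0_integralZl//; last 2 first.
- apply/measurable_EFinP; apply: measurable_indic; exact: (open_cara borel_cara).
- by rewrite lee_fin.
rewrite integral_indic//; last exact: (open_cara borel_cara).
by rewrite setIT.
Qed.

Lemma lsc_max (h1 h2 : X -> \bar R) : lower_semicontinuous h1 ->
  lower_semicontinuous h2 -> lower_semicontinuous (fun x => maxe (h1 x) (h2 x)).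
Proof.
move=> /lower_semicontinuousP l1 /lower_semicontinuousP l2.
apply/lower_semicontinuousP => c.
rewrite (_ : [set x | _] = [set x | (c%:E < h1 x)%E] `|` [set x | (c%:E < h2 x)%E]).
  exact: openU.
by apply/seteqP; split => x /=; rewrite lt_max => /orP.
Qed.

Lemma lsc_majorant (f : X -> \bar R) :
  measurable_fun [set: g_sigma_algebraType (@open X)] f ->
  (forall x, (0 <= f x)%E) -> (\int[cara mu]_x f x < +oo)%E ->
  exists h : X -> \bar R, [/\ lower_semicontinuous h,
    forall x, (f x <= h x)%E & (\int[cara mu]_x h x < +oo)%E].
Proof.
move=> mf f0 intf.
have mfc := borel_fun_cara borel_cara mf.
have bf (Y : set (\bar R)) : measurable Y -> borel (f @^-1` Y).
  by move=> mY; have := mf measurableT Y mY; rewrite setTI.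
(* {f = +oo} is null and can carry every level k at no cost; finite values are
   handled dyadically. *)
pose A k := if @pickle_inv int k is Some z
  then f @^-1` [set` `](2 ^ z)%:E, (2 ^ (z + 1))%:E]] else set0.
pose a k := if @pickle_inv int k is Some z then 2 ^ (z + 1) else 0 : R.
have bA k : borel (A k).
  rewrite /A; case: pickle_inv => [z|]; last exact: sigma_algebra0.
  by apply: bf; exact: emeasurable_itv.
have a0 k : 0 <= a k.
  by rewrite /a; case: pickle_inv => [z|]//; rewrite exprz_ge0.
have tA : trivIset setT A.
  apply/trivIsetP => i j _ _ ij; apply/seteqP; split => // x [].
  rewrite /A.
  have := @pickle_invK int i; have := @pickle_invK int j.
  case: (@pickle_inv int i) => [z|]//=; case: (@pickle_inv int j) => [z'|]//=.
  move=> jE iE; rewrite !in_itv/= => /andP[l1 u1] /andP[l2 u2].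
  have zz : z != z' by apply: contra ij => /eqP E; rewrite -iE -jE E.
  wlog zltz : z z' {iE jE ij} l1 u1 l2 u2 zz / z < z'.
    move=> wl; move: (zz); rewrite neq_lt => /orP[|] H; first exact: (wl z z').
    by apply: (wl z' z) => //; rewrite eq_sym.
  have := lt_le_trans l2 u1; rewrite lte_fin ltNge => /negP; apply.
  by rewrite ler_eXz2l ?ltr1n// lezD1.
(* On the piece [2^z < f <= 2^(z + 1)] the weight [2^(z + 1)] is below [2 * f], and the pieces are
   disjoint, so the sum is at most twice the integral of [f]. *)
have sA : (\sum_(k <oo) (a k)%:E * mu (A k) < +oo)%E.
  apply: (@le_lt_trans _ _ (\sum_(k <oo) 2%:E * \int[cara mu]_(x in A k) f x)%E).
    apply: lee_nneseries => [k _ _|k _].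
      by rewrite mule_ge0 ?outer_measure_ge0 ?lee_fin.
    rewrite /a /A; case: pickle_inv => [z|]; last by rewrite outer_measure0 mule0 integral_set0 mule0.
    set S := f @^-1` _.
    have mS : measurable (S : set (caratheodory_type mu)).
      by apply: (borel_measurable borel_cara); apply: bf; exact: emeasurable_itv.
    rewrite exprzDr ?unitfE// expr1z mulrC EFinM -muleA lee_wpmul2l ?lee_fin//.
    rewrite -[X in (_ * X)%E]/(cara mu S) -integral_cst//.
    apply: ge0_le_integral_nomeas => x /= Sx.
      by rewrite lee_fin exprz_ge0.
    by move: Sx; rewrite /S/= in_itv/= => /andP[/ltW].
  rewrite nneseriesZl//; last by move=> k _; exact: integral_ge0.
  rewrite -ge0_integral_bigcup//; last 2 first.
  - by move=> k; exact: (borel_measurable borel_cara).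
  - exact: measurable_funS mfc.
  apply: lte_mul_pinfty => //.
  apply: le_lt_trans intf; apply: ge0_subset_integral => //.
  by apply: bigcup_measurable => k _; exact: (borel_measurable borel_cara).
have [h1 [lh1 h10 h1A ih1]] := lsc_levels bA a0 sA.
pose A' (_ : nat) := f @^-1` [set +oo%E].
have bA' k : borel (A' k) by apply: bf; exact: emeasurable_set1.
have muA' : mu (f @^-1` [set +oo%E]) = 0%E.
  have [//|] := eqVneq (mu (f @^-1` [set +oo%E])) 0%E.
  move=> mu0; have mupos : (0 < mu (f @^-1` [set +oo%E]))%E.
    by rewrite lt0e mu0 outer_measure_ge0.
  move: intf; suff -> : (\int[cara mu]_x f x)%E = +oo%E by [].
  apply/eqP; rewrite -leye_eq.
  have mS := borel_measurable borel_cara (bA' 0%N).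
  apply: (@le_trans _ _ (\int[cara mu]_(x in A' 0%N) f x)%E); last first.
    by apply: ge0_subset_integral.
  apply: (@le_trans _ _ (\int[cara mu]_(x in A' 0%N) (cst +oo x))%E); last first.
    apply: ge0_le_integral_nomeas => x E; first exact: leey.
    by have -> : f x = +oo%E by exact: E.
  by rewrite integral_cst// gt0_mulye.
have sA' : (\sum_(k <oo) (k%:R)%:E * mu (A' k) < +oo)%E.
  by rewrite eseries0// => k _; rewrite /A' muA' mule0.
have [h2 [lh2 h20 h2A ih2]] := lsc_levels bA' (fun k => ler0n R k) sA'.
exists (fun x => maxe (h1 x) (h2 x)); split; first exact: lsc_max.
- move=> x; have := f0 x; case fx : (f x) => [r| |]// r0.
    move: r0; rewrite lee_fin le_eqVlt => /predU1P[<-|r0].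
      by rewrite le_max h10.
    have [z /andP[zr rz]] := dyadic_level r0.
    rewrite le_max; apply/orP; left.
    apply: (@le_trans _ _ (2 ^ (z + 1))%:E); first by rewrite lee_fin.
    have := h1A (pickle z) x; rewrite /A /a pickleK_inv; apply.
    by rewrite /= in_itv/= fx lte_fin lee_fin zr.
  rewrite le_max; apply/orP; right.
  rewrite leye_eq; apply/eqP/eqyP => M M0.
  apply: (@le_trans _ _ ((Num.truncn M).+1%:R)%:E).
    by rewrite lee_fin ltW// truncnS_gt.
  exact: h2A.
- have mh (h : X -> \bar R) : lower_semicontinuous h -> measurable_fun [set: caratheodory_type mu] h.
    by move=> lh; exact: (borel_fun_cara borel_cara (lsc_borel_measurable lh)).
  apply: (@le_lt_trans _ _ (\int[cara mu]_x (h1 x + h2 x))%E).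
    apply: ge0_le_integral_nomeas => x _; first by rewrite le_max h10.
    by rewrite ge_max leeDl// leeDr.
  by rewrite ge0_integralD//; [exact: lte_add_pinfty|exact: mh|exact: mh].
Qed.

End VitaliCaratheodory.

Lemma lip_continuous {R : realType} {X : pmetricType R} (M : R) (h : X -> R) :
  0 <= M -> (forall y z, h y <= h z + M * mdist y z) -> continuous h.
Proof.
move=> M0 hM x; apply/cvgrPdist_lt => e e0.
apply/metricType_numDomainType.nbhs_mdistP.
have M1 : 0 < M + 1 by rewrite ltr_wpDl.
exists (e / (M + 1)); first by rewrite /= divr_gt0.
move=> y /=; rewrite ltr_pdivlMr// => xy.
apply: le_lt_trans xy; rewrite mulrC.
apply: (@le_trans _ _ (M * mdist x y)); last first.
  by rewrite ler_wpM2r ?mdist_ge0// lerDl.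
rewrite ler_norml; have := hM x y; have := hM y x.
rewrite (metric_sym y); lra.
Qed.

(** * Lipschitz approximation from below *)

Section LscApproximation.
Context {R : realType} {X : pmetricType R}.

Lemma lsc_poweR (h : X -> \bar R) (q : R) : 0 < q -> (forall x, (0 <= h x)%E) ->
  lower_semicontinuous h -> lower_semicontinuous (fun x => (h x `^ q)%E).
Proof.
move=> q0 h0 /lower_semicontinuousP lh; apply/lower_semicontinuousP => c.
have [c0|c0] := ltP c 0.
  rewrite (_ : [set x | _] = setT); first exact: openT.
  apply/seteqP; split => // x _ /=.
  by apply: lt_le_trans (poweR_ge0 _ _); rewrite lte_fin.
rewrite (_ : [set x | _] = [set x | ((c `^ q^-1)%:E < h x)%E]); first exact: lh.
have qq (x : \bar R) : (0 <= x)%E -> ((x `^ q) `^ q^-1 = x)%E.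
  by move=> x0; rewrite -poweRrM divff ?gt_eqF// poweRe1.
apply/seteqP; split => x /= H.
  rewrite ltNge; apply/negP => hx; move: H; rewrite ltNge => /negP; apply.
  have := gt0_ler_poweR (ltW q0); move/(_ (h x) (c `^ q^-1)%:E).
  rewrite !in_itv/= !leey h0 lee_fin powR_ge0 => /(_ isT isT hx)/le_trans; apply.
  by rewrite /= lee_fin -powRrM mulVf ?gt_eqF// powRr1.
rewrite ltNge; apply/negP => hx; move: H; rewrite ltNge => /negP; apply.
have qi0 : 0 <= q^-1 by rewrite invr_ge0 ltW.
have := gt0_ler_poweR qi0; move/(_ (h x `^ q)%E c%:E).
by rewrite !in_itv/= !leey poweR_ge0 lee_fin c0 qq// => /(_ isT isT hx).
Qed.

Variables (rho : X -> \bar R) (eta : R).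
Hypotheses (lrho : lower_semicontinuous rho) (eta0 : 0 < eta)
  (rho_eta : forall x, (eta%:E <= rho x)%E).

(** Cutting at [n + eta] rather than [n] preserves the floor [eta] for every [n]. *)
Definition lsc_trunc (n : nat) x : R := fine (mine (rho x) (n%:R + eta)%:E).

Lemma lsc_truncE n x : (lsc_trunc n x)%:E = mine (rho x) (n%:R + eta)%:E.
Proof.
rewrite /lsc_trunc fineK// fin_numElt; apply/andP; split.
  by rewrite lt_min ltNyr andbT (lt_le_trans _ (rho_eta x))// ltNyr.
by rewrite gt_min ltry orbT.
Qed.

Lemma lsc_trunc_ge n x : eta <= lsc_trunc n x.
Proof. by rewrite -lee_fin lsc_truncE le_min rho_eta/= lee_fin lerDr ler0n. Qed.

(** The Pasch-Hausdorff envelope: the largest [n]-Lipschitz function below the truncation. *)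
Definition lip_approx (n : nat) (x : X) : R :=
  inf [set lsc_trunc n y + n%:R * mdist x y | y in [set: X]].

Let has_inf_lip n x : has_inf [set lsc_trunc n y + n%:R * mdist x y | y in [set: X]].
Proof.
split; first by eexists; exists x.
exists 0 => _ [y _ <-]; rewrite addr_ge0// ?mulr_ge0 ?mdist_ge0//.
exact: le_trans (ltW eta0) (lsc_trunc_ge _ _).
Qed.

Lemma lip_approx_le n x y : lip_approx n x <= lsc_trunc n y + n%:R * mdist x y.
Proof. by apply: (ge_inf (proj2 (has_inf_lip n x))); exists y. Qed.

Lemma lip_approx_lb n x c : (forall y, c <= lsc_trunc n y + n%:R * mdist x y) ->
  c <= lip_approx n x.
Proof.
move=> H; apply: lb_le_inf; first exact: (proj1 (has_inf_lip n x)).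
by move=> _ [y _ <-].
Qed.

Lemma lip_approx_ge n x : eta <= lip_approx n x.
Proof.
apply: lip_approx_lb => y; rewrite ler_wpDr// ?lsc_trunc_ge//.
by rewrite mulr_ge0 ?mdist_ge0.
Qed.

Lemma lip_approx_le_rho n x : ((lip_approx n x)%:E <= rho x)%E.
Proof.
apply: (@le_trans _ _ (lsc_trunc n x)%:E).
  by have := lip_approx_le n x x; rewrite mdistxx mulr0 addr0 lee_fin.
by rewrite lsc_truncE ge_min lexx.
Qed.

Lemma lip_approx_le_nat n x : lip_approx n x <= n%:R + eta.
Proof.
apply: (@le_trans _ _ (lsc_trunc n x)).
  by have := lip_approx_le n x x; rewrite mdistxx mulr0 addr0.
by rewrite -lee_fin lsc_truncE ge_min lexx orbT.
Qed.

Lemma lip_approx_lip n x y : lip_approx n x <= lip_approx n y + n%:R * mdist x y.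
Proof.
rewrite -lerBlDr; apply: lip_approx_lb => z; rewrite lerBlDr.
apply: le_trans (lip_approx_le n x z) _.
rewrite -addrA lerD2l -mulrDr ler_wpM2l// addrC.
exact: metric_triangle.
Qed.

Lemma lip_approx_nd m n x : (m <= n)%N -> lip_approx m x <= lip_approx n x.
Proof.
move=> mn; apply: lip_approx_lb => y; apply: le_trans (lip_approx_le m x y) _.
rewrite lerD//; last by rewrite ler_wpM2r ?mdist_ge0// ler_nat.
rewrite -lee_fin !lsc_truncE le_min !ge_min lexx/=.
by rewrite lee_fin lerD2r ler_nat mn orbT.
Qed.

(** Suppose the supremum [s] is below some [c < rho x]. Semicontinuity keeps [rho] above [c] on a
    ball of radius [d]; outside that ball the penalty [n * d] exceeds [c] for large [n]. Both cases
    put the envelope at [x] above [c]. *)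
Lemma lip_approx_cvg x : (lip_approx n x)%:E @[n --> \oo] --> rho x.
Proof.
have nd : nondecreasing_seq (fun n => (lip_approx n x)%:E).
  by move=> m n mn; rewrite lee_fin lip_approx_nd.
have := ereal_nondecreasing_cvgn nd.
set s := ereal_sup _; suff -> : s = rho x by [].
apply/eqP; rewrite eq_le; apply/andP; split.
  by apply: ge_ereal_sup => _ [n _ <-]; exact: lip_approx_le_rho.
rewrite leNgt; apply/negP => srho.
have lip_s n : ((lip_approx n x)%:E <= s)%E by apply: ereal_sup_ubound; exists n.
have sfin : s \is a fin_num.
  rewrite fin_numElt (lt_le_trans srho (leey _)) andbT.
  by rewrite (lt_le_trans _ (lip_s 0%N))// ltNyr.
have [c sc crho] : exists2 c, (s < c%:E)%E & (c%:E < rho x)%E.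
  rewrite -(fineK sfin) in srho *; case: (rho x) srho => [r| |]//.
    rewrite lte_fin => sr; exists ((fine s + r) / 2); rewrite lte_fin; lra.
  by move=> _; exists (fine s + 1); rewrite ?ltry// lte_fin ltrDl.
have [V] := lrho crho.
rewrite -metricType_numDomainType.filter_from_mdist_nbhs => -[d /= d0 dV] Vc.
have c0 : 0 <= c.
  rewrite -lee_fin; apply: ltW; apply: le_lt_trans sc.
  by apply: le_trans (lip_s 0%N); rewrite lee_fin; exact: le_trans (ltW eta0) (lip_approx_ge _ _).
pose n := maxn (Num.truncn c).+1 (Num.truncn (c / d)).+1.
have nc : c <= n%:R.
  by apply: ltW; apply: lt_le_trans (truncnS_gt _) _; rewrite ler_nat leq_maxl.
have ncd : c <= n%:R * d.
  rewrite -ler_pdivrMr//.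
  by apply: ltW; apply: lt_le_trans (truncnS_gt _) _; rewrite ler_nat leq_maxr.
suff : c <= lip_approx n x.
  by rewrite -lee_fin => /le_trans/(_ (lip_s n)); rewrite leNgt sc.
apply: lip_approx_lb => y.
have [xyd|dxy] := ltP (mdist x y) d.
  rewrite ler_wpDr// ?mulr_ge0 ?mdist_ge0//.
  rewrite -lee_fin lsc_truncE le_min (ltW (Vc _ (dV _ xyd)))/=.
  by rewrite lee_fin ler_wpDr// ltW.
apply: le_trans ncd _; rewrite ler_wpDl//.
  exact: le_trans (ltW eta0) (lsc_trunc_ge _ _).
by rewrite ler_wpM2l.
Qed.

Lemma lip_approx_continuous n : continuous (lip_approx n).
Proof. by apply: (@lip_continuous _ _ n%:R) => // y z; exact: lip_approx_lip. Qed.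

End LscApproximation.

Section LscMajorantPower.
Context {R : realType} {X : pmetricType R}.
Variable mu : {outer_measure set X -> \bar R}.
Hypothesis borel_cara : @borel R X `<=` mu.-caratheodory.
Variable B : nat -> set X.
Hypotheses (oB : forall n, open (B n)) (muB : forall n, (mu (B n) < +oo)%E)
  (BT : \bigcup_n B n = setT).

Lemma lsc_majorant_power (g : X -> \bar R) (p : R) : 0 < p ->
  measurable_fun [set: g_sigma_algebraType (@open X)] g ->
  (forall x, (0 <= g x)%E) -> (\int[cara mu]_x (g x `^ p) < +oo)%E ->
  exists rho : X -> \bar R, [/\ lower_semicontinuous rho,
    forall x, (g x <= rho x)%E, forall x, (0 <= rho x)%E &
    (\int[cara mu]_x (rho x `^ p) < +oo)%E].
Proof.
move=> p0 mg g0 ig.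
have mgp : measurable_fun [set: g_sigma_algebraType (@open X)] (fun x => g x `^ p)%E.
  exact: (measurableT_comp (measurable_poweR p) mg).
have [h [lh gh ih]] := lsc_majorant borel_cara oB muB BT mgp (fun x => poweR_ge0 (g x) p) ig.
have h0 x : (0 <= h x)%E by apply: le_trans (gh x); exact: poweR_ge0.
have pi0 : 0 < p^-1 by rewrite invr_gt0.
exists (fun x => (h x `^ p^-1)%E); split.
- exact: lsc_poweR.
- move=> x; have := gt0_ler_poweR (ltW pi0); move/(_ (g x `^ p)%E (h x)).
  rewrite !in_itv/= !leey poweR_ge0 h0 gh => /(_ isT isT isT).
  by rewrite -poweRrM divff ?gt_eqF// poweRe1.
- by move=> x; exact: poweR_ge0.
- under eq_integral do rewrite -poweRrM mulVf ?gt_eqF// poweRe1//.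
  exact: ih.
Qed.

End LscMajorantPower.

(** * Properness *)

Section Packing.
Context {R : realType} {X : pmetricType R}.
Variable mu : {outer_measure set X -> \bar R}.
Hypothesis borel_cara : @borel R X `<=` mu.-caratheodory.

Definition separated (r : R) (s : seq X) := uniq s /\
  forall c c', c \in s -> c' \in s -> c != c' -> r <= mdist c c'.

(** Balls of half the separation are disjoint, so their integrals add up inside [V]. With [f = 1]
    this bounds the size of nets, with [f = rho^p] the number of bad balls. *)
Lemma packing_le_integral (r t : R) (s : seq X) (V : set X) (f : X -> \bar R) :
  separated r s -> measurable (V : set (caratheodory_type mu)) ->
  measurable_fun [set: caratheodory_type mu] f -> (forall x, (0 <= f x)%E) ->
  (forall c, c \in s -> ball c (r / 2) `<=` V) ->
  (forall c, c \in s -> (t%:E <= \int[cara mu]_(x in ball c (r / 2)%R) f x)%E) ->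
  (((size s)%:R * t)%:E <= \int[cara mu]_(x in V) f x)%E.
Proof.
move=> [us sepr] mV mf f0 sV sf.
pose F c : set (caratheodory_type mu) := ball (c : X) (r / 2).
have mF c : measurable (F c) by exact: (ball_cara borel_cara).
have tF : trivIset [set` s] F.
  move=> c c' /= cs c's [z []]; rewrite /F ballEmdist/= => cz.
  rewrite ballEmdist/= => c'z; apply/eqP; apply: contraT => cc'.
  have := sepr _ _ cs c's cc'; rewrite leNgt => /negP; case.
  apply: le_lt_trans (metric_triangle _ z _) _.
  by rewrite (metric_sym z) (splitr r) ltrD.
apply: (@le_trans _ _ (\int[cara mu]_(x in \big[setU/set0]_(c <- s) F c) f x)%E).
  rewrite ge0_integral_bigsetU//; last exact: measurable_funS mf.
  elim: s sf {us sepr sV tF} => [|c s ih] sf; first by rewrite mul0r big_nil.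
  rewrite big_cons/= -natr1 mulrDl mul1r addrC EFinD leeD//.
    by apply: sf; rewrite inE eqxx.
  by apply: ih => c' c's; apply: sf; rewrite inE c's orbT.
apply: ge0_subset_integral => //.
- exact: bigsetU_measurable.
- exact: measurable_funS mf.
- by move=> x; rewrite -bigcup_seq => -[c /= cs]; exact: sV.
Qed.

Variables (Q C : R).
Hypotheses (C1 : 1 <= C) (ahl : forall (x : X) (r : R), 0 < r ->
  ((r `^ Q / C)%:E <= mu (ball x r) <= (C * r `^ Q)%:E)%E).

(** A separated family of maximal size is a net, since an uncovered point could be added to it. *)
Lemma finite_net (A : set X) (x0 : X) (K r : R) : 0 < K -> 0 < r ->
  A `<=` ball x0 K ->
  exists s : seq X, [/\ separated r s, forall c, c \in s -> A c &
    forall x, A x -> exists2 c, c \in s & mdist c x < r].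
Proof.
move=> K0 r0 AK.
pose P (n : nat) := `[< exists s, [/\ separated r s, forall c, c \in s -> A c &
   size s = n] >].
have C0 : 0 < C by exact: lt_le_trans C1.
have r20 : 0 < r / 2 by rewrite divr_gt0.
have rQ : 0 < (r / 2) `^ Q / C by rewrite divr_gt0// powR_gt0.
(* The upper mass bound of the enlarged ball divided by the lower mass bound of one small ball. *)
pose N := Num.truncn (C * (K + r) `^ Q / ((r / 2) `^ Q / C)).
have PN n : P n -> (n <= N)%N.
  move=> /asboolP[s [seps sA <-]].
  rewrite -ltnS -(ltr_nat R); apply: le_lt_trans (truncnS_gt _).
  rewrite ler_pdivlMr// -lee_fin.
  have mb x t : measurable (ball x t : set (caratheodory_type mu)).
    exact: (ball_cara borel_cara).
  have := @packing_le_integral r ((r / 2) `^ Q / C) s (ball x0 (K + r)) (cst 1%E)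
    seps (mb _ _) (measurable_cst _) (fun=> lee01).
  rewrite integral_cst// mul1e => H.
  apply: le_trans (H _ _) _.
  - move=> c /sA/AK; rewrite !ballEmdist => xc z /= cz.
    apply: le_lt_trans (metric_triangle _ c _) _; rewrite ltrD//.
    by apply: (lt_le_trans cz); lra.
  - move=> c cs; rewrite integral_cst// mul1e.
    by have /andP[] := ahl c r20.
  - have Kr0 : 0 < K + r by rewrite addr_gt0.
    by have /andP[] := ahl x0 Kr0.
have P0 : exists n, P n.
  by exists 0%N; apply/asboolP; exists [::]; split.
case: (ex_maxnP P0 PN) => n /asboolP[s [[us seps] sA sn]] nmax.
exists s; split => // x Ax; apply: contrapT => H.
have far c : c \in s -> r <= mdist c x.
  by move=> cs; rewrite leNgt; apply/negP => cx; apply: H; exists c.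
have xs : x \notin s.
  by apply/negP => /far; rewrite mdistxx leNgt r0.
suff /nmax : P n.+1 by rewrite ltnn.
apply/asboolP; exists (x :: s); split; last by rewrite /= sn.
  split; first by rewrite /= xs.
  move=> c c'; rewrite !inE => /predU1P[->|cs] /predU1P[->|c's]; rewrite ?eqxx//.
  - by rewrite metric_sym => _; exact: far.
  - by move=> _; exact: far.
  - exact: seps.
by move=> c; rewrite inE => /predU1P[->//|]; exact: sA.
Qed.

(** If an ultrafilter contained no ball of radius [e], it would contain the complements of the
    finitely many balls that cover [ball x0 K], hence the empty set. *)
Lemma ultra_bounded_cauchy (F : set_system X) (x0 : X) (K : R) :
  ProperFilter F -> (forall A, F A \/ F (~` A)) ->
  0 < K -> F (ball x0 K) -> cauchy F.
Proof.
move=> FF FU K0 FK; apply: cauchy_exP => e e0.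
have [s [_ _ sc]] := finite_net K0 e0 (@subset_refl _ (ball x0 K)).
apply: contrapT => nF.
have far (s' : seq X) : F [set z | forall c, c \in s' -> ~ ball c e z].
  elim: s' => [|c s' ih]; first by apply: filterS filterT => z _ c.
  have [Fc|Fc] := FU (ball c e).
    by exfalso; apply: nF; exists c.
  apply: filterS2 Fc ih => z nz zs c'.
  by rewrite inE => /predU1P[->|]; [exact: nz|exact: zs].
have [x [xK nx]] := filter_ex (filterI FK (far s)).
by have [c cs cx] := sc x xK; apply: (nx c cs); rewrite ballEmdist.
Qed.

End Packing.

(** * Chains and their limit curves *)

Section Chains.
Context {R : realType} {X : pmetricType R}.
Implicit Types (f : X -> R) (z : X) (s : seq X) (t : R).

(** A left Riemann sum for the integral of [f]: the weight sits at the start of each step, so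
    reversing a chain may change its cost. *)
Fixpoint chain_cost f z s : R :=
  if s is z' :: s' then f z * mdist z z' + chain_cost f z' s' else 0.

Definition chain (e : R) z s : bool := path (fun y y' => mdist y y' < e) z s.

(* The position reached along the chain after spending the cost [t]. *)
Fixpoint chain_pos f z s t : X :=
  if s is z' :: s' then
    if f z * mdist z z' <= t then chain_pos f z' s' (t - f z * mdist z z') else z
  else z.

Variables (f : X -> R) (eta kappa e : R).
Hypotheses (eta0 : 0 < eta) (feta : forall z, eta <= f z)
  (kappa0 : 0 <= kappa)
  (fkappa : forall y z, mdist y z < e -> f y * mdist y z <= kappa).

Let f0 z : 0 <= f z. Proof. exact: le_trans (ltW eta0) (feta z). Qed.

Lemma chain_cost_ge0 z s : 0 <= chain_cost f z s.
Proof. by elim: s z => //= z' s ih z; rewrite addr_ge0// mulr_ge0// mdist_ge0. Qed.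

Lemma chain_pos_end z s t : chain_cost f z s <= t -> chain_pos f z s t = last z s.
Proof.
elim: s z t => //= z' s ih z t H; rewrite ifT; first by apply: ih; lra.
by have := chain_cost_ge0 z' s; lra.
Qed.

Lemma chain_pos0 z s : chain_pos f z s 0 = z.
Proof.
elim: s z => //= z' s ih z; case: ifPn => // H.
have d0 : mdist z z' = 0.
  apply/le_anti; rewrite mdist_ge0 andbT.
  have fz : 0 < f z by exact: lt_le_trans (feta z).
  by rewrite -(pmulr_rle0 _ fz).
by rewrite d0 mulr0 subrr ih (mdist_positivity _ _ d0).
Qed.

Lemma chain_pos_start z s t : 0 <= t -> exists v,
  last z v = chain_pos f z s t /\ chain_cost f z v <= t.
Proof.
elim: s z t => [|z' s ih] z t t0; first by exists [::].
rewrite /=; case: ifPn => H; last by exists [::].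
have [|v [lv cv]] := ih z' (t - f z * mdist z z'); first by rewrite subr_ge0.
by exists (z' :: v); split => //=; rewrite addrC -lerBrDr.
Qed.

(** Positions are rounded down to vertices, so the cost between two of them may exceed [t1 - t0],
    but by no more than one step, that is, [kappa]. *)
Lemma chain_pos_sub z s t0 t1 : chain e z s -> t0 <= t1 -> exists v,
  last (chain_pos f z s t0) v = chain_pos f z s t1 /\
  chain_cost f (chain_pos f z s t0) v <= t1 - t0 + kappa.
Proof.
elim: s z t0 t1 => [|z' s ih] z t0 t1.
  by move=> _ t01; exists [::]; split => //=; rewrite addr_ge0// subr_ge0.
move=> /= /andP[zz' pz] t01.
have [H0|H0] := leP (f z * mdist z z') t0.
  rewrite ifT; last exact: le_trans t01.
  have [|v [lv cv]] := ih z' (t0 - f z * mdist z z') (t1 - f z * mdist z z') pz.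
    by rewrite lerD2r.
  by exists v; split => //; move: cv; rewrite opprB addrA subrK.
have [H1|H1] := leP (f z * mdist z z') t1; last first.
  by exists [::]; split => //=; rewrite addr_ge0// subr_ge0.
have t10 : 0 <= t1 - f z * mdist z z' by rewrite subr_ge0.
have [v [lv cv]] := chain_pos_start z' s t10.
exists (z' :: v); split => //=.
by have := fkappa zz'; lra.
Qed.

Lemma chain_cost_ge (q : R) z s : 0 <= q -> (forall y, y \in z :: s -> q <= f y) ->
  q * mdist z (last z s) <= chain_cost f z s.
Proof.
move=> q0; elim: s z => [|z' s ih] z H /=; first by rewrite mdistxx mulr0.
apply: (@le_trans _ _ (q * mdist z z' + q * mdist z' (last z' s))).
  by rewrite -mulrDr ler_wpM2l// metric_triangle.
rewrite lerD//; first by rewrite ler_wpM2r ?mdist_ge0// H// inE eqxx.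
by apply: ih => y ys; apply: H; rewrite inE ys orbT.
Qed.

Lemma chain_cost_radius z s y : y \in z :: s -> eta * mdist z y <= chain_cost f z s.
Proof.
elim: s z => [|z' s ih] z.
  by rewrite inE => /eqP ->; rewrite mdistxx mulr0.
rewrite inE => /predU1P[->|/ih H].
  by rewrite mdistxx mulr0; exact: chain_cost_ge0.
apply: (@le_trans _ _ (eta * mdist z z' + eta * mdist z' y)).
  by rewrite -mulrDr (ler_wpM2l (ltW eta0))// metric_triangle.
by rewrite /= lerD// ler_wpM2r ?mdist_ge0.
Qed.

Lemma chain_pos_mdist z s t0 t1 : chain e z s -> t0 <= t1 ->
  eta * mdist (chain_pos f z s t0) (chain_pos f z s t1) <= t1 - t0 + kappa.
Proof.
move=> zs t01; have [v [<- cv]] := chain_pos_sub zs t01.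
apply: le_trans cv; apply: chain_cost_radius; exact: mem_last.
Qed.

(* [h] is a lower bound of [f] that is Lipschitz, hence almost constant along a
   short piece of a chain. *)
Lemma chain_pos_weighted (h : X -> R) (M : R) z s t0 t1 : 0 <= M ->
  (forall y, h y <= f y) -> (forall y y', h y <= h y' + M * mdist y y') ->
  chain e z s -> t0 <= t1 ->
  (h (chain_pos f z s t0) - M * ((t1 - t0 + kappa) / eta)) *
    mdist (chain_pos f z s t0) (chain_pos f z s t1) <= t1 - t0 + kappa.
Proof.
move=> M0 hf hM zs t01; have [v [<- cv]] := chain_pos_sub zs t01.
set a := chain_pos f z s t0; set D := t1 - t0 + kappa.
have D0 : 0 <= D by rewrite addr_ge0// subr_ge0.
have [q0|q0] := leP 0 (h a - M * (D / eta)); last first.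
  by apply: le_trans D0; rewrite mulr_le0_ge0 ?mdist_ge0// ltW.
apply: le_trans (cv); apply: chain_cost_ge => // y yv.
apply: le_trans (hf y); rewrite lerBlDr.
apply: le_trans (hM a y) _; rewrite lerD2l ler_wpM2l// ler_pdivlMr// mulrC.
apply: le_trans (chain_cost_radius yv) _.
exact: cv.
Qed.

End Chains.

Section LimitCurve.
Context {R : realType} {X : pmetricType R}.
Notation leb := (@lebesgue_measure R).

(* That is, [X] is proper. *)
Hypothesis properX : forall (F : set_system X) (x0 : X) (K : R),
  ProperFilter F -> (forall A, F A \/ F (~` A)) -> 0 < K -> F (ball x0 K) ->
  exists l : X, F --> l.

Variables (f : nat -> X -> R) (eta T : R) (x0 x1 : X) (e kappa : nat -> R).
Variable s : nat -> seq X.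
Hypotheses (eta0 : 0 < eta) (feta : forall n z, eta <= f n z)
  (flip : forall n y z, f n y <= f n z + n%:R * mdist y z)
  (fnd : forall m n z, (m <= n)%N -> f m z <= f n z)
  (kappa0 : forall n, 0 <= kappa n) (kappa_cvg : kappa @ \oo --> 0)
  (fkappa : forall n y z, mdist y z < e n -> f n y * mdist y z <= kappa n)
  (T0 : 0 <= T) (schain : forall n, chain (e n) x0 (s n))
  (slast : forall n, last x0 (s n) = x1)
  (scost : forall n, chain_cost (f n) x0 (s n) <= T).

Let ga n t := chain_pos (f n) x0 (s n) t.

(* The chains are parametrized by cost: the weighted length inequality below is
   then a closed condition on pairs of points and passes to the limit. *)
Lemma limit_curve : exists g : R -> X, [/\ g 0 = x0, g T = x1,
  (forall r t, 0 <= r -> r <= t -> t <= T -> eta * mdist (g r) (g t) <= t - r) &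
  (forall m r t, 0 <= r -> r <= t -> t <= T ->
    (f m (g r) - m%:R * ((t - r) / eta)) * mdist (g r) (g t) <= t - r)].
Proof.
(* A single ultrafilter gives the limits for all [t] simultaneously, in place of a diagonal
   subsequence. *)
have [F [FU ooF]] := @ultraFilterLemma _ \oo _.
have FF : ProperFilter F := @ultra_proper _ F FU.
have ga0 n : ga n 0 = x0 by exact: chain_pos0 (feta n) _ _.
have gaT n : ga n T = x1 by rewrite /ga (chain_pos_end eta0 (feta n))// slast.
have gad n r t : r <= t -> eta * mdist (ga n r) (ga n t) <= t - r + kappa n.
  exact: (chain_pos_mdist eta0 (feta n) (kappa0 n) (@fkappa n)).
have kF : kappa @ F --> 0 by apply: cvg_trans kappa_cvg; apply: cvg_app.
have /choice[g gP] : forall t, exists l : X, 0 <= t -> ga n t @[n --> F] --> l.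
  move=> t; have [t0|t0] := leP 0 t; last by exists x0.
  have K0 : 0 < (t + 1) / eta + 1 by rewrite addr_gt0// divr_gt0// ltr_wpDl.
  have [|l lP] := @properX (ga n t @[n --> F]) x0 _ _ (fun A => in_ultra_setVsetC _ FU) K0 _.
    have : \forall n \near F, kappa n < 1 by apply: cvgr_lt kF _ ltr01.
    apply: filterS => n kn; rewrite /= ballEmdist/=.
    have := gad n 0 t t0; rewrite ga0 subr0 => H.
    apply: (@le_lt_trans _ _ ((t + 1) / eta)); last by rewrite ltrDl.
    by rewrite ler_pdivlMr// mulrC; apply: le_trans H _; rewrite lerD2l ltW.
  by exists l.
exists g.
have dcvg r t : 0 <= r -> 0 <= t ->
    mdist (ga n r) (ga n t) @[n --> F] --> mdist (g r) (g t).
  move=> r0 t0; apply/cvgrPdist_lt => d d0.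
  have d20 : 0 < d / 2 by rewrite divr_gt0.
  have /metricType_numDomainType.cvgrPdist_lt/(_ _ d20) := gP r r0.
  have /metricType_numDomainType.cvgrPdist_lt/(_ _ d20) := gP t t0.
  apply: filterS2 => n nt nr.
  rewrite ltr_norml.
  have := metric_triangle (g r) (ga n r) (g t).
  have := metric_triangle (ga n r) (ga n t) (g t).
  have := metric_triangle (ga n r) (g r) (ga n t).
  have := metric_triangle (g r) (g t) (ga n t).
  rewrite (metric_sym (ga n t) (g t)) (metric_sym (ga n r) (g r)).
  by lra.
have fcvg m r : 0 <= r -> f m (ga n r) @[n --> F] --> f m (g r).
  move=> r0; apply: (@cvg_comp _ _ _ _ (f m) _ (nbhs (g r))); first exact: gP.
  exact: (lip_continuous (ler0n _ m) (flip m)).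
have gcst t y : 0 <= t -> (forall n, ga n t = y) -> g t = y.
  move=> t0 gay; apply/mdist_positivity/le_anti; rewrite mdist_ge0 andbT.
  apply/ler_addgt0Pl => d d0; rewrite addr0.
  have /metricType_numDomainType.cvgrPdist_lt/(_ _ d0)/filter_ex[n] := gP t t0.
  by rewrite gay => /ltW.
split.
- exact: gcst.
- exact: gcst.
- move=> r t r0 rt tT.
  apply: (@ler_cvg_to _ F _ _ (fun n => eta * mdist (ga n r) (ga n t)) (fun n => t - r + kappa n)).
  + apply: cvgM; first exact: cvg_cst. apply: dcvg => //; exact: le_trans rt.
  + by rewrite -[X in _ --> X]addr0; apply: cvgD => //; exact: cvg_cst.
  + by apply: nearW => n; exact: gad.
- move=> m r t r0 rt tT.
  apply: (@ler_cvg_to _ F _ _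
    (fun n => (f m (ga n r) - m%:R * ((t - r + kappa n) / eta)) * mdist (ga n r) (ga n t))
    (fun n => t - r + kappa n)).
  + apply: cvgM; last by apply: dcvg => //; exact: le_trans rt.
    apply: cvgB; first exact: fcvg.
    apply: cvgM; first exact: cvg_cst.
    apply: cvgM; last exact: cvg_cst.
    by rewrite -[X in _ --> X]addr0; apply: cvgD => //; exact: cvg_cst.
  + by rewrite -[X in _ --> X]addr0; apply: cvgD => //; exact: cvg_cst.
  (* For [n >= m], [f m] is an [m]-Lipschitz lower bound of the weight [f n] of the [n]-th chain. *)
  + apply: ooF; exists m => // n /= mn.
    apply: (chain_pos_weighted eta0 (feta n) (kappa0 n) (@fkappa n)) => // y.
    exact: fnd.
Qed.

End LimitCurve.

Section LengthBound.
Context {R : realType} {X : pmetricType R}.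

Lemma poly_length_lip (g : R -> X) (a b c : R) s : itv_partition a b s ->
  (forall r t, a <= r -> r <= t -> t <= b -> mdist (g r) (g t) <= c * (t - r)) ->
  poly_length g a s <= c * (b - a).
Proof.
elim: s a => [|x s ih] a abs H /=.
  by rewrite (itv_partition_nil abs) subrr mulr0.
have xs := itv_partition_cons abs.
have ax : a <= x by case: abs => /= /andP[/ltW].
have xb := itv_partition_le xs.
have := H a x (lexx _) ax xb.
have := ih x xs (fun r t xr => H r t (le_trans ax xr)).
lra.
Qed.

Lemma curve_length_lip (g : R -> X) (a b c : R) :
  (forall r t, a <= r -> r <= t -> t <= b -> mdist (g r) (g t) <= c * (t - r)) ->
  (curve_length a b g <= (c * (b - a))%:E)%E.
Proof.
move=> H; rewrite curve_lengthE; apply: ge_ereal_sup => _ [s abs <-].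
by rewrite lee_fin; exact: poly_length_lip.
Qed.

End LengthBound.

(** * Line integrals along the limit curve *)

Section LimitCurveIntegral.
Context {R : realType} {X : pmetricType R}.
Notation leb := (@lebesgue_measure R).
Variables (g : R -> X) (eta T : R).
Hypotheses (eta0 : 0 < eta) (T0 : 0 <= T)
  (glip : forall r t, 0 <= r -> r <= t -> t <= T ->
    eta * mdist (g r) (g t) <= t - r).

Let glip' r t : 0 <= r -> r <= t -> t <= T -> mdist (g r) (g t) <= eta^-1 * (t - r).
Proof. by move=> r0 rt tT; rewrite mulrC ler_pdivlMr// mulrC glip. Qed.

Lemma lip_rectifiable : rectifiable 0 T g.
Proof.
split; last first.
  apply: le_lt_trans (curve_length_lip glip') _; exact: ltry.
apply/within_itv_mdistP => t; rewrite in_itv/= => /andP[t0 tT] e e0.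
exists (eta * e); first by rewrite mulr_gt0.
move=> s; rewrite in_itv/= => /andP[s0 sT] ts.
rewrite -(ltr_pM2l eta0); apply: le_lt_trans ts.
have [ts|st] := leP t s.
  by rewrite distrC ger0_norm ?subr_ge0// glip.
by rewrite metric_sym ger0_norm ?subr_ge0 ?(ltW st)// glip// ltW.
Qed.

Local Notation len := (len_upto 0 g).

Lemma lip_len r t : 0 <= r -> r <= t -> t <= T -> len t - len r <= eta^-1 * (t - r).
Proof.
move=> r0 rt tT; rewrite (len_uptoB lip_rectifiable)//.
rewrite -lee_fin fineK ?(curve_length_fin lip_rectifiable)//.
apply: curve_length_lip => r' t' rr' rt' tt'; apply: glip' => //.
  exact: le_trans r0 rr'.
exact: le_trans tt' tT.
Qed.

(** On a time interval shorter than [d] the weight in the hypothesis is at least [h (g r) / 2], so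
    the arc has length at most [2 * (t - r) / h (g r)], while [h] is at most [2 * h (g r)] on it.
    The product of these two losses is the factor 4. *)
Lemma weighted_line_integral (h : X -> R) (M : R) : 0 <= M ->
  (forall z, eta <= h z) -> (forall y z, h y <= h z + M * mdist y z) ->
  (forall r t, 0 <= r -> r <= t -> t <= T ->
    (h (g r) - M * ((t - r) / eta)) * mdist (g r) (g t) <= t - r) ->
  (line_integral 0 T g (EFin \o h) <= (4 * T)%:E)%E.
Proof.
move=> M0 heta hM hg.
have rg := lip_rectifiable.
have ch := lip_continuous M0 hM.
rewrite (line_integral_EFin T0 rg ch) lee_fin.
have cfg := arc_param_continuous T0 rg ch.
pose I t := (\int[leb]_(r in `[0%R, t]) h (arc_param 0 T g r))%R.
have I0 : I 0 = 0 by rewrite /I set_itv1 Rintegral_set1.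
(* Within time [d] the curve moves by at most [d / eta], so that [h] varies by at most [eta / 4];
   [M + 1] avoids a division by zero. *)
pose d := eta / (4 * (M + 1) / eta).
have d0 : 0 < d by rewrite divr_gt0// divr_gt0// mulr_gt0// ltr_wpDl.
have Md : M * (d / eta) <= eta / 4.
  rewrite /d invf_div.
  have M1 : M + 1 != 0 by rewrite gt_eqF// ltr_wpDl.
  have e1 : eta != 0 by rewrite gt_eqF.
  rewrite (_ : M * _ = eta / 4 * (M / (M + 1))); last by field; rewrite M1.
  rewrite ler_piMr ?divr_ge0 ?(ltW eta0)//.
  by rewrite ler_pdivrMr ?mul1r ?lerDl// ltr_wpDl.
have len0 : len 0 = 0 by exact: len_uptoa.
suff : I (len T) - I (len 0) <= 4 * T - 4 * 0.
  by rewrite len0 I0 mulr0 !subr0.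
apply: (interval_chain (F := I \o len) (G := fun t => 4 * t) d0 T0) => r t r0 rt tT trd /=.
have ed r' t' : r <= r' -> t' <= t -> M * ((t' - r') / eta) <= eta / 4.
  move=> rr' tt'; apply: le_trans Md; rewrite ler_wpM2l// ler_pM2r ?invr_gt0//.
  by apply: le_trans (ltW trd); lra.
have hr0 : 0 < h (g r) by exact: lt_le_trans (heta _).
have weighted r' t' : r <= r' -> r' <= t' -> t' <= t ->
    mdist (g r') (g t') <= 2 / h (g r) * (t' - r').
  move=> rr' rt' tt'; rewrite mulrAC ler_pdivlMr// mulrC.
  suff : h (g r) / 2 * mdist (g r') (g t') <= t' - r' by lra.
  have r'0 : 0 <= r' by exact: le_trans rr'.
  have t'T : t' <= T by exact: le_trans tT.
  have r'T : r' <= T by exact: le_trans t'T.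
  have r't : r' <= t by exact: le_trans tt'.
  refine (le_trans _ (hg r' t' r'0 rt' t'T)).
  rewrite ler_wpM2r ?mdist_ge0//.
  have H1 := hM (g r) (g r').
  have H2 : M * mdist (g r) (g r') <= eta / 4.
    apply: le_trans (ed r r' (lexx _) r't); rewrite ler_wpM2l// ler_pdivlMr// mulrC.
    exact: glip.
  have H3 := ed r' t' rr' tt'.
  have H4 := heta (g r).
  lra.
have lenr : len t - len r <= 2 / h (g r) * (t - r).
  rewrite (len_uptoB rg)// -lee_fin fineK ?(curve_length_fin rg)//.
  exact: curve_length_lip.
have lrt : len r <= len t by apply: (len_upto_homo rg).
have ltT : len t <= len T by apply: (len_upto_homo rg) => //; exact: le_trans rt.
have lr0 : 0 <= len r.
  by have := len_upto_homo rg (lexx _) r0 (le_trans rt tT); rewrite len0.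
have rT : r <= T by exact: le_trans tT.
have [|_] := andP (@integral_segmentB_bounds _ _ _ cfg (len r) (len t) 0 (2 * h (g r)) lr0 lrt ltT _).
  move=> s rs st /=; apply/andP; split; first exact: le_trans (ltW eta0) (heta _).
  have [|x [+ -> xs _]] := @arc_paramP _ _ _ _ _ T0 rg s.
    by rewrite (le_trans lr0 rs) (le_trans st ltT).
  rewrite in_itv/= => /andP[x_0 xT].
  apply: le_trans (hM _ (g r)) _.
  have dxr : mdist (g x) (g r) <= len t - len r.
    have [xr|rx] := leP x r.
      apply: le_trans (mdist_le_len rg x_0 xr rT) _; rewrite xs; lra.
    rewrite metric_sym; apply: le_trans (mdist_le_len rg r0 (ltW rx) xT) _.
    by rewrite xs; lra.
  have H1 : M * mdist (g x) (g r) <= eta / 4.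
    apply: le_trans (ed r t (lexx _) (lexx _)); rewrite ler_wpM2l//.
    by apply: le_trans dxr _; rewrite (mulrC (t - r)); exact: lip_len.
  have := heta (g r); lra.
move/le_trans; apply.
apply: (@le_trans _ _ (2 * h (g r) * (2 / h (g r) * (t - r)))).
  by rewrite ler_wpM2l// mulr_ge0// ltW.
by rewrite le_eqVlt; apply/orP; left; apply/eqP; field; rewrite gt_eqF.
Qed.

(** All the [h n] share one curve, so the bound [4 * T] is uniform in [n] and monotone convergence
    carries it to [rho]. *)
Lemma weighted_line_integral_sup (h : nat -> X -> R) (rho : X -> \bar R) :
  (forall n z, eta <= h n z) ->
  (forall n y z, h n y <= h n z + n%:R * mdist y z) ->
  (forall m n z, (m <= n)%N -> h m z <= h n z) ->
  (forall z, (h n z)%:E @[n --> \oo] --> rho z) ->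
  (forall m r t, 0 <= r -> r <= t -> t <= T ->
    (h m (g r) - m%:R * ((t - r) / eta)) * mdist (g r) (g t) <= t - r) ->
  (line_integral 0 T g rho <= (4 * T)%:E)%E.
Proof.
move=> heta hlip hnd hrho hg.
have rg := lip_rectifiable.
have -> : line_integral 0 T g rho =
    limn (fun n => line_integral 0 T g (EFin \o h n)).
  rewrite /line_integral -monotone_convergence//.
  - by apply: eq_integral => r _; apply/esym/cvg_lim => //; exact: hrho.
  - move=> n; apply/measurable_EFinP.
    apply: subspace_continuous_measurable_fun => //.
    exact: (arc_param_continuous T0 rg (lip_continuous (ler0n _ n) (hlip n))).
  - by move=> n r _; rewrite lee_fin (le_trans (ltW eta0)).
  - by move=> r _ m n mn; rewrite lee_fin hnd.
apply: lime_le.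
  apply: ereal_nondecreasing_is_cvgn => m n mn.
  apply: ge0_le_integral_nomeas => r _; rewrite lee_fin ?hnd//.
  exact: le_trans (ltW eta0) (heta _ _).
apply: nearW => n.
exact: (weighted_line_integral (ler0n _ n) (heta n) (hlip n) (hg n)).
Qed.

End LimitCurveIntegral.

(** * The truncated chain distance *)

Section ChainDistance.
Context {R : realType} {X : pmetricType R}.
Variables (f : X -> R) (e T : R) (x0 : X).
Hypotheses (e0 : 0 < e) (T0 : 0 <= T) (f0 : forall z, 0 < f z)
  (ff : forall z z', mdist z z' < e -> f z <= 2 * f z').

(* The truncation at [T] makes the infimum bounded and never empty. *)
Definition chain_dist (x : X) : R :=
  inf ([set T] `|` [set chain_cost f x0 s | s in
    [set s | chain e x0 s /\ last x0 s = x]]).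

Let costs x := [set T] `|` [set chain_cost f x0 s | s in
    [set s | chain e x0 s /\ last x0 s = x]].

Let cost_ge0 z s : 0 <= chain_cost f z s.
Proof. by elim: s z => //= z' s ih z; rewrite addr_ge0// mulr_ge0 ?mdist_ge0// ltW. Qed.

Let costs_inf x : has_inf (costs x).
Proof.
split; first by exists T; left.
by exists 0 => _ [->//|[s _ <-]]; exact: cost_ge0.
Qed.

Lemma chain_dist_le x c : costs x c -> chain_dist x <= c.
Proof. by move=> xc; apply: (ge_inf (proj2 (costs_inf x))). Qed.

Lemma chain_dist_ge x c : (forall d, costs x d -> c <= d) -> c <= chain_dist x.
Proof. by move=> H; apply: lb_le_inf; [exact: (proj1 (costs_inf x))|exact: H]. Qed.

Lemma chain_dist_ge0 x : 0 <= chain_dist x.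
Proof. by apply: chain_dist_ge => _ [->//|[s _ <-]]; exact: cost_ge0. Qed.

Lemma chain_dist_leT x : chain_dist x <= T.
Proof. by apply: chain_dist_le; left. Qed.

Lemma chain_dist0 : chain_dist x0 = 0.
Proof.
apply/le_anti; rewrite chain_dist_ge0 andbT.
by apply: chain_dist_le; right; exists [::].
Qed.

Lemma chain_dist_step z z' : mdist z z' < e ->
  chain_dist z' <= chain_dist z + f z * mdist z z'.
Proof.
move=> zz'; rewrite -lerBlDr; apply: chain_dist_ge => _ [->|[s [sc sl] <-]].
  rewrite lerBlDr; apply: le_trans (chain_dist_leT z') _.
  by rewrite lerDl mulr_ge0 ?mdist_ge0// ltW.
rewrite lerBlDr; apply: chain_dist_le; right; exists (rcons s z').
  by split; [rewrite /chain rcons_path -/(chain e x0 s) sc sl|rewrite last_rcons].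
elim: s x0 sl {sc} => [|y s ih] z0 /=; first by move=> ->; rewrite addr0 add0r.
by move=> /ih ->; rewrite addrA.
Qed.

(** The factor 2 pays for the backward step, whose weight is [f z'] instead of [f z]. *)
Lemma chain_dist_local_lip z z' : mdist z z' < e ->
  `|chain_dist z - chain_dist z'| <= 2 * f z * mdist z z'.
Proof.
move=> zz'; have z'z : mdist z' z < e by rewrite metric_sym.
have := chain_dist_step zz'; have := chain_dist_step z'z.
rewrite (metric_sym z' z).
have : f z' * mdist z z' <= 2 * f z * mdist z z' by rewrite ler_wpM2r ?mdist_ge0// ff.
have : f z * mdist z z' <= 2 * f z * mdist z z'.
  by rewrite ler_wpM2r ?mdist_ge0//; have := f0 z; lra.
rewrite ler_norml; lra.
Qed.

Lemma chain_dist_continuous : continuous chain_dist.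
Proof.
move=> x; apply/cvgrPdist_lt => d d0.
apply/metricType_numDomainType.nbhs_mdistP.
exists (Num.min e (d / (2 * f x))).
  by rewrite /= lt_min e0 divr_gt0// mulr_gt0.
move=> y /=; rewrite lt_min => /andP[xye]; rewrite ltr_pdivlMr ?mulr_gt0// mulrC.
by apply: le_lt_trans; exact: chain_dist_local_lip.
Qed.

(** One factor 2 comes from [chain_dist_local_lip], the other from [upper_gradient_local_lip]. *)
Lemma chain_dist_upper_gradient : continuous f ->
  upper_gradient chain_dist (fun z => (4 * f z)%:E).
Proof.
move=> cf; have cf2 : continuous (fun z => 2 * f z).
  by move=> x; apply: cvgM; [exact: cvg_cst|exact: cf].
have := @upper_gradient_local_lip _ _ chain_dist (fun z => 2 * f z) e e0 cf2.
have -> : (fun z => (2 * (2 * f z))%:E) = (fun z => (4 * f z)%:E).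
  by apply/funext => z; rewrite mulrA -natrM.
apply.
- by move=> z; rewrite mulr_ge0// ltW.
- exact: chain_dist_local_lip.
- by move=> z z' /ff; rewrite mulrCA ler_pM2l.
Qed.

End ChainDistance.

Section PointwiseChain.
Context {R : realType} {X : pmetricType R}.
Hypothesis properX : forall (F : set_system X) (x0 : X) (K : R),
  ProperFilter F -> (forall A, F A \/ F (~` A)) -> 0 < K -> F (ball x0 K) ->
  exists l : X, F --> l.

Variables (rho : X -> \bar R) (eta : R).
Hypotheses (lrho : lower_semicontinuous rho) (eta0 : 0 < eta)
  (rho_eta : forall x, (eta%:E <= rho x)%E).

(* So small that [f n] varies by a factor at most 2 along one step, and one step
   costs at most [eta / (n + 1)]. *)
Definition chain_mesh (n : nat) : R := eta / ((n%:R + 1 + eta) * n.+1%:R).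

Let f := lip_approx rho eta.

Lemma chain_mesh_gt0 n : 0 < chain_mesh n.
Proof.
by rewrite divr_gt0// mulr_gt0 ?ltr0n// -addrA ltr_wpDl// addr_gt0.
Qed.

Lemma chain_mesh_step n y z : mdist y z < chain_mesh n ->
  f n y * mdist y z <= eta / n.+1%:R.
Proof.
move=> yz; apply: (@le_trans _ _ ((n%:R + eta) * chain_mesh n)).
  rewrite ler_pM ?mdist_ge0 ?(ltW yz)//.
    exact: le_trans (ltW eta0) (lip_approx_ge eta0 rho_eta _ _).
  exact: lip_approx_le_nat.
have n1 : 0 < n%:R + 1 + eta by rewrite -addrA ltr_wpDl// addr_gt0.
rewrite /chain_mesh.
rewrite (_ : _ * _ = eta / n.+1%:R * ((n%:R + eta) / (n%:R + 1 + eta))); last first.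
  have N0 : n.+1%:R != 0 :> R by [].
  move: (n%:R + eta) (n%:R + 1 + eta) (n.+1%:R : R) n1 N0 => b a N a0 N0.
  by field; rewrite N0 gt_eqF.
rewrite ler_piMr ?divr_ge0 ?(ltW eta0)//.
by rewrite ler_pdivrMr// mul1r; lra.
Qed.

Lemma chain_mesh_double n z z' : mdist z z' < chain_mesh n -> f n z <= 2 * f n z'.
Proof.
move=> zz'; apply: le_trans (lip_approx_lip eta0 rho_eta n z z') _.
rewrite (_ : 2 * _ = f n z' + f n z'); last by lra.
rewrite lerD2l.
apply: le_trans (lip_approx_ge eta0 rho_eta n z').
apply: (@le_trans _ _ (n%:R * chain_mesh n)); first by rewrite ler_wpM2l// ltW.
have n1 : 0 < n%:R + 1 + eta by rewrite -addrA ltr_wpDl// addr_gt0.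
rewrite /chain_mesh mulrCA ler_piMr ?(ltW eta0)//.
rewrite ler_pdivrMr ?mulr_gt0// mul1r.
apply: (@le_trans _ _ (n%:R + 1 + eta)).
  by rewrite -addrA lerDl addr_ge0// ltW.
by rewrite ler_peMr ?(ltW n1)// ler1n.
Qed.

(** Otherwise every mesh admits a chain of cost at most [T], and the limit curve joins [x] to [y]
    with integral at most [4 * T], against the upper gradient inequality. The 4 is the loss in
    [weighted_line_integral]. *)
Lemma exists_no_cheap_chain (u : X -> R) (g : X -> \bar R) (x y : X) (T : R) :
  upper_gradient u g -> (forall z, (g z <= rho z)%E) -> 0 <= T ->
  4 * T < `|u x - u y| ->
  exists n, forall s, chain (chain_mesh n) x s -> last x s = y ->
    T < chain_cost (f n) x s.
Proof.
move=> [mg g0 ug] grho T0 uT; apply: contrapT => H.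
have /choice[s sP] : forall n, exists s, [/\ chain (chain_mesh n) x s, last x s = y &
    chain_cost (f n) x s <= T].
  move=> n; apply: contrapT => Hn; apply: H; exists n => s sc sl.
  by rewrite ltNge; apply/negP => sT; apply: Hn; exists s.
have fge n z : eta <= f n z by exact: lip_approx_ge.
have fnd m n z : (m <= n)%N -> f m z <= f n z by exact: lip_approx_nd.
have flip n := lip_approx_lip eta0 rho_eta n.
have kcvg : (fun n => eta / n.+1%:R) @ \oo --> 0.
  rewrite -[X in _ --> X](mulr0 eta).
  by apply: cvgM; [exact: cvg_cst|exact: cvg_harmonic].
have [ga [ga0 gaT galip gaw]] := @limit_curve _ _ properX f eta T x y
   chain_mesh _ s eta0 fge flip fnd (fun n => divr_ge0 (ltW eta0) (ler0n _ _)) kcvg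
   chain_mesh_step T0 (fun n => let: And3 a _ _ := sP n in a)
   (fun n => let: And3 _ a _ := sP n in a) (fun n => let: And3 _ _ a := sP n in a).
have gT : (line_integral 0 T ga g <= (4 * T)%:E)%E.
  apply: le_trans (weighted_line_integral_sup eta0 T0 galip fge flip fnd _ gaw).
    by apply: ge0_le_integral_nomeas => t _; [exact: g0|exact: grho].
  by move=> z; exact: lip_approx_cvg.
have := le_trans (ug 0 T ga T0 (lip_rectifiable eta0 galip)) gT.
by rewrite ga0 gaT lee_fin leNgt uT.
Qed.

Lemma upper_gradient_chain_dist (u : X -> R) (g : X -> \bar R) (x y : X) (T : R) :
  upper_gradient u g -> (forall z, (g z <= rho z)%E) -> 0 <= T ->
  4 * T < `|u x - u y| ->
  exists w : X -> R, exists G : X -> \bar R, [/\ continuous w,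
    forall z, 0 <= w z <= T, upper_gradient w G,
    forall z, (G z <= 4%:E * rho z)%E & w x = 0 /\ w y = T].
Proof.
move=> ug grho T0 uT.
have [n nP] := exists_no_cheap_chain ug grho T0 uT.
have fpos z : 0 < f n z by apply: lt_le_trans eta0 (lip_approx_ge _ _ _ _).
exists (chain_dist (f n) (chain_mesh n) T x), (fun z => (4 * f n z)%:E); split.
- apply: chain_dist_continuous => //; [exact: chain_mesh_gt0|exact: chain_mesh_double].
- by move=> z; rewrite chain_dist_ge0// chain_dist_leT.
- apply: chain_dist_upper_gradient => //; first exact: chain_mesh_gt0.
    exact: chain_mesh_double.
  exact: (lip_approx_continuous eta0 rho_eta).
- by move=> z; rewrite EFinM lee_wpmul2l ?lee_fin// lip_approx_le_rho.
(* Every chain to [y] costs more than [T], so the truncation makes the distance exactly [T]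
   there. *)
- split; first exact: chain_dist0.
  apply/le_anti; rewrite chain_dist_leT//=; apply: chain_dist_ge => //.
  by move=> _ [->//|[s [sc sl] <-]]; apply: ltW; exact: nP.
Qed.

End PointwiseChain.

(** * Pointwise estimates *)

Section Telescoping.
Context {R : realType} {X : pmetricType R}.
Variable mu : {outer_measure set X -> \bar R}.
Hypothesis borel_cara : @borel R X `<=` mu.-caratheodory.
Variables (Q C : R).
Hypotheses (C1 : 1 <= C) (ahl : forall (x : X) (r : R), 0 < r ->
  ((r `^ Q / C)%:E <= mu (ball x r) <= (C * r `^ Q)%:E)%E).

Local Notation m x r := (fine (mu (ball x r))).

Let mball (x : X) (r : R) : measurable (ball x r : set (caratheodory_type mu)).
Proof. exact: (ball_cara borel_cara). Qed.

Let C0 : 0 < C. Proof. exact: lt_le_trans C1. Qed.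

Lemma ball_measure_fin x r : 0 < r -> mu (ball x r) \is a fin_num.
Proof.
move=> r0; have /andP[_ H] := ahl x r0.
by rewrite ge0_fin_numE ?outer_measure_ge0// (le_lt_trans H)// ltry.
Qed.

Lemma ball_measure_ge x r : 0 < r -> r `^ Q / C <= m x r.
Proof.
move=> r0; have /andP[H _] := ahl x r0.
by rewrite -lee_fin fineK// ball_measure_fin.
Qed.

Lemma ball_measure_le x r : 0 < r -> m x r <= C * r `^ Q.
Proof.
move=> r0; have /andP[_ H] := ahl x r0.
by rewrite -lee_fin fineK// ball_measure_fin.
Qed.

Lemma ball_measure_gt0 x r : 0 < r -> 0 < m x r.
Proof.
by move=> r0; apply: lt_le_trans (ball_measure_ge x r0); rewrite divr_gt0 ?powR_gt0.
Qed.

Lemma ball_measure_ratio x y r : 0 < r ->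
  (m y (r / 2))^-1 * m x r <= C ^+ 2 * 2 `^ Q.
Proof.
move=> r0; have r20 : 0 < r / 2 by rewrite divr_gt0.
rewrite mulrC ler_pdivrMr ?ball_measure_gt0//.
apply: le_trans (ball_measure_le x r0) _.
apply: (@le_trans _ _ (C ^+ 2 * 2 `^ Q * ((r / 2) `^ Q / C))); last first.
  by rewrite ler_wpM2l ?ball_measure_ge// mulr_ge0 ?powR_ge0// exprn_ge0// ltW.
have -> : r `^ Q = 2 `^ Q * (r / 2) `^ Q by rewrite -powRM ?(ltW r20)// mulrC divfK.
by rewrite le_eqVlt; apply/orP; left; apply/eqP; field; rewrite gt_eqF.
Qed.

Variable w : X -> R.
Variable M : R.
Hypotheses (cw : continuous w) (wM : forall z, 0 <= w z <= M).

Lemma continuous_cara (h : X -> R) : continuous h ->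
  measurable_fun [set: caratheodory_type mu] h.
Proof.
move=> ch; apply/measurable_EFinP.
exact: (borel_fun_cara borel_cara (lsc_borel_measurable (continuous_EFin_lsc ch))).
Qed.

Lemma bounded_integrable_ball (h : X -> R) (N : R) x r : 0 < r ->
  continuous h -> (forall z, `|h z| <= N) ->
  (cara mu).-integrable (ball x r) (EFin \o h).
Proof.
move=> r0 ch hN; apply: measurable_bounded_integrable.
- exact: mball.
- by rewrite -ge0_fin_numE//; exact: ball_measure_fin.
- by apply: measurable_funS (continuous_cara ch).
- exists N; split; first exact: num_real.
  by move=> y Ny z _ /=; apply: le_trans (hN z) (ltW Ny).
Qed.

Let wabs c z : `|w z - c| <= M + `|c|.
Proof.
apply: le_trans (ler_normB _ _) _; rewrite lerD2r.
by have /andP[w0 wM'] := wM z; rewrite ger0_norm.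
Qed.

Let cwc c : continuous (fun z => w z - c).
Proof. by move=> x; apply: cvgB; [exact: cw|exact: cvg_cst]. Qed.

Let cnwc c : continuous (fun z => `|w z - c|).
Proof. by move=> x; apply: cvg_norm; exact: cwc. Qed.

Lemma bounded_integrable_on_balls : integrable_on_balls mu w.
Proof.
move=> x r r0; apply: (@bounded_integrable_ball _ M) => // z.
by have /andP[w0 wM'] := wM z; rewrite ger0_norm.
Qed.

Lemma mean_dist (x : X) (r c : R) : 0 < r ->
  `|mean mu (ball x r) w - c| <=
    (m x r)^-1 * Rintegral (cara mu) (ball x r) (fun z => `|w z - c|).
Proof.
move=> r0; have m0 := ball_measure_gt0 x r0.
have ib : (cara mu).-integrable (ball x r) (EFin \o (fun z => w z - c)).
  exact: (bounded_integrable_ball x r0 (@cwc c) (wabs c)).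
have -> : mean mu (ball x r) w - c =
    (m x r)^-1 * Rintegral (cara mu) (ball x r) (fun z => w z - c).
  have iw := @bounded_integrable_on_balls x r r0.
  have ic : (cara mu).-integrable (ball x r) (EFin \o cst c).
    by apply: (@bounded_integrable_ball (cst c) `|c|) => // z; exact: cst_continuous.
  rewrite (RintegralB (mball x r) iw ic).
  rewrite Rintegral_cst; last exact: mball.
  by rewrite mulrBr /mean mulrCA mulVf ?mulr1// gt_eqF.
rewrite normrM gtr0_norm ?invr_gt0// ler_wpM2l ?invr_ge0 ?(ltW m0)//.
by apply: le_normr_Rintegral => //; exact: mball.
Qed.

Definition osc_le (x : X) (r D : R) :=
  Rintegral (cara mu) (ball x r) (fun z => `|w z - mean mu (ball x r) w|) <= m x r * D.

Lemma Rintegral_ballS x y r t c : 0 < r -> ball y t `<=` ball x r -> 0 < t ->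
  Rintegral (cara mu) (ball y t) (fun z => `|w z - c|) <=
  Rintegral (cara mu) (ball x r) (fun z => `|w z - c|).
Proof.
move=> r0 sub t0; apply: fine_le.
- apply: integrable_fin_num; first exact: mball.
  by apply: (bounded_integrable_ball _ _ (@cnwc c)) => // z; rewrite normr_id; exact: wabs.
- apply: integrable_fin_num; first exact: mball.
  by apply: (bounded_integrable_ball _ _ (@cnwc c)) => // z; rewrite normr_id; exact: wabs.
apply: ge0_subset_integral => //.
apply/measurable_EFinP; exact: measurable_funS (continuous_cara (@cnwc c)).
Qed.

(** The centre may move: with [y = x] this is a step of the telescoping sum, with [y] near [x] it
    passes from balls around one point to balls around the other. *)
Lemma mean_half_ball x y r D : 0 < r -> 0 <= D -> ball y (r / 2) `<=` ball x r ->
  osc_le x r D ->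
  `|mean mu (ball y (r / 2)) w - mean mu (ball x r) w| <= C ^+ 2 * 2 `^ Q * D.
Proof.
move=> r0 D0 sub osc; have r20 : 0 < r / 2 by rewrite divr_gt0.
apply: le_trans (mean_dist _ _ r20) _.
have m0 := ball_measure_gt0 y r20.
apply: (@le_trans _ _ ((m y (r / 2))^-1 * (m x r * D))).
  rewrite ler_wpM2l ?invr_ge0 ?(ltW m0)//.
  by apply: le_trans osc; exact: Rintegral_ballS.
by rewrite mulrA ler_wpM2r// ball_measure_ratio.
Qed.

(** This is where continuity of [w] pays off: every point is a Lebesgue point. *)
Lemma mean_close (x : X) (e : R) : 0 < e -> exists2 d, 0 < d &
  forall r, 0 < r -> r <= d -> `|mean mu (ball x r) w - w x| <= e.
Proof.
move=> e0; have /cvgrPdist_lt/(_ _ e0) := @cw x.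
move=> /metricType_numDomainType.nbhs_mdistP[d /= d0 dP]; exists d => // r r0 rd.
apply: le_trans (mean_dist _ _ r0) _.
have m0 := ball_measure_gt0 x r0.
rewrite mulrC ler_pdivrMr//.
apply: (@le_trans _ _ (Rintegral (cara mu) (ball x r) (cst e))); last first.
  by rewrite Rintegral_cst//; exact: mball.
apply: le_Rintegral; first exact: mball.
- by apply: (bounded_integrable_ball _ _ (@cnwc (w x))) => // z; rewrite normr_id; exact: wabs.
- apply: (@bounded_integrable_ball (cst e) `|e|) => // z; exact: cst_continuous.
move=> z; rewrite ballEmdist/= => xz; rewrite distrC ltW// dP//=.
exact: lt_le_trans rd.
Qed.

Lemma telescoping (x : X) (b q : R) : 0 <= b -> 0 < q -> q < 1 ->
  (forall i, osc_le x (2 * 2^-1 ^+ i) (b * q ^+ i)) ->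
  `|w x - mean mu (ball x 2) w| <= C ^+ 2 * 2 `^ Q * b / (1 - q).
Proof.
move=> b0 q0 q1 osc.
set K := C ^+ 2 * 2 `^ Q.
have K0 : 0 <= K by rewrite mulr_ge0 ?powR_ge0// exprn_ge0// ltW.
have q10 : 0 < 1 - q by rewrite subr_gt0.
pose r i : R := 2 * 2^-1 ^+ i.
have r0 i : 0 < r i by rewrite mulr_gt0 ?exprn_gt0.
have rS i : r i.+1 = r i / 2 by rewrite /r exprSr mulrA.
have step n : `|mean mu (ball x (r n)) w - mean mu (ball x 2) w| <=
    K * b * (1 - q ^+ n) / (1 - q).
  elim: n => [|n ih].
    by rewrite /r !expr0 mulr1 !subrr normr0 mulr0 mul0r.
  have H : `|mean mu (ball x (r n.+1)) w - mean mu (ball x (r n)) w| <= K * (b * q ^+ n).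
    rewrite rS; apply: mean_half_ball => //.
      by rewrite mulr_ge0// exprn_ge0// ltW.
    by apply: le_ball; have := r0 n; lra.
    exact: osc.
  have -> : K * b * (1 - q ^+ n.+1) / (1 - q) =
      K * (b * q ^+ n) + K * b * (1 - q ^+ n) / (1 - q).
    by rewrite exprS; field; rewrite gt_eqF.
  apply: le_trans (ler_distD (mean mu (ball x (r n)) w) _ _) _.
  exact: lerD.
apply/ler_addgt0Pl => e e0.
have [d d0 dP] := mean_close x e0.
have [n nd] : exists n, r n <= d.
  have [n nP] := ltr_exp2 (2 / d).
  exists n; rewrite /r exprVn ler_pdivrMr ?exprn_gt0// mulrC -ler_pdivrMr//.
  exact: ltW.
apply: le_trans (ler_distD (mean mu (ball x (r n)) w) _ _) _.
apply: lerD; first by rewrite distrC; exact: dP.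
apply: le_trans (step n) _.
rewrite ler_wpM2r ?invr_ge0 ?(ltW q10)//.
have qn : 0 <= q ^+ n by rewrite exprn_ge0// ltW.
by apply: ler_piMr; [exact: mulr_ge0|lra].
Qed.

End Telescoping.

Section PoincarePointwise.
Context {R : realType} {X : pmetricType R}.
Variable mu : {outer_measure set X -> \bar R}.
Hypothesis borel_cara : @borel R X `<=` mu.-caratheodory.
Variables (Q C : R).
Hypotheses (C1 : 1 <= C) (ahl : forall (x : X) (r : R), 0 < r ->
  ((r `^ Q / C)%:E <= mu (ball x r) <= (C * r `^ Q)%:E)%E).
Variables (p Cp lam : R).
Hypotheses (p1 : 1 <= p) (Cp0 : 0 < Cp) (lam1 : 1 <= lam)
  (poinc : forall (u : X -> R) (rho : X -> \bar R),
      integrable_on_balls mu u -> upper_gradient u rho ->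
      forall (x : X) (r : R), 0 < r ->
        (((fine (mu (ball x r)))^-1)%:E *
           \int[cara mu]_(y in ball x r) `|u y - mean mu (ball x r) u|%:E
         <= (Cp * r)%:E *
            (((fine (mu (ball x (lam * r))))^-1)%:E *
               \int[cara mu]_(y in ball x (lam * r)%R) (rho y `^ p))
            `^ p^-1)%E).

Local Notation m x r := (fine (mu (ball x r))).

Let p0 : 0 < p. Proof. exact: lt_le_trans p1. Qed.
Let pi0 : 0 < p^-1. Proof. by rewrite invr_gt0. Qed.
Let C0 : 0 < C. Proof. exact: lt_le_trans C1. Qed.
Let lam0 : 0 < lam. Proof. exact: lt_le_trans lam1. Qed.

Definition dradius (i : nat) : R := 2 * 2^-1 ^+ i.

Lemma dradius_gt0 i : 0 < dradius i.
Proof. by rewrite mulr_gt0 ?exprn_gt0. Qed.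

(** The energy is tested on the enlarged balls on the right of the Poincare inequality. The radii
    start at 2, so that the first ball around [x] contains the unit ball around any point at
    distance less than 1. *)
Definition good (rho : X -> \bar R) (x : X) (S al : R) := forall i,
  (\int[cara mu]_(y in ball x (lam * dradius i)%R) (rho y `^ p) <=
    (S * dradius i `^ (Q - p + al))%:E)%E.

Lemma ler_poweR_finite (q : R) (x y : \bar R) : 0 <= q -> (0 <= x)%E -> (x <= y)%E ->
  (x `^ q <= y `^ q)%E.
Proof.
move=> q0 x0 xy; have := gt0_ler_poweR q0; apply; rewrite ?in_itv/= ?leey ?x0//.
by rewrite (le_trans x0).
Qed.

Lemma poincare_osc (w : X -> R) (T : R) (G rho : X -> \bar R) (x : X) (r V : R) :
  continuous w -> (forall z, 0 <= w z <= T) -> upper_gradient w G ->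
  (forall z, (G z <= 4%:E * rho z)%E) -> (forall z, (0 <= rho z)%E) ->
  measurable_fun [set: caratheodory_type mu] rho -> 0 < r -> 0 <= V ->
  (\int[cara mu]_(y in ball x (lam * r)%R) (rho y `^ p) <= V%:E)%E ->
  osc_le mu w x r (Cp * r * (C * (lam * r) `^ (- Q) * (4 `^ p * V)) `^ p^-1).
Proof.
move=> cw wT ug Grho rho0 mrho r0 V0 HV.
have iw := bounded_integrable_on_balls borel_cara ahl cw wT.
have lr0 : 0 < lam * r by rewrite mulr_gt0.
have := poinc iw ug x r0.
set I1 := (\int[_]_(_ in _) _)%E; set I2 := (\int[_]_(_ in _) _)%E => H.
have m0 := ball_measure_gt0 C1 ahl x r0.
have ml0 := ball_measure_gt0 C1 ahl x lr0.
have I2le : (I2 <= (4 `^ p * V)%:E)%E.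
  apply: (@le_trans _ _ (\int[cara mu]_(y in ball x (lam * r)%R) ((4 `^ p)%:E * rho y `^ p))%E).
    apply: ge0_le_integral_nomeas => z _; first exact: poweR_ge0.
    have [_ G0 _] := ug.
    rewrite -poweR_EFin -poweRM ?lee_fin//.
    by apply: ler_poweR_finite => //; exact: ltW.
  rewrite ge0_integralZl//.
  - by rewrite EFinM lee_wpmul2l// lee_fin powR_ge0.
  - exact: (ball_cara borel_cara).
  - by apply: measurable_funTS; exact: (measurableT_comp (measurable_poweR p) mrho).
  - by move=> z _; exact: poweR_ge0.
have I20 : (0 <= I2)%E by apply: integral_ge0 => z _; exact: poweR_ge0.
have : ((m x r)^-1%:E * I1 <= (Cp * r * (C * (lam * r) `^ (- Q) * (4 `^ p * V)) `^ p^-1)%:E)%E.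
  apply: le_trans H _; rewrite [in leRHS]EFinM lee_wpmul2l//.
    by rewrite lee_fin mulr_ge0// ltW.
  rewrite -poweR_EFin; apply: ler_poweR_finite; first exact: ltW.
    by rewrite mule_ge0// lee_fin invr_ge0 ltW.
  rewrite EFinM; apply: lee_pmul => //; first by rewrite lee_fin invr_ge0 ltW.
  rewrite lee_fin powRN.
  have := ball_measure_ge ahl x lr0.
  by move=> H2; rewrite -[leRHS]invf_div lef_pV2 ?posrE ?divr_gt0 ?powR_gt0//.
have I1E : I1 = (Rintegral (cara mu) (ball x r) (fun z => `|w z - mean mu (ball x r) w|))%:E.
  rewrite /Rintegral fineK//; apply: integrable_fin_num; first exact: (ball_cara borel_cara).
  apply: (bounded_integrable_ball borel_cara ahl (N := T + `|mean mu (ball x r) w|)) => //.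
    by move=> z; apply: cvg_norm; apply: cvgB; [exact: cw|exact: cvg_cst].
  move=> z; rewrite normr_id; apply: le_trans (ler_normB _ _) _; rewrite lerD2r.
  by have /andP[w0 wT'] := wT z; rewrite ger0_norm.
by rewrite I1E -EFinM lee_fin mulrC ler_pdivrMr// mulrC.
Qed.

Definition osc_cst : R := Cp * (C * lam `^ (- Q) * 4 `^ p) `^ p^-1.

Lemma osc_cst_ge0 : 0 <= osc_cst.
Proof. by rewrite mulr_ge0 ?powR_ge0// ltW. Qed.

Lemma osc_bound_simpl (S al : R) (i : nat) : 0 <= S -> 0 < al -> al < p ->
  Cp * dradius i * (C * (lam * dradius i) `^ (- Q) *
    (4 `^ p * (S * dradius i `^ (Q - p + al)))) `^ p^-1 <=
  (2 * osc_cst * S `^ p^-1) * (2^-1 `^ (al / p)) ^+ i.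
Proof.
move=> S0 al0 alp; have r0 := dradius_gt0 i.
(* Since [al < p], the factor [2^(al / p)] due to the initial radius is at most 2. *)
have ri : dradius i `^ (al / p) <= 2 * (2^-1 `^ (al / p)) ^+ i.
  rewrite /dradius powRM ?exprn_ge0//.
  have -> : (2^-1 ^+ i) `^ (al / p) = (2^-1 `^ (al / p)) ^+ i :> R.
    by rewrite -(@powR_mulrn _ 2^-1 i)// powRAC powR_mulrn// powR_ge0.
  rewrite ler_wpM2r ?exprn_ge0 ?powR_ge0//.
  by apply: ler1_powR => //; rewrite ?ler1n// ler_pdivrMr// mul1r ltW.
move: (dradius i) r0 ri => r r0 ri.
have rn0 : r != 0 by rewrite gt_eqF.
have -> : C * (lam * r) `^ (- Q) * (4 `^ p * (S * r `^ (Q - p + al))) =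
    (C * lam `^ (- Q) * 4 `^ p) * S * r `^ (al - p).
  rewrite powRM ?(ltW lam0) ?(ltW r0)//.
  have -> : al - p = - Q + (Q - p + al) by ring.
  rewrite (@powRD _ r (- Q)); last by rewrite rn0 implybT.
  ring.
rewrite /osc_cst; set B := C * lam `^ (- Q) * 4 `^ p.
have B0 : 0 <= B by rewrite !mulr_ge0 ?powR_ge0// ltW.
rewrite (powRM _ (mulr_ge0 B0 S0) (powR_ge0 _ _)) (powRM _ B0 S0).
rewrite -(powRrM r) mulrBl divff ?gt_eqF//.
have rE : r * r `^ (al / p - 1) = r `^ (al / p).
  by rewrite mulr_powRB1 ?(ltW r0)// divr_gt0.
rewrite (_ : Cp * r * _ = Cp * B `^ p^-1 * S `^ p^-1 * (r * r `^ (al / p - 1))); last by ring.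
rewrite rE (_ : 2 * _ * _ * _ = Cp * B `^ p^-1 * S `^ p^-1 *
   (2 * (2^-1 `^ (al / p)) ^+ i)); last by ring.
by rewrite ler_wpM2l// !mulr_ge0 ?powR_ge0// ltW.
Qed.

(** Up to a constant, the sum over all scales of the oscillations around a good point. *)
Definition good_bound (S al : R) : R := S `^ p^-1 / (1 - 2^-1 `^ (al / p)).

Lemma good_ratio (al : R) : 0 < al -> 0 < (2^-1 : R) `^ (al / p) < 1.
Proof.
by move=> al0; rewrite powR_gt0//= half_powR_lt1// divr_gt0.
Qed.

Lemma poincare_telescoping : exists2 K : R, 0 < K & forall (w : X -> R) (T : R)
    (G rho : X -> \bar R) (x y : X) (S al S' al' : R),
  continuous w -> (forall z, 0 <= w z <= T) -> upper_gradient w G ->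
  (forall z, (G z <= 4%:E * rho z)%E) -> (forall z, (0 <= rho z)%E) ->
  measurable_fun [set: caratheodory_type mu] rho ->
  mdist x y < 1 -> 0 <= S -> 0 < al -> al < p -> 0 <= S' -> 0 < al' -> al' < p ->
  good rho x S al -> good rho y S' al' ->
  `|w x - w y| <= K * (good_bound S al + good_bound S' al').
Proof.
have [oc oc0 ocP] : exists2 oc : R, 0 <= oc & forall (S al : R) (i : nat),
    0 <= S -> 0 < al -> al < p ->
    Cp * dradius i * (C * (lam * dradius i) `^ (- Q) *
      (4 `^ p * (S * dradius i `^ (Q - p + al)))) `^ p^-1 <=
    (2 * oc * S `^ p^-1) * (2^-1 `^ (al / p)) ^+ i.
  by exists osc_cst; [exact: osc_cst_ge0|exact: osc_bound_simpl].
pose K1 := C ^+ 2 * 2 `^ Q * (2 * oc).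
have K10 : 0 <= K1.
  apply: mulr_ge0; apply: mulr_ge0 => //.
  by apply: exprn_ge0; exact: ltW.
(* Of the four increments used below, two are charged to [x] and two to [y], each at the price [K1];
   the 1 makes the constant positive. *)
exists (2 * K1 + 1); first by rewrite ltr_wpDl// mulr_ge0.
move=> w T G rho x y S al S' al' cw wT ug Grho rho0 mrho xy S0 al0 alp S'0 al'0 al'p gx gy.
have osc z A a : 0 <= A -> 0 < a -> a < p -> good rho z A a -> forall i,
    osc_le mu w z (dradius i) ((2 * oc * A `^ p^-1) * (2^-1 `^ (a / p)) ^+ i).
  move=> A0 a0 ap gz i; rewrite /osc_le.
  have V0 : 0 <= A * dradius i `^ (Q - p + a) by rewrite mulr_ge0 ?powR_ge0.
  apply: le_trans (poincare_osc cw wT ug Grho rho0 mrho (dradius_gt0 i) V0 (gz i)) _.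
  rewrite ler_wpM2l//; last exact: ocP.
  exact/ltW/(ball_measure_gt0 C1 ahl)/dradius_gt0.
have b0 A : 0 <= 2 * oc * A `^ p^-1.
  by rewrite !mulr_ge0 ?powR_ge0.
have tel z A a : 0 <= A -> 0 < a -> a < p -> good rho z A a ->
    `|w z - mean mu (ball z 2) w| <= K1 * good_bound A a.
  move=> A0 a0 ap gz.
  have /andP[q0 q1] := good_ratio a0.
  apply: le_trans (telescoping borel_cara C1 ahl cw wT (b0 A) q0 q1 (osc z A a A0 a0 ap gz)) _.
  by rewrite /K1 /good_bound !mulrA.
have gb0 A a : 0 < a -> 0 <= good_bound A a.
  move=> a0; have /andP[q0 q1] := good_ratio a0.
  by rewrite /good_bound divr_ge0 ?powR_ge0// subr_ge0 ltW.
(* The path of means is [x], [ball x 2], [ball y 1], [ball y 2], [y]; the two middle links are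
   instances of this bound, as [ball y 1] lies in both larger balls. *)
have half z z' A a : mdist z z' < 1 -> 0 <= A -> 0 < a -> a < p -> good rho z A a ->
    `|mean mu (ball z' (2 / 2)) w - mean mu (ball z 2) w| <= K1 * good_bound A a.
  move=> zz' A0 a0 ap gz.
  have /andP[q0 q1] := good_ratio a0.
  have := osc z A a A0 a0 ap gz 0%N; rewrite /dradius !expr0 !mulr1 => Hosc.
  have two0 : 0 < 2 :> R by [].
  apply: le_trans (mean_half_ball borel_cara C1 ahl cw wT two0 (b0 A) _ Hosc) _.
    rewrite divff// !ballEmdist => t /= z't.
    apply: le_lt_trans (metric_triangle _ z' _) _.
    by rewrite (_ : 2 = 1 + 1 :> R) ?ltrD// -natrD.
  rewrite /K1 /good_bound !mulrA ler_pdivlMr ?subr_gt0//.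
  rewrite ler_piMr ?gerBl ?(ltW q0)//.
  by rewrite !mulr_ge0 ?powR_ge0// ?exprn_ge0// ltW.
have Hx := tel x S al S0 al0 alp gx.
have Hy := tel y S' al' S'0 al'0 al'p gy.
have yy : mdist y y < 1 by rewrite mdistxx.
have Hxy := half x y S al xy S0 al0 alp gx.
have Hyy := half y y S' al' yy S'0 al'0 al'p gy.
have gx0 := gb0 S al al0; have gy0 := gb0 S' al' al'0.
move: Hx Hy Hxy Hyy.
set ax := mean _ (ball x 2) w; set ay := mean _ (ball y 2) w.
set am := mean _ _ w.
set g1 := good_bound S al in gx0 *; set g2 := good_bound S' al' in gy0 *.
rewrite mulrDl mul1r => Hx Hy Hxy Hyy.
apply: le_trans (ler_distD ax _ _) _.
have := ler_distD am ax (w y); have := ler_distD ay am (w y).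
rewrite (distrC ay (w y)) (distrC ax am).
rewrite -mulrA mulrDr; move: (K1 * g1) (K1 * g2) Hx Hy Hxy Hyy => c1 c2.
lra.
Qed.

End PoincarePointwise.

Section PointwiseEstimate.
Context {R : realType} {X : pmetricType R}.
Variable mu : {outer_measure set X -> \bar R}.
Hypothesis borel_cara : @borel R X `<=` mu.-caratheodory.
Variables (Q C : R).
Hypotheses (C1 : 1 <= C) (ahl : forall (x : X) (r : R), 0 < r ->
  ((r `^ Q / C)%:E <= mu (ball x r) <= (C * r `^ Q)%:E)%E).
Variables (p Cp lam : R).
Hypotheses (p1 : 1 <= p) (Cp0 : 0 < Cp) (lam1 : 1 <= lam)
  (poinc : forall (u : X -> R) (rho : X -> \bar R),
      integrable_on_balls mu u -> upper_gradient u rho ->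
      forall (x : X) (r : R), 0 < r ->
        (((fine (mu (ball x r)))^-1)%:E *
           \int[cara mu]_(y in ball x r) `|u y - mean mu (ball x r) u|%:E
         <= (Cp * r)%:E *
            (((fine (mu (ball x (lam * r))))^-1)%:E *
               \int[cara mu]_(y in ball x (lam * r)%R) (rho y `^ p))
            `^ p^-1)%E).
Hypothesis properX : forall (F : set_system X) (x0 : X) (K : R),
  ProperFilter F -> (forall A, F A \/ F (~` A)) -> 0 < K -> F (ball x0 K) ->
  exists l : X, F --> l.

Let p0 : 0 < p. Proof. exact: lt_le_trans p1. Qed.
Let C0 : 0 < C. Proof. exact: lt_le_trans C1. Qed.
Let lam0 : 0 < lam. Proof. exact: lt_le_trans lam1. Qed.

Local Notation good := (good mu Q p lam).

Lemma lsc_cst (c : R) : lower_semicontinuous (fun _ : X => c%:E).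
Proof. by move=> x a ac; exists setT => //; exact: filterT. Qed.

(** The floor adds at most [eta^p] times the measure of the ball, of order [r^Q]; as [r <= 2], this
    is at most [2^p * r^(Q - p + al)] up to constants, so a small [eta] adds no more than another
    [S]. *)
Lemma good_max (rho : X -> \bar R) (eta S al : R) (x : X) :
  measurable_fun [set: caratheodory_type mu] rho -> (forall z, (0 <= rho z)%E) ->
  0 < eta -> 0 < al -> al < p ->
  eta `^ p * (C * lam `^ Q * 2 `^ p) <= S ->
  good rho x S al -> good (fun z => maxe (rho z) eta%:E) x (2 * S) al.
Proof.
move=> mrho rho0 eta0 al0 alp etaS gx i.
have r0 := @dradius_gt0 R i; set r := dradius i in r0 *.
have lr0 : 0 < lam * r by rewrite mulr_gt0.
have r2 : r <= 2.
  by rewrite /r /dradius ler_piMr// exprn_ile1// invf_le1// ler1n.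
have mrp : measurable_fun [set: caratheodory_type mu] (fun z => rho z `^ p)%E.
  exact: (measurableT_comp (measurable_poweR p) mrho).
apply: (@le_trans _ _ (\int[cara mu]_(z in ball x (lam * r)%R)
    (rho z `^ p + (eta `^ p)%:E))%E).
  apply: ge0_le_integral_nomeas => z _; first exact: poweR_ge0.
  have [ez|ze] := leP (rho z) eta%:E.
    by rewrite poweR_EFin leeDr// poweR_ge0.
  by rewrite leeDl// lee_fin powR_ge0.
have mb : measurable (ball x (lam * r) : set (caratheodory_type mu)).
  exact: (ball_cara borel_cara).
rewrite ge0_integralD//; last 3 first.
- by move=> z _; exact: poweR_ge0.
- exact: measurable_funTS.
- by move=> z _; rewrite lee_fin powR_ge0.
rewrite integral_cst//.
rewrite (_ : (2 * S * r `^ (Q - p + al))%:E =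
   (S * r `^ (Q - p + al))%:E + (S * r `^ (Q - p + al))%:E)%E; last first.
  by rewrite -EFinD; congr EFin; lra.
apply: leeD; first exact: gx.
have /andP[_ H] := ahl x lr0.
apply: (@le_trans _ _ ((eta `^ p)%:E * (C * (lam * r) `^ Q)%:E)%E).
  by rewrite lee_wpmul2l// lee_fin powR_ge0.
rewrite -EFinM lee_fin.
apply: (@le_trans _ _ (eta `^ p * (C * lam `^ Q * 2 `^ p) * r `^ (Q - p + al))); last first.
  by rewrite ler_wpM2r ?powR_ge0.
rewrite -!mulrA ler_wpM2l ?powR_ge0// powRM ?(ltW lam0) ?(ltW r0)//.
rewrite ler_wpM2l ?(ltW C0)// ler_wpM2l ?powR_ge0//.
have -> : r `^ Q = r `^ (p - al) * r `^ (Q - p + al).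
  rewrite -powRD; last by rewrite (gt_eqF r0) implybT.
  by congr (_ `^ _); ring.
rewrite ler_wpM2r ?powR_ge0//.
apply: (@le_trans _ _ (2 `^ (p - al))).
  apply: (@ge0_ler_powR _ (p - al)); rewrite ?nnegrE ?subr_ge0 ?(ltW alp) ?(ltW r0)//.
by apply: ler_powR; rewrite ?ler1n// gerBl ltW.
Qed.

Lemma good_bound_double (S al : R) : 0 <= S -> 0 < al ->
  good_bound p (2 * S) al <= 2 * good_bound p S al.
Proof.
move=> S0 al0; have /andP[q0 q1] := good_ratio p1 al0.
rewrite /good_bound mulrA ler_wpM2r ?invr_ge0 ?subr_ge0 ?(ltW q1)//.
rewrite powRM// ler_wpM2r ?powR_ge0//.
by apply: ler1_powR; rewrite ?ler1n// invf_le1.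
Qed.

Lemma pointwise_estimate : exists2 K : R, 0 < K & forall (u : X -> R)
    (g rho : X -> \bar R) (x y : X) (S al S' al' : R),
  upper_gradient u g -> lower_semicontinuous rho -> (forall z, (0 <= rho z)%E) ->
  (forall z, (g z <= rho z)%E) -> mdist x y < 1 ->
  0 < S -> 0 < al -> al < p -> 0 < S' -> 0 < al' -> al' < p ->
  good rho x S al -> good rho y S' al' ->
  `|u x - u y| <= K * (good_bound p S al + good_bound p S' al').
Proof.
have [K K0 KP] := poincare_telescoping borel_cara C1 ahl p1 Cp0 lam1 poinc.
(* A factor 5 from applying the chain distance with [T = D / 5], where [4 * T < D], and a factor 2
   from doubling the levels in [good_max]. *)
exists (10 * K); first by rewrite mulr_gt0.
move=> u g rho x y S al S' al' ug lrho rho0 grho xy S0 al0 alp S'0 al'0 al'p gx gy.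
have [->|uxy] := eqVneq (u x) (u y).
  rewrite subrr normr0 mulr_ge0 ?mulr_ge0 ?(ltW K0)//.
  have gb0 A a : 0 < a -> 0 <= good_bound p A a.
    move=> a0; have /andP[q0 q1] := good_ratio p1 a0.
    by rewrite /good_bound divr_ge0 ?powR_ge0// subr_ge0 ltW.
  by rewrite addr_ge0// gb0.
have D0 : 0 < `|u x - u y| by rewrite normr_gt0 subr_eq0.
set D := `|u x - u y| in D0 *.
pose CC := C * lam `^ Q * 2 `^ p.
have CC0 : 0 < CC by rewrite !mulr_gt0// powR_gt0.
(* The largest floor that [good_max] admits at both points. It varies with the levels, which is
   harmless because [K] does not depend on it. *)
pose eta := (Num.min S S' / CC) `^ p^-1.
have m0 : 0 < Num.min S S' / CC by rewrite divr_gt0// lt_min S0.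
have eta0 : 0 < eta by exact: powR_gt0.
have etaE : eta `^ p * CC = Num.min S S'.
  by rewrite /eta -powRrM mulVf ?gt_eqF// powRr1 ?(ltW m0)// divfK// gt_eqF.
pose rho' z := maxe (rho z) eta%:E.
have lrho' : lower_semicontinuous rho' by apply: lsc_max => //; exact: lsc_cst.
have rho'_eta z : (eta%:E <= rho' z)%E by rewrite le_max lexx orbT.
have mc (h : X -> \bar R) : lower_semicontinuous h ->
    measurable_fun [set: caratheodory_type mu] h.
  by move=> lh; exact: (borel_fun_cara borel_cara (lsc_borel_measurable lh)).
have gx' : good rho' x (2 * S) al.
  by apply: good_max => //; [exact: mc|rewrite etaE ge_min lexx].
have gy' : good rho' y (2 * S') al'.
  by apply: good_max => //; [exact: mc|rewrite etaE ge_min lexx orbT].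
have grho' z : (g z <= rho' z)%E by apply: le_trans (grho z) _; rewrite le_max lexx.
have D50 : 0 <= D / 5 by rewrite divr_ge0// ltW.
have D5 : 4 * (D / 5) < D by lra.
have [w [G [cw wT ugw Gr [wx wy]]]] :=
  upper_gradient_chain_dist properX lrho' eta0 rho'_eta ug grho' D50 D5.
have rho'0 z : (0 <= rho' z)%E by rewrite le_max rho0.
have S20 : 0 <= 2 * S by rewrite mulr_ge0// ltW.
have S'20 : 0 <= 2 * S' by rewrite mulr_ge0// ltW.
have := KP w (D / 5) G rho' x y (2 * S) al (2 * S') al' cw wT ugw Gr rho'0 (mc _ lrho')
  xy S20 al0 alp S'20 al'0 al'p gx' gy'.
rewrite wx wy sub0r normrN ger0_norm// => H.
have HS := good_bound_double (ltW S0) al0.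
have HS' := good_bound_double (ltW S'0) al'0.
have : D / 5 <= K * (2 * good_bound p S al + 2 * good_bound p S' al').
  by apply: le_trans H _; rewrite ler_wpM2l ?(ltW K0)// lerD.
rewrite -mulrDr mulrCA; move: (good_bound p S al + _) => s.
rewrite -mulrA; move: (K * s) => t; lra.
Qed.

End PointwiseEstimate.

(** * Exceptional sets *)

Lemma nneseries_geometric_le {R : realType} (f : nat -> R) (a q : R) :
  0 <= a -> 0 <= q -> q < 1 -> (forall i, 0 <= f i <= a * q ^+ i) ->
  (\sum_(i <oo) (f i)%:E <= (a / (1 - q))%:E)%E.
Proof.
move=> a0 q0 q1 fq.
have f0 i : 0 <= f i by have /andP[] := fq i.
have q10 : 0 < 1 - q by rewrite subr_gt0.
apply: lime_le; first by apply: is_cvg_nneseries => i _ _; rewrite lee_fin.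
apply: nearW => n; rewrite sumEFin lee_fin.
apply: (@le_trans _ _ (a * (1 - q ^+ n) / (1 - q))).
  elim: n => [|n ih]; first by rewrite big_nil expr0 subrr mulr0 mul0r.
  rewrite big_nat_recr//=.
  have -> : a * (1 - q ^+ n.+1) / (1 - q) = a * (1 - q ^+ n) / (1 - q) + a * q ^+ n.
    by rewrite exprS; field; rewrite gt_eqF.
  by apply: lerD => //; have /andP[] := fq n.
rewrite ler_wpM2r ?invr_ge0 ?(ltW q10)//.
have qn : 0 <= q ^+ n by rewrite exprn_ge0.
by apply: ler_piMr => //; lra.
Qed.

Section Content.
Context {R : realType} {X : pmetricType R}.

Lemma hausdorff_content_ge0 (beta : R) (E : set X) :
  (0 <= hausdorff_content beta E)%E.
Proof.
apply: le_ereal_inf_tmp => _ [D [c [r [r0 _ ->]]]].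
by apply: esum_ge0 => k _; rewrite lee_fin powR_ge0.
Qed.

Lemma content_le (beta : R) (E : set X) (s : nat -> seq X) (r : nat -> R) :
  (forall i, 0 < r i) ->
  (forall x, E x -> exists i, exists2 c, c \in s i & mdist c x < r i) ->
  (hausdorff_content beta E <= \sum_(i <oo) ((size (s i))%:R * r i `^ beta)%:E)%E.
Proof.
move=> r0 Es; rewrite /hausdorff_content.
pose J i := [set j : nat | (j < size (s i))%N].
(* The finite lists are merged into one countable cover by coding the pair of a scale and a position
   in its list. *)
pose D := pickle @` ([set: nat] `*`` J).
pose c (k : nat) : X := if @unpickle (nat * nat)%type k is Some ij
  then nth point (s ij.1) ij.2 else point.
pose rr (k : nat) : R := if @unpickle (nat * nat)%type k is Some ij then r ij.1 else 1.
apply: (@le_trans _ _ (\esum_(k in D) (rr k `^ beta)%:E)%E).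
  apply: ereal_inf_lbound; exists D, c, rr; split => //.
    by move=> k _; rewrite /rr; case: unpickle.
  move=> x /Es[i [y ys yx]].
  exists (pickle (i, index y (s i))).
    by exists (i, index y (s i)) => //; split => //; rewrite /J/= index_mem.
  by rewrite /c /rr pickleK/= nth_index// ballEmdist.
rewrite esum_image; last first.
  by move=> x y _ _ /(congr1 (@unpickle (nat * nat)%type)); rewrite !pickleK => -[].
under eq_esum do rewrite /rr pickleK.
rewrite -(@esum_esum _ _ _ _ _ (fun i _ => (r i `^ beta)%:E)); last first.
  by move=> i j _ _; rewrite lee_fin powR_ge0.
rewrite nneseries_esumT; last by move=> i; rewrite lee_fin mulr_ge0 ?powR_ge0.
apply: le_esum => i _.
have -> : J i = `I_(size (s i)) by [].
rewrite esum_fset//; last by move=> j _; rewrite lee_fin powR_ge0.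
rewrite -fsbig_ord sumEFin sumr_const card_ord lee_fin.
by rewrite (mulr_natl (r i `^ beta)) lexx.
Qed.

End Content.

Section BadSets.
Context {R : realType} {X : pmetricType R}.
Variable mu : {outer_measure set X -> \bar R}.
Hypothesis borel_cara : @borel R X `<=` mu.-caratheodory.
Variables (Q C : R).
Hypotheses (C1 : 1 <= C) (ahl : forall (x : X) (r : R), 0 < r ->
  ((r `^ Q / C)%:E <= mu (ball x r) <= (C * r `^ Q)%:E)%E).
Variables (p lam : R).
Hypothesis lam1 : 1 <= lam.
Variables (rho : X -> \bar R) (A V : set X) (x0 : X) (K J S e d : R).
Hypotheses (mrho : measurable_fun [set: caratheodory_type mu] rho)
  (K0 : 0 < K) (AK : A `<=` ball x0 K)
  (mV : measurable (V : set (caratheodory_type mu)))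
  (AV : forall x i, A x -> ball x (lam * dradius i) `<=` V)
  (VJ : (\int[cara mu]_(x in V) (rho x `^ p) <= J%:E)%E)
  (S0 : 0 < S) (d0 : 0 < d)
  (Abad : forall x, A x -> exists i,
     ~ (\int[cara mu]_(y in ball x (lam * dradius i)%R) (rho y `^ p) <=
        (S * dradius i `^ e)%:E)%E).

Let C0 : 0 < C. Proof. exact: lt_le_trans C1. Qed.
Let lam0 : 0 < lam. Proof. exact: lt_le_trans lam1. Qed.

(** For points bad at scale [i], a net of separation [2 * lam * dradius i] has disjoint balls of
    radius [lam * dradius i], each carrying energy above [S * dradius i ^ e]; the total [J] limits
    their number. *)
Lemma bad_nets : exists s : nat -> seq X,
  (forall i, (size (s i))%:R * (S * dradius i `^ e) <= J) /\
  forall x, A x -> exists i, exists2 c, c \in s i & mdist c x < 2 * lam * dradius i.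
Proof.
pose bad i := A `&` [set x |
  ~ (\int[cara mu]_(y in ball x (lam * dradius i)%R) (rho y `^ p) <=
        (S * dradius i `^ e)%:E)%E].
have /choice[s sP] : forall i, exists s : seq X,
    (size s)%:R * (S * dradius i `^ e) <= J /\
    forall x, bad i x -> exists2 c, c \in s & mdist c x < 2 * lam * dradius i.
  move=> i; have ri0 := @dradius_gt0 R i.
  have r0 : 0 < 2 * lam * dradius i by rewrite !mulr_gt0.
  have badK : bad i `<=` ball x0 K by move=> x [/AK].
  have [s [seps sb scov]] := finite_net borel_cara C1 ahl K0 r0 badK.
  exists s; split => //.
  have half : 2 * lam * dradius i / 2 = lam * dradius i by field.
  have := @packing_le_integral _ _ mu borel_cara (2 * lam * dradius i)
    (S * dradius i `^ e) s V (fun x => rho x `^ p)%E seps mV.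
  rewrite half => H; rewrite -lee_fin; apply: le_trans VJ; apply: H.
  - exact: (measurableT_comp (measurable_poweR p) mrho).
  - by move=> x; exact: poweR_ge0.
  - by move=> c /sb[Ac _]; exact: AV.
  - by move=> c /sb[_ /negP]; rewrite -ltNge => /ltW.
exists s; split => [i|x Ax]; first by have [] := sP i.
have [i xi] := Abad Ax; exists i; have [_] := sP i; apply; split => //.
Qed.

Let q := 2^-1 `^ d : R.
Let q0 : 0 <= q. Proof. exact: powR_ge0. Qed.
Let q1 : q < 1. Proof. exact: half_powR_lt1. Qed.

(** [J / S] times the sum over all scales of [dradius i ^ d]. *)
Definition bad_cst := J / S * 2 `^ d / (1 - q).

(** The net has at most [J / (S * r^e)] points, so the weight [r^(e + d)] leaves [r^d]: the surplus
    exponent [d > 0] makes the scales summable. *)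
Lemma net_term_le (s : nat -> seq X) i :
  (forall i, (size (s i))%:R * (S * dradius i `^ e) <= J) ->
  (size (s i))%:R * dradius i `^ (e + d) <= J / S * 2 `^ d * q ^+ i.
Proof.
move=> sJ; have r0 := @dradius_gt0 R i.
rewrite powRD; last by rewrite (gt_eqF r0) implybT.
have -> : (dradius i : R) `^ d = 2 `^ d * q ^+ i.
  rewrite /dradius powRM ?exprn_ge0//; congr (_ * _).
  by rewrite -(@powR_mulrn _ 2^-1 i)// powRAC powR_mulrn// powR_ge0.
rewrite mulrA -[leRHS]mulrA ler_wpM2r ?mulr_ge0 ?powR_ge0 ?exprn_ge0//.
by rewrite ler_pdivlMr// -mulrA (mulrC _ S).
Qed.

Lemma J_ge0 : 0 <= J.
Proof.
by rewrite -lee_fin; apply: le_trans VJ; apply: integral_ge0 => x _; exact: poweR_ge0.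
Qed.

Lemma net_series_le (s : nat -> seq X) (b : R) : 0 <= b ->
  (forall i, (size (s i))%:R * (S * dradius i `^ e) <= J) ->
  (\sum_(i <oo) ((size (s i))%:R * (b * dradius i `^ (e + d)))%:E <=
    (b * bad_cst)%:E)%E.
Proof.
move=> b0 sJ.
have a0 : 0 <= b * (J / S * 2 `^ d).
  by rewrite !mulr_ge0 ?powR_ge0 ?J_ge0 ?invr_ge0 ?(ltW S0).
rewrite /bad_cst mulrA; apply: nneseries_geometric_le => // i.
rewrite mulr_ge0 ?mulr_ge0 ?powR_ge0//= mulrCA -mulrA ler_wpM2l//.
exact: net_term_le.
Qed.

Lemma bad_content :
  (hausdorff_content (e + d) A <= ((2 * lam) `^ (e + d) * bad_cst)%:E)%E.
Proof.
have [s [sJ sA]] := bad_nets.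
apply: le_trans (net_series_le (powR_ge0 _ _) sJ).
have r0 i : 0 < 2 * lam * dradius i by rewrite !mulr_gt0// dradius_gt0.
apply: le_trans (content_le (e + d) r0 sA) _.
apply: lee_nneseries => [i _ _|i _]; rewrite lee_fin ?mulr_ge0 ?powR_ge0//.
by rewrite powRM ?mulr_ge0 ?(ltW lam0) ?(ltW (@dradius_gt0 R i)).
Qed.

(** At total exponent [Q] the weights of the nets bound the measures of the balls, and subadditivity
    of the outer measure handles a set not known to be measurable. *)
Lemma bad_measure : e + d = Q ->
  (mu A <= (C * (2 * lam) `^ Q * bad_cst)%:E)%E.
Proof.
move=> edQ; have [s [sJ sA]] := bad_nets.
have b0 : 0 <= C * (2 * lam) `^ Q by rewrite mulr_ge0 ?powR_ge0// ltW.
apply: le_trans (net_series_le b0 sJ); rewrite edQ.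
pose F i := \bigcup_(c in [set` s i]) ball c (2 * lam * dradius i).
apply: (@le_trans _ _ (mu (\bigcup_i F i))).
  apply: le_outer_measure => x /sA[i [c cs cx]].
  by exists i => //; exists c => //; rewrite ballEmdist.
apply: le_trans (outer_measure_sigma_subadditive _ _) _.
apply: lee_nneseries => [i _ _|i _]; first exact: outer_measure_ge0.
have r0 : 0 < 2 * lam * dradius i by rewrite !mulr_gt0// dradius_gt0.
rewrite /F; elim: (s i) => [|c t ih].
  by rewrite bigcup0 ?outer_measure0 ?mul0r// => c /=; rewrite in_nil.
set G := fun c : X => ball c (2 * lam * dradius i).
apply: (@le_trans _ _ (mu (G c `|` \bigcup_(c in [set` t]) G c))).
  apply: le_outer_measure => x [c' /=]; rewrite inE => /predU1P[->|c't] Gx.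
    by left.
  by right; exists c'.
apply: le_trans (outer_measureU2 _ _ _) _.
rewrite /= -natr1 mulrDl mul1r (addrC ((size t)%:R * _)) EFinD; apply: leeD; last exact: ih.
have /andP[_ H] := ahl c r0; apply: le_trans H _.
have lr : 0 <= 2 * lam by rewrite mulr_ge0// ltW.
by rewrite lee_fin (powRM _ lr (ltW (@dradius_gt0 R i))) mulrA lexx.
Qed.

End BadSets.

(** * Decay at good points *)

Section Decay.
Context {R : realType} {X : pmetricType R}.
Variable mu : {outer_measure set X -> \bar R}.
Hypothesis borel_cara : @borel R X `<=` mu.-caratheodory.

Lemma integral_tail (O : X) (f : X -> \bar R) (e : R) :
  measurable_fun [set: caratheodory_type mu] f -> (forall x, (0 <= f x)%E) ->
  (\int[cara mu]_x f x < +oo)%E -> 0 < e ->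
  exists2 M, 0 < M & forall D : set X, measurable (D : set (caratheodory_type mu)) ->
    (forall x, D x -> M <= mdist O x) -> (\int[cara mu]_(x in D) f x <= e%:E)%E.
Proof.
move=> mf f0 ifin e0.
pose F (n : nat) : set (caratheodory_type mu) := ball (O : X) n.+1%:R.
have mF n : measurable (F n) by exact: (ball_cara borel_cara).
have ndF : nondecreasing_seq F.
  by move=> m n mn; apply/subsetPset; apply: le_ball; rewrite ler_nat.
have FT : \bigcup_n F n = setT.
  apply/seteqP; split => // x _; exists (Num.truncn (mdist O x)) => //.
  by rewrite /F ballEmdist/=; exact: truncnS_gt.
have := @ge0_nondecreasing_set_cvg_integral _ _ _ F f (cara mu) ndF mF
  (fun n => measurable_funTS (mf)) (fun n x _ => f0 x).
rewrite FT; set I := (\int[_]_(_ in setT) _)%E.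
have Ifin : I \is a fin_num by rewrite ge0_fin_numE//; apply: integral_ge0.
rewrite -(fineK Ifin) => /fine_cvgP[_ /cvgrPdist_lt/(_ _ e0)[n _ /(_ n (leqnn n))]] /= H.
exists n.+1%:R => // D mD DM.
have FD : [disjoint F n & D].
  apply/disj_set2P; apply/seteqP; split => // x [Fx Dx].
  by move: Fx; rewrite /F ballEmdist/= ltNge DM.
have inF : (\int[cara mu]_(x in F n) f x)%E \is a fin_num.
  rewrite ge0_fin_numE; last exact: integral_ge0.
  apply: le_lt_trans ifin; exact: ge0_subset_integral.
have le1 : (\int[cara mu]_(x in F n) f x + \int[cara mu]_(x in D) f x <= I)%E.
  rewrite -ge0_integral_setU//; last exact: measurable_funTS.
  by apply: ge0_subset_integral => //; exact: measurableU.
move: le1; rewrite addeC -leeBrDr// => /le_trans; apply.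
rewrite -(fineK Ifin) -(fineK inF) -EFinB lee_fin.
by apply: ltW; apply: le_lt_trans H; exact: ler_norm.
Qed.

End Decay.

Section GoodPoints.
Context {R : realType} {X : pmetricType R}.
Variable mu : {outer_measure set X -> \bar R}.
Hypothesis borel_cara : @borel R X `<=` mu.-caratheodory.
Variables (Q C : R).
Hypotheses (C1 : 1 <= C) (ahl : forall (x : X) (r : R), 0 < r ->
  ((r `^ Q / C)%:E <= mu (ball x r) <= (C * r `^ Q)%:E)%E).
Variables (p lam : R) (O : X).
Hypotheses (p1 : 1 <= p) (lam1 : 1 <= lam).
Variables (rho : X -> \bar R).
Hypotheses (mrho : measurable_fun [set: caratheodory_type mu] rho)
  (irho : (\int[cara mu]_x (rho x `^ p) < +oo)%E).

Local Notation good := (good mu Q p lam rho).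

Let p0 : 0 < p. Proof. exact: lt_le_trans p1. Qed.
Let C0 : 0 < C. Proof. exact: lt_le_trans C1. Qed.
Let lam0 : 0 < lam. Proof. exact: lt_le_trans lam1. Qed.

Let mrp : measurable_fun [set: caratheodory_type mu] (fun x => rho x `^ p)%E.
Proof. exact: (measurableT_comp (measurable_poweR p) mrho). Qed.

Lemma dradius_le2 i : dradius i <= 2 :> R.
Proof. by rewrite /dradius ler_piMr// exprn_ile1// invf_le1// ler1n. Qed.

Lemma ball_dradius_sub (x y : X) i : mdist x y < 1 ->
  ball y (lam * dradius i) `<=` ball x (1 + 2 * lam).
Proof.
move=> xy; rewrite !ballEmdist => z /= yz.
apply: le_lt_trans (metric_triangle _ y _) _; apply: ltrD => //.
by apply: lt_le_trans yz _; rewrite mulrC ler_wpM2r ?dradius_le2// ltW.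
Qed.

(** With [al = p - Q] the power of the radius is 1, so goodness only asks that the energy near [x]
    be at most [S], true in the tail. *)
Lemma eventually_good (S : R) : 0 < S -> exists2 M, 0 < M &
  forall x, M < mdist O x -> good x S (p - Q).
Proof.
move=> S0; have [M M0 MP] := integral_tail borel_cara O mrp
  (fun x => poweR_ge0 _ _) irho S0.
exists (M + (1 + 2 * lam)); first by rewrite addr_gt0// addr_gt0// mulr_gt0.
move=> x Mx i; rewrite (_ : Q - p + (p - Q) = 0) ?powRr0 ?mulr1; last by ring.
apply: MP; first exact: (ball_cara borel_cara).
move=> y yx; have xx : mdist x x < 1 by rewrite mdistxx.
have := @ball_dradius_sub x x i xx y yx; rewrite ballEmdist/= => xy.
have := metric_triangle O y x; rewrite (metric_sym y x); lra.
Qed.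

(** Without such a [y], [ball x 1] would be covered by [Bad] and [Big]. Far away each has measure at
    most [1 / (3 * C)], too little for a unit ball, whose measure is at least [1 / C]. *)
Lemma good_small_point (u : X -> R) (tau e : R) : u \in Lfun (cara mu) p%:E ->
  0 < tau -> 0 < e -> exists2 M, 0 < M & forall x, M < mdist O x ->
    exists y, [/\ mdist x y < 1, good y tau (p / 2) & `|u y| <= e].
Proof.
move=> uL tau0 e0.
have iu := Lfun_integrable p1 uL.
have mu_ : measurable_fun [set: caratheodory_type mu] (fun x => (`|u x| `^ p)%:E).
  exact: (measurable_int (cara mu)).
have iufin : (\int[cara mu]_x (`|u x| `^ p)%:E < +oo)%E.
  case/integrableP : iu => _; apply: le_lt_trans.
  by apply: ge0_le_integral_nomeas => // x _; rewrite ?lee_fin ?powR_ge0// ler_norm.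
have ep0 : 0 < e `^ p by exact: powR_gt0.
(* By Chebyshev, this tail of [|u|^p] gives [Big] measure at most [1 / (3 * C)]. *)
pose d1 := e `^ p / (3 * C).
have d10 : 0 < d1 by rewrite divr_gt0// mulr_gt0.
have up0 x : (0 <= (`|u x| `^ p)%:E)%E by rewrite lee_fin powR_ge0.
have [M1 M10 M1P] := integral_tail borel_cara O mu_ up0 iufin d10.
pose k := C * (2 * lam) `^ Q * (2 `^ (p / 2) / tau / (1 - 2^-1 `^ (p / 2))).
have p20 : 0 < p / 2 by rewrite divr_gt0.
have q1 : 2^-1 `^ (p / 2) < 1 :> R by exact: half_powR_lt1.
have k0 : 0 < k.
  rewrite /k; apply: mulr_gt0.
    by rewrite mulr_gt0// powR_gt0// mulr_gt0.
  by rewrite !divr_gt0 ?powR_gt0// subr_gt0.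
(* Here [k] is the factor of the energy in [bad_measure], so that [k * d2 = 1 / (3 * C)]. *)
pose d2 := (3 * C * k)^-1.
have d20 : 0 < d2 by rewrite invr_gt0; apply: mulr_gt0 => //; exact: mulr_gt0.
have [M2 M20 M2P] := integral_tail borel_cara O mrp
  (fun x => poweR_ge0 _ _) irho d20.
exists (M1 + M2 + (1 + 2 * lam)); first by have := lam0; lra.
move=> x Mx; apply: contrapT => nex.
pose Bad := [set y | mdist x y < 1 /\ ~ good y tau (p / 2)].
pose Big : set (caratheodory_type mu) := ball x 1 `&` [set y | e < `|u y|].
have cover : ball x 1 `<=` Bad `|` Big.
  move=> y; rewrite ballEmdist/= => xy.
  have [gy|ngy] := pselect (good y tau (p / 2)); last by left.
  right; split; first by rewrite ballEmdist.
  by rewrite /= ltNge; apply/negP => uy; apply: nex; exists y.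
have V0 : 0 < 1 + 2 * lam by rewrite addr_gt0// mulr_gt0.
have badK : Bad `<=` ball x (1 + 2 * lam).
  move=> y [xy _]; rewrite ballEmdist/=; apply: lt_le_trans xy _.
  by rewrite lerDl mulr_ge0// ltW.
have badV y i : Bad y -> ball y (lam * dradius i) `<=` ball x (1 + 2 * lam).
  by move=> [xy _]; exact: ball_dradius_sub.
have mV : measurable (ball x (1 + 2 * lam) : set (caratheodory_type mu)).
  exact: (ball_cara borel_cara).
have VJ : (\int[cara mu]_(x in ball x (1 + 2 * lam)%R) (rho x `^ p) <= d2%:E)%E.
  apply: M2P => // y; rewrite ballEmdist/= => xy.
  have := metric_triangle O y x; rewrite (metric_sym y x); lra.
have nbad y : Bad y -> exists i,
     ~ (\int[cara mu]_(z in ball y (lam * dradius i)%R) (rho z `^ p) <=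
        (tau * dradius i `^ (Q - p / 2))%:E)%E.
  move=> [_ ngy]; apply: contrapT => H; apply: ngy => i.
  have -> : Q - p + p / 2 = Q - p / 2 by field.
  by apply: contrapT => Hi; apply: H; exists i.
have muBad := bad_measure borel_cara C1 ahl lam1 mrho V0 badK mV badV VJ tau0 p20 nbad
  (subrK _ _).
have {}muBad : (mu Bad <= ((3 * C)^-1)%:E)%E.
  apply: le_trans muBad _; rewrite lee_fin /bad_cst.
  rewrite le_eqVlt; apply/orP; left; apply/eqP.
  rewrite (_ : C * _ * _ = k * d2); last by rewrite /k; ring.
  rewrite /d2 invfM mulrCA divff ?mulr1// gt_eqF//.
have muBig : (mu Big <= ((3 * C)^-1)%:E)%E.
  have mBig : measurable Big.
    rewrite /Big; apply: measurableI; first exact: (ball_cara borel_cara).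
    have mu1 : measurable_fun [set: caratheodory_type mu] u.
      by move: uL; rewrite inE => /andP[/[!inE]].
    have mau : measurable_fun [set: caratheodory_type mu] (fun y => `|u y|).
      exact: (measurableT_comp _ mu1).
    by have := mau measurableT _ (measurable_itv `]e, +oo[); rewrite setTI preimage_itvoy.
  have H : ((e `^ p)%:E * mu Big <= d1%:E)%E.
    rewrite -[mu Big]/(cara mu Big) -integral_cst//.
    apply: (@le_trans _ _ (\int[cara mu]_(x in Big) (`|u x| `^ p)%:E)%E).
      apply: ge0_le_integral_nomeas => y; rewrite ?lee_fin ?powR_ge0//.
      move=> [_ /= /ltW ey].
      by apply: (ge0_ler_powR (ltW p0)); rewrite ?nnegrE ?(ltW e0).
    apply: M1P => // y [+ _]; rewrite ballEmdist/= => xy.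
    have := metric_triangle O y x; rewrite (metric_sym y x).
    have : 0 < lam by []. lra.
  rewrite -(@lee_pmul2l _ (e `^ p)%:E)// ?lte_fin//.
have C30 : 0 < (3 * C)^-1 by rewrite invr_gt0 mulr_gt0.
have /andP[lo _] := ahl x (@ltr01 R).
have : (C^-1%:E <= ((3 * C)^-1 + (3 * C)^-1)%:E)%E.
  rewrite powR1 mul1r in lo; apply: le_trans lo _.
  apply: le_trans (le_outer_measure mu _ _ cover) _.
  apply: le_trans (outer_measureU2 _ _ _) _.
  by rewrite EFinD; exact: leeD.
rewrite lee_fin invfM; have : 0 < C^-1 by rewrite invr_gt0. lra.
Qed.

End GoodPoints.

Section ThinExceptionalSet.
Context {R : realType} {X : pmetricType R}.
Variable mu : {outer_measure set X -> \bar R}.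
Hypothesis borel_cara : @borel R X `<=` mu.-caratheodory.
Variables (Q C : R).
Hypotheses (C1 : 1 <= C) (ahl : forall (x : X) (r : R), 0 < r ->
  ((r `^ Q / C)%:E <= mu (ball x r) <= (C * r `^ Q)%:E)%E).
Variables (p lam : R) (O : X).
Hypotheses (p1 : 1 <= p) (lam1 : 1 <= lam).
Variables (rho : X -> \bar R).
Hypotheses (mrho : measurable_fun [set: caratheodory_type mu] rho)
  (irho : (\int[cara mu]_x (rho x `^ p) < +oo)%E).

Local Notation good := (good mu Q p lam rho).
Local Notation good_bound := (good_bound p).

Let p0 : 0 < p. Proof. exact: lt_le_trans p1. Qed.

(** Common to both ranges of [p], which differ only in the set [D] of points known to be good. Of
    the three thirds of [e], two come from the bounds at [x] and [y], one from [|u y|]. *)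
Lemma decay (u : X -> R) (K : R) (D : set X) : u \in Lfun (cara mu) p%:E -> 0 < K ->
  (forall (x y : X) (S al S' al' : R), mdist x y < 1 ->
    0 < S -> 0 < al -> al < p -> 0 < S' -> 0 < al' -> al' < p ->
    good x S al -> good y S' al' ->
    `|u x - u y| <= K * (good_bound S al + good_bound S' al')) ->
  (forall e : R, 0 < e -> exists M, forall x, D x -> M < mdist O x ->
    exists S al, [/\ 0 < S, 0 < al, al < p, good x S al & good_bound S al <= e]) ->
  forall e : R, 0 < e -> exists M, forall x, D x -> M < mdist O x -> `|u x| <= e.
Proof.
move=> uL K0 uest Dgood e e0.
have p20 : 0 < p / 2 by rewrite divr_gt0.
have p2p : p / 2 < p by have := p0; lra.
have /andP[q0 q1] := good_ratio p1 p20.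
set c := 1 - 2^-1 `^ (p / 2 / p).
have c0 : 0 < c by rewrite subr_gt0.
pose e3 := e / (3 * K).
have e30 : 0 < e3 by rewrite divr_gt0// mulr_gt0.
(* Solves [good_bound tau (p / 2) = e3]. *)
pose tau := (e3 * c) `^ p.
have tau0 : 0 < tau by rewrite powR_gt0// mulr_gt0.
have tauE : good_bound tau (p / 2) = e3.
  rewrite /good_bound -/c /tau -powRrM divff ?gt_eqF// powRr1.
    by rewrite mulfK// gt_eqF.
  by rewrite ltW// mulr_gt0.
have [M1 M1P] := Dgood e3 e30.
have e30' : 0 < e / 3 by rewrite divr_gt0.
have [M2 M20 M2P] := good_small_point borel_cara C1 ahl O p1 lam1 mrho irho uL tau0 e30'.
exists (Num.max M1 M2) => x Dx; rewrite gt_max => /andP[Mx1 Mx2].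
have [S [al [S0 al0 alp gx gb]]] := M1P x Dx Mx1.
have [y [xy gy uy]] := M2P x Mx2.
have := uest x y S al tau (p / 2) xy S0 al0 alp tau0 p20 p2p gx gy.
rewrite tauE => H.
have {}H : `|u x - u y| <= K * (e3 + e3).
  by apply: le_trans H _; rewrite ler_wpM2l ?(ltW K0)// lerD2r.
have KE : K * (e3 + e3) = 2 * e / 3 by rewrite /e3; field; rewrite gt_eqF.
have := ler_distD (u y) (u x) 0; rewrite !subr0; lra.
Qed.

(* Normalized so that [good_bound (level al / j) al] does not depend on [al]. *)
Definition level (al : R) : R := (1 - 2^-1 `^ (al / p)) `^ p.

Lemma level_gt0 al : 0 < al -> 0 < level al.
Proof.
by move=> al0; have /andP[q0 q1] := good_ratio p1 al0; rewrite powR_gt0// subr_gt0.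
Qed.

Lemma good_bound_level al (j : nat) : 0 < al ->
  good_bound (level al / j.+1%:R) al = j.+1%:R^-1 `^ p^-1.
Proof.
move=> al0; have /andP[q0 q1] := good_ratio p1 al0.
have c0 : 0 < 1 - 2^-1 `^ (al / p) by rewrite subr_gt0.
rewrite /good_bound powRM ?(ltW (level_gt0 al0))// /level -powRrM divff ?gt_eqF//.
by rewrite powRr1 ?(ltW c0)// mulrAC divff ?gt_eqF// mul1r.
Qed.

(* The exponent [al] is quantified inside, so that one set is thin for all the
   exponents [0 < al < p] at once. The factor 1 is the constant of [thin]. *)
Definition exceptional : set X := [set x | forall j : nat,
  annulus O (1 * 2 ^+ j.+1) x -> forall al : R, 0 < al -> al < p ->
  ~ good x (level al / j.+1%:R) al].

Lemma not_exceptional_good (e : R) : 0 < e -> exists M, forall x,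
  (~` exceptional) x -> M < mdist O x ->
  exists S al, [/\ 0 < S, 0 < al, al < p, good x S al & good_bound S al <= e].
Proof.
move=> e0.
(* From the annulus [N] on, the bound [(1 / (j + 1))^(1 / p)] is at most [e]. *)
pose N := Num.truncn (e^-1 `^ p).
exists (2 ^+ N.+1 * 2) => x nE Nx.
have /existsNP[j /not_implyP[jx]] := nE.
move=> /existsNP[al /not_implyP[al0 /not_implyP[alp /contrapT gx]]].
exists (level al / j.+1%:R), al; split => //.
  by rewrite divr_gt0// level_gt0.
rewrite good_bound_level//.
have Nj : (N <= j)%N.
  case: jx => + _; rewrite ballEmdist/= mul1r -exprS -exprSr in Nx * => jx.
  have := lt_trans Nx jx; rewrite ltr_eXn2l ?ltr1n// ltnS => H.
  by rewrite -ltnS; exact: ltnW.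
have eN : e^-1 `^ p <= j.+1%:R.
  by apply: ltW; apply: lt_le_trans (truncnS_gt _) _; rewrite ler_nat ltnS.
rewrite -[leRHS](@powRr1 _ e) ?(ltW e0)// -[X in e `^ X](@divff _ p) ?gt_eqF// powRrM.
have pi0 : 0 <= p^-1 by rewrite invr_ge0 ltW.
apply: (ge0_ler_powR pi0); rewrite ?nnegrE ?invr_ge0 ?powR_ge0//.
rewrite -[leRHS]invrK lef_pV2 ?posrE ?invr_gt0 ?powR_gt0//.
apply: le_trans eN; rewrite le_eqVlt; apply/orP; left; apply/eqP.
have := @powRM _ e e^-1 p; rewrite divff ?gt_eqF// powR1 => /(_ (ltW e0)).
rewrite invr_ge0 (ltW e0) => /(_ isT) H.
by apply: (@mulfI _ (e `^ p)); [rewrite gt_eqF// powR_gt0|rewrite -H divff// gt_eqF// powR_gt0].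
Qed.

Lemma linear_geometric_le (w : R) (j : nat) : 0 < w -> w < 1 ->
  j%:R * w ^+ j <= (1 - w)^-1.
Proof.
move=> w0 w1; have h0 : 0 < 1 - w by rewrite subr_gt0.
(* The extra term [w ^+ j] strengthens the bound so that the induction closes, the last gap being
   [(1 - w)^2 >= 0]. *)
suff H : (1 - w) * (j%:R * w ^+ j) + w ^+ j <= 1.
  rewrite -[leRHS]mul1r ler_pdivlMr// mulrC; apply: le_trans H.
  by rewrite lerDl exprn_ge0// ltW.
elim: j => [|j ih]; first by rewrite expr0 mul0r mulr0 add0r.
have wj : w ^+ j <= 1 by rewrite exprn_ile1 ?ltW.
rewrite -natr1 exprS.
have -> : (1 - w) * ((j%:R + 1) * (w * w ^+ j)) + w * w ^+ j =
    w * ((1 - w) * (j%:R * w ^+ j) + w ^+ j) + w * ((1 - w) * w ^+ j) by ring.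
apply: (@le_trans _ _ (w * 1 + w * ((1 - w) * 1))).
  by rewrite lerD// ler_wpM2l ?(ltW w0)// ler_wpM2l// ltW.
have := sqr_ge0 (1 - w); rewrite expr2; lra.
Qed.

(** In the annulus [j] the level is proportional to [1 / (j + 1)], so the content is at most
    [B * (j + 1)], and the weights of [thin] decay geometrically. Points of [ball O 2] are vacuously
    exceptional, but no annulus meets them. *)
Lemma exceptional_thin : p <= Q -> thin O Q p exceptional.
Proof.
move=> pQ; exists 1 => // al /andP[al0 alp].
pose J := fine (\int[cara mu]_x (rho x `^ p))%E.
have JE : (\int[cara mu]_x (rho x `^ p))%E = J%:E.
  rewrite fineK// ge0_fin_numE//; apply: integral_ge0 => x _; exact: poweR_ge0.
have J0 : 0 <= J.
  by rewrite -lee_fin -JE; apply: integral_ge0 => x _; exact: poweR_ge0.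
have a20 : 0 < al / 2 by rewrite divr_gt0.
have a2p : al / 2 < p by have := p0; lra.
set be := Q - (p - al).
(* One half of [al] is the exponent of goodness, the other is the surplus [d] of [bad_content]. *)
have beE : be = Q - p + al / 2 + al / 2 by rewrite /be; field.
pose F j := hausdorff_content be (exceptional `&` annulus O (1 * 2 ^+ j.+1)).
pose B := (2 * lam) `^ be * (J / level (al / 2) * 2 `^ (al / 2) / (1 - 2^-1 `^ (al / 2))).
have q1 : 2^-1 `^ (al / 2) < 1 :> R by exact: half_powR_lt1.
have B0 : 0 <= B.
  rewrite /B mulr_ge0 ?powR_ge0// divr_ge0 ?subr_ge0 ?(ltW q1)//.
  by rewrite mulr_ge0 ?powR_ge0// divr_ge0// ltW// level_gt0.
have FB j : (F j <= (B * j.+1%:R)%:E)%E.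
  pose A := exceptional `&` annulus O (1 * 2 ^+ j.+1).
  have K0 : 0 < 2 * (1 * 2 ^+ j.+1) :> R by rewrite !mulr_gt0// exprn_gt0.
  have AK : A `<=` ball O (2 * (1 * 2 ^+ j.+1)) by move=> x [_ []].
  have S0 : 0 < level (al / 2) / j.+1%:R by rewrite divr_gt0// level_gt0.
  have VJ : (\int[cara mu]_(x in setT) (rho x `^ p) <= J%:E)%E by rewrite JE.
  have Abad x : A x -> exists i,
     ~ (\int[cara mu]_(z in ball x (lam * dradius i)%R) (rho z `^ p) <=
        (level (al / 2) / j.+1%:R * dradius i `^ (Q - p + al / 2))%:E)%E.
    move=> [Ex jx]; apply: contrapT => H.
    apply: (Ex j jx (al / 2) a20 a2p) => i.
    by apply: contrapT => Hi; apply: H; exists i.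
  have := bad_content borel_cara C1 ahl lam1 mrho K0 AK measurableT
    (fun _ _ _ => @subsetT _ _) VJ S0 a20 Abad.
  rewrite -beE => /le_trans; apply; rewrite lee_fin /bad_cst /B.
  rewrite le_eqVlt; apply/orP; left; apply/eqP.
  have N0 : j.+1%:R != 0 :> R by [].
  have l0 : level (al / 2) != 0 by rewrite gt_eqF// level_gt0.
  have q10 : 1 - 2^-1 `^ (al / 2) != 0 :> R by rewrite gt_eqF// subr_gt0.
  move: (level (al / 2)) (j.+1%:R : R) (2^-1 `^ (al / 2) : R) l0 N0 q10 => l N q l0 N0 q10.
  by field; rewrite l0 N0 q10.
pose w := 2^-1 `^ al : R.
(* The weight is split as [v^(j + 1) * v^(j + 1)]: one factor absorbs [j + 1], the other is
   summed. *)
pose v := 2^-1 `^ (al / 2) : R.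
have v0 : 0 < v by rewrite powR_gt0.
have wv (i : nat) : ((1 * 2 ^+ i.+1) `^ al)^-1 = v ^+ i.+1 * v ^+ i.+1 :> R.
  rewrite mul1r -exprMn.
  have -> : v * v = w by rewrite /v -powRD ?(gt_eqF, implybT)// -splitr.
  rewrite -powR_inv1 ?powR_ge0// powRAC powR_inv1 ?exprn_ge0//.
  by rewrite -exprVn /w -(@powR_mulrn _ 2^-1)// powRAC powR_mulrn// powR_ge0.
have := @nneseries_tail_cvg R (fun j => F j * (((1 * 2 ^+ j.+1) `^ al)^-1)%:E)%E xpredT.
apply; last first.
  by move=> j _; rewrite mule_ge0 ?hausdorff_content_ge0// lee_fin invr_ge0 powR_ge0.
have c0 : 0 <= B * (1 - v)^-1.
  by rewrite mulr_ge0// invr_ge0 subr_ge0 ltW.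
apply: (@le_lt_trans _ _ (\sum_(j <oo) (B * (1 - v)^-1 * v ^+ j.+1)%:E)%E).
  apply: lee_nneseries => [j _ _|j _].
    by rewrite mule_ge0 ?hausdorff_content_ge0// lee_fin invr_ge0 powR_ge0.
  apply: (@le_trans _ _ ((B * j.+1%:R)%:E * (v ^+ j.+1 * v ^+ j.+1)%:E)%E).
    by rewrite wv lee_wpmul2r ?FB// lee_fin mulr_ge0 ?exprn_ge0// ltW.
  rewrite -EFinM lee_fin; set V := v ^+ j.+1.
  have V0 : 0 <= V by rewrite exprn_ge0// ltW.
  rewrite (_ : B * j.+1%:R * (V * V) = B * (j.+1%:R * V) * V); last by rewrite -!mulrA.
  rewrite ler_wpM2r// ler_wpM2l//.
  exact: linear_geometric_le.
have := @nneseries_geometric_le _ (fun j => B * (1 - v)^-1 * v ^+ j.+1)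
  (B * (1 - v)^-1) v c0 (ltW v0) q1.
move=> H; apply: le_lt_trans (H _) (ltry _) => j.
rewrite mulr_ge0 ?exprn_ge0 ?(ltW v0)//= ler_wpM2l//.
by rewrite exprS ler_piMl ?exprn_ge0 ?(ltW v0) ?(ltW q1).
Qed.

End ThinExceptionalSet.

(** * Uniqueness of the limit *)

Section Connectivity.
Context {R : realType} {X : pmetricType R}.
Variable mu : {outer_measure set X -> \bar R}.
Hypothesis borel_cara : @borel R X `<=` mu.-caratheodory.
Variables (p : R) (O : X).
Hypotheses (p0 : 0 < p) (unbX : unbounded_space X) (poinc : poincare mu p).

Lemma mdist_continuous (a b : R) (g : R -> X) :
  {within `[a, b], continuous g} ->
  {within `[a, b], continuous (fun t => mdist O (g t))}.
Proof.
move=> /within_itv_mdistP cg; apply/within_itv_normP => t tab e e0.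
have [d d0 dP] := cg t tab e e0; exists d => // s sab ts.
apply: le_lt_trans (dP s sab ts).
have := metric_triangle O (g t) (g s); have := metric_triangle O (g s) (g t).
rewrite (metric_sym (g s) (g t)) ler_norml; lra.
Qed.

(** A curve entering or leaving the ball would meet the sphere by the intermediate value theorem;
    the sphere being empty, the indicator is constant along every curve. *)
Lemma indic_ball_upper_gradient (a : R) : (forall z, mdist O z <> a) ->
  upper_gradient (\1_(ball O a) : X -> R) (cst 0%E).
Proof.
move=> Oa; split => //.
move=> b c g bc [cg _].
rewrite (_ : line_integral _ _ _ _ = 0%E); last first.
  by rewrite /line_integral integral0.
rewrite lee_fin normr_le0 subr_eq0; apply/eqP.
have cd := mdist_continuous cg.
rewrite !indicE; congr ((_ : bool)%:R).
rewrite !ballEmdist; apply/idP/idP; rewrite !inE/= => H; rewrite ltNge; apply/negP => H'.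
  have [|t _ tE] := @IVT R (fun t => mdist O (g t)) b c a bc cd.
    by rewrite ge_min le_max H' orbT (ltW H).
  exact: (Oa (g t)).
have [|t _ tE] := @IVT R (fun t => mdist O (g t)) b c a bc cd.
  by rewrite ge_min le_max H' (ltW H) orbT.
exact: (Oa (g t)).
Qed.

Lemma unbounded_from (M : R) : exists z, M < mdist O z.
Proof.
have [x [y xy]] := unbX (M + M); apply: contrapT => H.
have Hx : mdist O x <= M by rewrite leNgt; apply/negP => h; apply: H; exists x.
have Hy : mdist O y <= M by rewrite leNgt; apply/negP => h; apply: H; exists y.
have := metric_triangle x O y; rewrite (metric_sym x O); lra.
Qed.

(** If the sphere were empty, the Poincare inequality with gradient 0 would make the indicator of
    [ball O a] constant almost everywhere on a large ball, although it takes both values on sets of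
    positive measure. *)
Lemma sphere_nonempty (a : R) : 0 < a -> exists z, mdist O z = a.
Proof.
move=> a0; apply: contrapT => nex.
have Oa z : mdist O z <> a by move=> za; apply: nex; exists z.
have [bpos [Cp [lam [Cp0 lam1 poinc_]]]] := poinc.
have [y ya] := unbounded_from a.
pose e := mdist O y - a.
have e0 : 0 < e by rewrite subr_gt0.
(* Large enough to contain both [ball O a] and [ball y e], which are disjoint by the choice of
   [e]. *)
pose r := mdist O y + e + a.
have r0 : 0 < r by rewrite /r addr_gt0// addr_gt0// (lt_trans a0).
pose u : X -> R := \1_(ball O a).
have mb x t : measurable (ball (x : X) t : set (caratheodory_type mu)).
  exact: (ball_cara borel_cara).
have mu_ : measurable_fun [set: caratheodory_type mu] u.
  exact: measurable_indic (mb O a).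
have iu : integrable_on_balls mu u.
  move=> x t t0; apply: measurable_bounded_integrable.
  - exact: mb.
  - by have /andP[] := bpos x t t0.
  - exact: measurable_funTS.
  - exists 1; split; first exact: num_real.
    move=> M M1 z _ /=; apply: ltW; apply: le_lt_trans M1.
    by rewrite /u indicE; case: (_ \in _); rewrite ?normr1 ?normr0.
have := poinc_ u (cst 0%E) iu (indic_ball_upper_gradient Oa) O r r0.
rewrite (_ : (\int[cara mu]_(y in ball O (lam * r)%R) _) = 0)%E; last first.
  by rewrite integral0_eq// => z _; rewrite poweR0r// gt_eqF.
rewrite mule0 poweR0r ?mule0; last by rewrite gt_eqF// invr_gt0.
set m := mean _ _ _ => H.
have int0 D c : measurable (D : set (caratheodory_type mu)) -> D `<=` ball O r ->
    (0 < mu D)%E -> (forall z, D z -> u z = c) -> m = c.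
  move=> mD Dr muD uc.
  have : (\int[cara mu]_(z in D) `|u z - m|%:E <= 0)%E.
    apply: (@le_trans _ _ (\int[cara mu]_(z in ball O r) `|u z - m|%:E)%E).
      apply: ge0_subset_integral => //.
      apply/measurable_EFinP; apply: (measurable_funTS).
      by apply: (measurableT_comp (@normr_measurable _ _)); exact: measurable_funB.
    move: H; rewrite muleC pmule_lle0//.
    have /andP[h1 h2] := bpos O r r0.
    by rewrite lte_fin invr_gt0 fine_gt0// h1.
  rewrite (eq_integral (cst `|c - m|%:E)); last first.
    by move=> z; rewrite inE => /uc ->.
  rewrite integral_cst//= => cm; apply/eqP; rewrite eq_sym -subr_eq0 -normr_le0.
  by rewrite -lee_fin -(pmule_lle0 _ muD).
have m1 : m = 1.
  apply: (int0 (ball O a)) => //.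
  - by apply: le_ball; rewrite /r lerDr addr_ge0 ?(ltW e0)// ltW// (lt_trans a0).
  - by have /andP[] := bpos O a a0.
  - by move=> z za; rewrite /u indicE mem_set.
have m0 : m = 0.
  apply: (int0 (ball y e)) => //.
  - rewrite !ballEmdist => z /= za; have := metric_triangle O y z; rewrite /r; lra.
  - by have /andP[] := bpos y e e0.
  - move=> z; rewrite /u indicE ballEmdist/= => za.
    rewrite memNset// ballEmdist/= => zO.
    by have := metric_triangle O z y; rewrite (metric_sym z) /e in za *; lra.
by move: m0; rewrite m1 => /eqP; rewrite oner_eq0.
Qed.

End Connectivity.

(** * Content bounded below by measure *)

Section ContentLowerBound.
Context {R : realType} {X : pmetricType R}.
Variable mu : {outer_measure set X -> \bar R}.
Variables (Q C : R).
Hypotheses (C1 : 1 <= C) (ahl : forall (x : X) (r : R), 0 < r ->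
  ((r `^ Q / C)%:E <= mu (ball x r) <= (C * r `^ Q)%:E)%E).

Let C0 : 0 < C. Proof. exact: lt_le_trans C1. Qed.

Lemma outer_measure_cover (D : set nat) (c : nat -> X) (r : nat -> R) (E : set X) :
  (forall k, D k -> 0 < r k) -> E `<=` \bigcup_(k in D) ball (c k) (r k) ->
  (mu E <= \esum_(k in D) (C * r k `^ Q)%:E)%E.
Proof.
move=> r0 ED.
pose F k := if k \in D then ball (c k) (r k) else set0.
apply: (@le_trans _ _ (mu (\bigcup_k F k))).
  apply: le_outer_measure => x /ED[k Dk xk]; exists k => //.
  by rewrite /F mem_set.
apply: le_trans (outer_measure_sigma_subadditive _ _) _.
rewrite nneseries_esumT; last by move=> k; exact: outer_measure_ge0.
rewrite [leRHS]esum_mkcond; apply: le_esum => k _; rewrite /F.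
case: ifPn => [kD|_]; last by rewrite outer_measure0.
by have /andP[] := ahl (c k) (r0 k (set_mem kD)).
Qed.

(** A cover with a ball of radius above [r] already costs [r^be]. Otherwise each radius satisfies
    [rr^Q <= r^(Q - be) * rr^be], and the measure of [E] bounds the cost from below. *)
Lemma content_lower_bound (E : set X) (be r m : R) : 0 < be -> be <= Q -> 0 < r ->
  0 < m -> m <= C -> ((m * r `^ Q)%:E <= mu E)%E ->
  ((m / C * r `^ be)%:E <= hausdorff_content be E)%E.
Proof.
move=> be0 beQ r0 m0 mC mE.
have mC1 : m / C <= 1 by rewrite ler_pdivrMr// mul1r.
apply: le_ereal_inf_tmp => _ [D [c [rr [rr0 ED ->]]]].
have [[k [Dk rk]]|small] := pselect (exists k, D k /\ r < rr k).
  apply: (@le_trans _ _ (rr k `^ be)%:E).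
    rewrite lee_fin; apply: (@le_trans _ _ (r `^ be)).
      by rewrite ler_piMl// powR_ge0.
    by apply: (ge0_ler_powR (ltW be0)); rewrite ?nnegrE ?(ltW r0) ?(ltW rk)// ltW// rr0.
  apply: esum_ge; exists [set k]; last by rewrite fsbig_set1.
  by split => // _ ->.
have {}small k : D k -> rr k <= r.
  by move=> Dk; rewrite leNgt; apply/negP => h; apply: small; exists k.
have : ((m * r `^ Q)%:E <= \esum_(k in D) (C * rr k `^ Q)%:E)%E.
  exact: le_trans mE (outer_measure_cover rr0 ED).
have rbe : r `^ Q = r `^ (Q - be) * r `^ be.
  rewrite -powRD ?subrK//; by rewrite (gt_eqF r0) implybT.
have a0 : 0 < C * r `^ (Q - be) by rewrite mulr_gt0// powR_gt0.
set s := (\esum_(k in D) _)%E; set t := (\esum_(k in D) _)%E => H.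
have st : (s <= (C * r `^ (Q - be))%:E * t)%E.
  apply: ge_ereal_sup => _ [F [finF FD] <-].
  apply: (@le_trans _ _ ((C * r `^ (Q - be))%:E * \sum_(k \in F) (rr k `^ be)%:E)%E).
    rewrite ge0_mule_fsumr; last by move=> k; rewrite lee_fin powR_ge0.
    apply: lee_fsum => // k Fk; rewrite -EFinM lee_fin -mulrA ler_wpM2l ?(ltW C0)//.
    have rk0 := rr0 k (FD k Fk).
    have -> : rr k `^ Q = rr k `^ (Q - be) * rr k `^ be.
      rewrite -powRD ?subrK//; by rewrite (gt_eqF rk0) implybT.
    rewrite ler_wpM2r ?powR_ge0//.
    have Qb : 0 <= Q - be by rewrite subr_ge0.
    apply: (ge0_ler_powR Qb); rewrite ?nnegrE ?(ltW r0) ?(ltW rk0)//.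
    exact: small (FD k Fk).
  rewrite lee_wpmul2l ?lee_fin ?(ltW a0)//.
  by apply: ereal_sup_ubound; exists F.
have {st}H := le_trans H st.
rewrite -(@lee_pmul2l _ (C * r `^ (Q - be))%:E)// ?lte_fin//.
apply: le_trans H; rewrite -EFinM lee_fin rbe le_eqVlt; apply/orP; left; apply/eqP.
by field; rewrite gt_eqF.
Qed.

End ContentLowerBound.

#[global] Instance at_infinity_filter {R : realType} {X : pmetricType R} (O : X) :
  Filter (at_infinity O).
Proof.
apply: filter_from_filter; first by exists 0.
move=> M N _ _; exists (Num.max M N) => // x /=.
by rewrite gt_max => /andP.
Qed.

Section Uniqueness.
Context {R : realType} {X : pmetricType R}.
Variable mu : {outer_measure set X -> \bar R}.
Variables (Q C : R).
Hypotheses (C1 : 1 <= C) (ahl : forall (x : X) (r : R), 0 < r ->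
  ((r `^ Q / C)%:E <= mu (ball x r) <= (C * r `^ Q)%:E)%E).
Variables (p : R) (O : X).
Hypotheses (Q1 : 1 <= Q) (p1 : 1 <= p) (pQ : p <= Q)
  (sphere : forall a : R, 0 < a -> exists z, mdist O z = a).

Let p0 : 0 < p. Proof. exact: lt_le_trans p1. Qed.
Let C0 : 0 < C. Proof. exact: lt_le_trans C1. Qed.

(** A ball of radius [r / 4] around a point at distance [3 / 2 * r] from [O] fits into the annulus;
    such a point exists because spheres are nonempty. *)
Lemma annulus_measure_ge (r : R) : 0 < r ->
  (((4 `^ Q * C)^-1 * r `^ Q)%:E <= mu (annulus O r))%E.
Proof.
move=> r0; have r32 : 0 < 3 / 2 * r by rewrite mulr_gt0.
have [z zr] := sphere r32.
have r40 : 0 < r / 4 by rewrite divr_gt0.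
have /andP[H _] := ahl z r40.
apply: (@le_trans _ _ (mu (ball z (r / 4)))).
  apply: le_trans H; rewrite lee_fin le_eqVlt; apply/orP; left; apply/eqP.
  have -> : r `^ Q = 4 `^ Q * (r / 4) `^ Q.
    by rewrite -powRM ?(ltW r40)// mulrC divfK.
  by rewrite invfM mulrACA mulVf ?mul1r ?gt_eqF ?powR_gt0// mulrC.
apply: le_outer_measure => y; rewrite /annulus !ballEmdist/= => zy.
split => /=.
  by have := metric_triangle O z y; lra.
by have := metric_triangle O y z; rewrite (metric_sym y z); lra.
Qed.

Lemma limit_off_thin_eq0 (u : X -> R) (c' : R) (E' : set X) :
  u \in Lfun (cara mu) p%:E -> thin O Q p E' ->
  u x @[x --> within (~` E') (at_infinity O)] --> c' -> c' = 0.
Proof.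
move=> uL [C' C'1 thinE] ucv; apply/eqP; apply: contrapT => /negP c'0.
have C'0 : 0 < C' by exact: lt_le_trans C'1.
pose t := `|c'| / 2.
have t0 : 0 < t by rewrite divr_gt0// normr_gt0.
have [M MP] : exists M, forall x, ~ E' x -> M < mdist O x -> t <= `|u x|.
  have /cvgrPdist_lt/(_ _ t0)[M _ MP] := ucv.
  exists M => x nE Mx; have := MP x Mx nE => /= H.
  have := ler_distD (u x) c' 0; rewrite !subr0.
  have : `|c'| = t + t by rewrite /t -splitr.
  lra.
have tp0 : 0 < t `^ p by exact: powR_gt0.
have iu := Lfun_integrable p1 uL.
pose G : set (caratheodory_type mu) := [set y | t <= `|u y|].
have [W W0 muG] : exists2 W : R, 0 <= W & (mu G <= W%:E)%E.
  have mu1 : measurable_fun [set: caratheodory_type mu] u.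
    by move: uL; rewrite inE => /andP[/[!inE]].
  have mau : measurable_fun [set: caratheodory_type mu] (fun y => `|u y|).
    exact: (measurableT_comp _ mu1).
  have mG : measurable G.
    by have := mau measurableT _ (measurable_itv `[t, +oo[); rewrite setTI preimage_itvcy.
  have : ((t `^ p)%:E * mu G < +oo)%E.
    rewrite -[mu G]/(cara mu G) -integral_cst//.
    case/integrableP : iu => _; apply: le_lt_trans.
    apply: (@le_trans _ _ (\int[cara mu]_(x in G) `|(`|u x| `^ p)%:E|)%E).
      apply: ge0_le_integral_nomeas => y; rewrite /= ?lee_fin ?powR_ge0//.
      rewrite /G /= => ty; rewrite ger0_norm ?powR_ge0//.
      by apply: (ge0_ler_powR (ltW p0)); rewrite ?nnegrE ?(ltW t0).
    apply: ge0_subset_integral => //.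
    apply: (measurableT_comp) => //.
    apply/measurable_EFinP.
    exact: (measurableT_comp (measurable_powR p) mau).
  have [Gy|Gfin] := eqVneq (mu G) +oo%E; first by rewrite Gy gt0_muley ?lte_fin.
  move=> _; exists (fine (mu G)); first by rewrite fine_ge0// outer_measure_ge0.
  by rewrite fineK// ge0_fin_numE ?outer_measure_ge0// ltey.
(* Half of the constant of [annulus_measure_ge]: the other half is reserved for the part of the
   annulus in [G]. *)
pose m := ((4 `^ Q * C)^-1) / 2.
have m0 : 0 < m by rewrite divr_gt0// invr_gt0 mulr_gt0// powR_gt0.
have mC : m <= C.
  apply: le_trans C1; apply: (@le_trans _ _ (4 `^ Q * C)^-1).
    by rewrite /m ler_piMr ?invf_le1 ?ler1n// invr_ge0 mulr_ge0 ?powR_ge0// ltW.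
  rewrite invf_le1 ?mulr_gt0 ?powR_gt0//; apply: (@le_trans _ _ (1 * 1)); first by rewrite mulr1.
  rewrite ler_pM//; apply: le_trans (le1r_powR _ Q1); by rewrite ler1n.
have p20 : 0 < p / 2 < p by apply/andP; split; have := p0; lra.
pose be := Q - (p - p / 2).
have be0 : 0 < be by rewrite /be; move: p0 pQ; lra.
have beQ : be <= Q by rewrite /be; have := p0; lra.
have mC0 : 0 < m / C by exact: divr_gt0.
have k0 : 0 < m / C / 2 by exact: divr_gt0.
pose r j := C' * 2 ^+ j.+1.
have r0 j : 0 < r j by rewrite mulr_gt0// exprn_gt0.
(* From [N] on, the annulus outside [E'] lies in [G], and [G] fills at most half of the guaranteed
   measure. *)
have [N NP] : exists N, forall j, (N <= j)%N -> M < r j /\ W <= m * r j `^ Q /\ 1 <= r j.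
  have [N HN] := ltr_exp2 (Num.max M (W / m)).
  exists N => j Nj.
  have rj : 2 ^+ j.+1 <= r j by rewrite /r ler_peMl// exprn_ge0.
  have Nr : 2 ^+ N <= r j.
    apply: le_trans rj; rewrite ler_weXn2l ?ler1n//; exact: leqW.
  have r1 : 1 <= r j by apply: le_trans Nr; rewrite exprn_ege1// ler1n.
  move: HN; rewrite gt_max => /andP[HM HW]; split; first exact: lt_le_trans Nr.
  split => //; rewrite mulrC -ler_pdivrMr//; apply: le_trans (ltW HW) _.
  by apply: le_trans Nr _; exact: le1r_powR.
have [N' N'P] : exists N', forall j, (N' <= j)%N ->
    (hausdorff_content be (E' `&` annulus O (r j)) * ((r j `^ (p / 2))^-1)%:E <
     (m / C / 2)%:E)%E.
  pose f j := (hausdorff_content be (E' `&` annulus O (r j)) *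
    ((r j `^ (p / 2))^-1)%:E)%E.
  have : (fun k => \sum_(k <= j <oo) f j)%E @ \oo --> 0%E := thinE (p / 2) p20.
  have f0 j : (0 <= f j)%E.
    by rewrite mule_ge0 ?hausdorff_content_ge0// lee_fin invr_ge0 powR_ge0.
  move=> /fine_cvgP[[N1 _ N1P] /cvgrPdist_lt/(_ _ k0)[N2 _ N2P]].
  exists (maxn N1 N2) => j; rewrite geq_max => /andP[j1 j2].
  have := N2P j j2; have := N1P j j1.
  rewrite /= sub0r normrN => fin H.
  apply: (@le_lt_trans _ _ (\sum_(j <= i <oo) f i)%E).
    have := @nneseries_lim_ge _ f xpredT j j.+1 (fun i _ _ => f0 i).
    by rewrite big_nat1.
  by rewrite -(fineK fin) lte_fin; apply: le_lt_trans H; exact: ler_norm.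
pose j := maxn N N'.
have [Mr [Wr r1]] := NP j (leq_maxl _ _).
have := N'P j (leq_maxr _ _); rewrite ltNge => /negP; apply.
have mE : ((m * r j `^ Q)%:E <= mu (E' `&` annulus O (r j)))%E.
  have cover : annulus O (r j) `<=` (E' `&` annulus O (r j)) `|` G.
    move=> x xA; have [Ex|nEx] := pselect (E' x); [by left|right].
    apply: MP => //; case: xA => _; rewrite ballEmdist/= => /negP; rewrite -leNgt.
    exact: lt_le_trans.
  have := le_trans (annulus_measure_ge (r0 j)) (le_trans (le_outer_measure mu _ _ cover) (outer_measureU2 mu _ _)).
  have -> : (4 `^ Q * C)^-1 = m + m by rewrite /m -splitr.
  rewrite mulrDl EFinD => H.
  have H2 : (mu G <= (m * r j `^ Q)%:E)%E by apply: le_trans muG _; rewrite lee_fin.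
  have := le_trans H (leeD2l _ H2).
  by rewrite leeD2rE.
have := content_lower_bound C1 ahl be0 beQ (r0 j) m0 mC mE => H.
apply: (@le_trans _ _ ((m / C * r j `^ be)%:E * ((r j `^ (p / 2))^-1)%:E)%E); last first.
  by rewrite lee_wpmul2r// lee_fin invr_ge0 powR_ge0.
rewrite -EFinM lee_fin -[leRHS]mulrA.
apply: (@le_trans _ _ (m / C * 1)).
  by rewrite mulr1; move: (m / C) mC0 => z; lra.
apply: ler_wpM2l; first exact: ltW.
rewrite -powRN -powRD; last by rewrite (gt_eqF (r0 j)) implybT.
(* The weighted content in the annulus is thus at least [m / C * r^(Q - p) >= m / C], since [p <= Q]
   and [r >= 1], while thinness puts it below half of [m / C]. *)
have -> : be + - (p / 2) = Q - p by rewrite /be; field.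
have := ler_powR r1 (_ : 0 <= Q - p); rewrite powRr0; apply.
by rewrite subr_ge0.
Qed.

End Uniqueness.

Lemma bounded_ultra_cvg {R : realType} {X : completeMetricType R}
    (mu : {outer_measure set X -> \bar R}) (Q C : R) :
  @borel R X `<=` mu.-caratheodory -> 1 <= C ->
  (forall (x : X) (r : R), 0 < r ->
    ((r `^ Q / C)%:E <= mu (ball x r) <= (C * r `^ Q)%:E)%E) ->
  forall (F : set_system X) (x0 : X) (K : R),
  ProperFilter F -> (forall A, F A \/ F (~` A)) -> 0 < K -> F (ball x0 K) ->
  exists l : X, F --> l.
Proof.
move=> bc C1 ahl F x0 K FF FU K0 FK.
have cF := ultra_bounded_cauchy bc C1 ahl FF FU K0 FK.
by exists (lim F); exact: cauchy_cvg cF.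
Qed.

Lemma cvg0_at_infinity {R : realType} {X : pmetricType R} (O : X) (D : set X) (u : X -> R) :
  (forall e : R, 0 < e -> exists M, forall x, D x -> M < mdist O x -> `|u x| <= e) ->
  u x @[x --> within D (at_infinity O)] --> (0 : R).
Proof.
move=> H; apply/cvgrPdist_le => e e0; have [M MP] := H e e0.
by exists M => // x Mx Dx; rewrite /= sub0r normrN; exact: MP.
Qed.

Theorem theorem1p7 (R : realType) (Q p : R) (X : completeMetricType R)
    (mu : {outer_measure set X -> \bar R}) (O : X) :
  1 < Q -> 1 <= p ->
  metric_measure_space mu -> unbounded_space X ->
  ahlfors_regular mu Q -> poincare mu p ->
  (Q < p ->
     forall u : X -> R, N1p mu p u -> u x @[x --> at_infinity O] --> (0 : R))
  /\
  (p <= Q ->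
     forall u : X -> R, N1p mu p u ->
       (exists2 E : set X, thin O Q p E &
          u x @[x --> within (~` E) (at_infinity O)] --> (0 : R))
       /\
       (forall (c' : R) (E' : set X), thin O Q p E' ->
          u x @[x --> within (~` E') (at_infinity O)] --> c' -> c' = 0)).
Proof.
move=> Q1 p1 [_ [bc _] _ _] unbX [C C1 ahl] poinc.
have Q0 : 0 < Q by exact: lt_trans Q1.
have p0 : 0 < p by exact: lt_le_trans p1.
have [bpos [Cp [lam [Cp0 lam1 poinc_]]]] := poinc.
have proper := bounded_ultra_cvg bc C1 ahl.
have [K K0 KP] := pointwise_estimate bc C1 ahl p1 Cp0 lam1 poinc_ proper.
pose B n : set X := ball O n.+1%:R.
have oB n : open (B n) by exact: ball_openX.
have muB n : (mu (B n) < +oo)%E by have /andP[] := bpos O n.+1%:R (ltr0Sn _ _).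
have BT : \bigcup_n B n = setT.
  apply/seteqP; split => // x _; exists (Num.truncn (mdist O x)) => //.
  by rewrite /B ballEmdist/=; exact: truncnS_gt.
have majorant (u : X -> R) : N1p mu p u -> exists rho : X -> \bar R,
    [/\ measurable_fun [set: caratheodory_type mu] rho,
      (\int[cara mu]_x (rho x `^ p) < +oo)%E &
      forall (x y : X) (S al S' al' : R), mdist x y < 1 ->
        0 < S -> 0 < al -> al < p -> 0 < S' -> 0 < al' -> al' < p ->
        good mu Q p lam rho x S al -> good mu Q p lam rho y S' al' ->
        `|u x - u y| <= K * (good_bound p S al + good_bound p S' al')].
  move=> [[_ [g ug ig]] _]; have [mg g0 _] := ug.
  have [rho [lrho grho rho0 irho]] := lsc_majorant_power bc oB muB BT p0 mg g0 ig.
  exists rho; split => //.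
    exact: (borel_fun_cara bc (lsc_borel_measurable lrho)).
  by move=> x y S al S' al'; exact: (KP u g rho x y S al S' al' ug lrho rho0 grho).
split=> [Qp u Nu|pQ u Nu]; have [rho [mrho irho est]] := majorant u Nu; have uL := Nu.2.
  apply/cvgrPdist_le => eps eps0.
  suff [M MP] : exists M, forall x, setT x -> M < mdist O x -> `|u x| <= eps.
    by exists M => // x Mx; rewrite /= sub0r normrN; exact: MP.
  apply: (decay bc C1 ahl p1 lam1 mrho irho uL K0 est) eps0 => e e0.
  have pQ0 : 0 < p - Q by rewrite subr_gt0.
  have pQp : p - Q < p by rewrite gtrBl.
  have /andP[_ q1] := good_ratio p1 pQ0.
  have c0 : 0 < 1 - 2^-1 `^ ((p - Q) / p) :> R by rewrite subr_gt0.
  have ec0 : 0 < e * (1 - 2^-1 `^ ((p - Q) / p)) by rewrite mulr_gt0.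
  (* Solves [good_bound p S (p - Q) = e]. *)
  pose S := (e * (1 - 2^-1 `^ ((p - Q) / p))) `^ p.
  have S0 : 0 < S by rewrite powR_gt0.
  have [M _ MP] : exists2 M, 0 < M &
      forall x, M < mdist O x -> good mu Q p lam rho x S (p - Q).
    exact: eventually_good.
  exists M => x _ /MP gx; exists S, (p - Q).
  split => //; rewrite /S /good_bound -powRrM divff ?gt_eqF// powRr1 ?(ltW ec0)//.
  by rewrite mulfK// gt_eqF.
split.
  exists (exceptional mu Q p lam O rho); first exact: (exceptional_thin bc C1 ahl).
  apply: cvg0_at_infinity.
  apply: (decay bc C1 ahl p1 lam1 mrho irho uL K0 est) => e e0.
  exact: not_exceptional_good.
have sphere (a : R) : 0 < a -> exists z, mdist O z = a.
  by move=> a0; exact: (sphere_nonempty bc O p0 unbX poinc a0).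
by move=> c' E' thinE'; exact: (limit_off_thin_eq0 C1 ahl (ltW Q1) p1 pQ sphere uL thinE').
Qed.
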